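(* Let $\mathbb L\in\{\mathbb R,\mathbb C\}$, $\mathbb K\in\{\mathbb R,\mathbb L\}$, $k\in\mathbb N$, $r\in\mathbb N_0\cup\{\infty,\omega\}$. Let $E_1,\ldots,E_k$ and $F$ be locally convex $\mathbb L$-vector spaces, $X$ be a locally convex $\mathbb K$-vector space, and $U\subseteq X$ be an open subset. Let $f\colon U\to L^k_{\mathbb L}(E_1,\ldots,E_k,F)$ be a map such that $$f^\wedge\colon U\times E_1\times\cdots\times E_k\to F,\quad f^\wedge(x,v):=f(x)(v)\ \text{ for } x\in U,\ v\in E_1\times\cdots\times E_k,$$ is $C^r_{\mathbb K}$. Then the following holds: (a) $f$ is $C^r_{\mathbb K}$ as a map to $L^k_{\mathbb L}(E_1,\ldots,E_k,F)_c$. (b) If $r\ge 1$, then $f$ is $C^{r-1}_{\mathbb K}$ as a map to $L^k_{\mathbb L}(E_1,\ldots,E_k,F)_b$. Furthermore, $$d^jf(x,y_1,\ldots,y_j)(v)=d^j(f^\wedge)((x,v),(y_1,0),\ldots,(y_j,0))$$ for all $j\in\mathbb N$ with $j\le r$ (resp., $j\le r-1$ in the situation of (b)), all $x\in U$, $v\in E_1\times\cdots\times E_k$, and $y_1,\ldots,y_j\in X$.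
   Context: All locally convex spaces are Hausdorff. $\mathbb N=\{1,2,\ldots\}$, $\mathbb N_0=\mathbb N\cup\{0\}$; the order is extended by $n<\infty<\omega$ for $n\in\mathbb N_0$, and $\infty\pm k:=\infty$, $\omega\pm k:=\omega$ for $k\in\mathbb N$. Complex locally convex spaces are regarded as real ones when $\mathbb K=\mathbb R$. Differential calculus (Keller's $C^r_c$-theory): Let $E,F$ be locally convex $\mathbb K$-vector spaces, $U\subseteq E$ open. For $r\in\mathbb N_0\cup\{\infty\}$, a map $f\colon U\to F$ is $C^r_{\mathbb K}$ if it is continuous and, for all $j\in\mathbb N$ with $j\le r$, the iterated directional derivatives $d^jf(x,y_1,\ldots,y_j):=(D_{y_j}\cdots D_{y_1}f)(x)$ exist for all $(x,y_1,\ldots,y_j)\in U\times E^j$ and $d^jf\colon U\times E^j\to F$ is continuous; here $(D_yf)(x)=\lim_{t\to0}\frac{f(x+ty)-f(x)}{t}$ with $t\in\mathbb K\setminus\{0\}$. A map $f$ is $C^\omega_{\mathbb C}$ (complex analytic) if it is continuous and for each $x\in U$ there is a $0$-neighbourhood $Y\subseteq E$ with $x+Y\subseteq U$ and $f(x+y)=\sum_{n=0}^\infty\beta_n(y)$ pointwise for $y\in Y$, with continuous complex homogeneous polynomials $\beta_n\colon E\to F$ of degree $n$ (this is equivalent to $C^\infty_{\mathbb C}$). A map $f$ is $C^\omega_{\mathbb R}$ (real analytic) if it extends to a complex analytic map to $F_{\mathbb C}$ on an open neighbourhood of $U$ in the complexification $E_{\mathbb C}$. $L^k_{\mathbb L}(E_1,\ldots,E_k,F)$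 is the space of continuous $k$-linear (over $\mathbb L$) maps $E_1\times\cdots\times E_k\to F$; the subscript $c$ (resp. $b$) means that it is endowed with the topology of uniform convergence on compact (resp. bounded) subsets of $E_1\times\cdots\times E_k$. *)

(* Defs.v *)
From HB Require Import structures.
From mathcomp Require Import all_boot all_order all_algebra.
From mathcomp Require Import all_classical all_reals all_analysis.
From mathcomp.real_closed Require Import complex.

Set Implicit Arguments.
Unset Strict Implicit.
Unset Printing Implicit Defensive.

Import Order.TTheory GRing.Theory Num.Theory.
Import numFieldNormedType.Exports.

Local Open Scope classical_set_scope.
Local Open Scope ring_scope.

Section ConvexBasis.
Context (K : numFieldType).

Lemma convex_setP (E : lmodType K) (A : set E) :
  convex_set (A : set (convex_lmodType E)) <->
  (forall x y (t : K), 0 <= t <= 1 -> A x -> A y ->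
     A (t *: x + (1 - t) *: y)).
Proof.
split=> [cA x y t t01 Ax Ay|cA x y l xA yA].
  have := cA x y (Itv01 (proj1 (andP t01)) (proj2 (andP t01))) (mem_set Ax)
    (mem_set Ay).
  by move=> /set_mem.
apply/mem_set; apply: cA; [|exact: set_mem|exact: set_mem].
by rewrite ge0 le1.
Qed.

Lemma convex_nbhs_basis (E : preTopologicalLmodType K) :
  continuous (fun x : E * E => x.1 + x.2) ->
  continuous (fun z : K^o * E => z.1 *: z.2) ->
  (forall (x : E) (U : set E), nbhs x U ->
     exists2 N : set E, convex_set (N : set (convex_lmodType E))
                      & nbhs x N /\ N `<=` U) ->
  exists2 B : set_system E, (forall b, b \in B -> convex_set b) & basis B.
Proof.
move=> addc scalec cvx.
exists [set b : set E | open b /\ convex_set (b : set (convex_lmodType E))].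
  by move=> b /[!inE] -[].
split; first by move=> b [].
move=> x U /cvx[N /convex_setP cN [xN NU]].
exists N°; last by move=> y /interior_subset /NU.
split; last by [].
split; first exact: open_interior.
apply/convex_setP => y z t /andP[t0 t1] Ny Nz.
have [->|tn0] := eqVneq t 0.
  by rewrite scale0r add0r subr0 scale1r.
have contg : continuous (fun w : E => t^-1 *: (w - (1 - t) *: z)).
  move=> w; apply: (@continuous_comp _ _ _ (fun w => (t^-1, w - (1 - t) *: z))
    (fun z : K^o * E => z.1 *: z.2)); last exact: scalec.
  apply: (@cvg_pair _ _ _ _ (nbhs (t^-1 : K^o))); first exact: cvg_cst.
  apply: (@continuous_comp _ _ _ (fun w => (w, - ((1 - t) *: z)))
    (fun x : E * E => x.1 + x.2)); last exact: addc.
  by apply: cvg_pair => /=; [exact: cvg_id|exact: cvg_cst].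
have : nbhs (t *: y + (1 - t) *: z)
    ((fun w : E => t^-1 *: (w - (1 - t) *: z)) @^-1` N).
  by apply: contg; rewrite addrK scalerA mulVf// scale1r.
apply: filterS => w Nw.
have -> : w = t *: (t^-1 *: (w - (1 - t) *: z)) + (1 - t) *: z.
  by rewrite scalerA divff// scale1r subrK.
by apply: cN => //; [rewrite t0 t1|exact: interior_subset].
Qed.

Lemma tvs_convex_nbhs (E : tvsType K) (x : E) (U : set E) : nbhs x U ->
  exists2 N : set E, convex_set (N : set (convex_lmodType E))
                   & nbhs x N /\ N `<=` U.
Proof.
have [B cB [oB Bb]] := @locally_convex K E.
move=> /Bb[b [Bb' bx] bU]; exists b; first by apply: cB; exact: mem_set.
by split => //; apply: open_nbhs_nbhs; split => //; exact: oB.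
Qed.

End ConvexBasis.

Section ProductTvs.
Context (K : numFieldType) (I : finType) (E : I -> tvsType K).
Local Notation P := (prod_topology E).
Implicit Types x y : P.

Let addP x y : P := fun i => x i + y i.
Let oppP x : P := fun i => - x i.
Let zeroP : P := fun i => 0.
Let scaleP (a : K) x : P := fun i => a *: x i.

Let addPA : associative addP.
Proof. by move=> x y z; apply: functional_extensionality_dep => i; exact: addrA. Qed.
Let addPC : commutative addP.
Proof. by move=> x y; apply: functional_extensionality_dep => i; exact: addrC. Qed.
Let add0P : left_id zeroP addP.
Proof. by move=> x; apply: functional_extensionality_dep => i; exact: add0r. Qed.
Let addNP : left_inverse zeroP oppP addP.
Proof. by move=> x; apply: functional_extensionality_dep => i; exact: addNr. Qed.

HB.instance Definition _ := GRing.isZmodule.Build P addPA addPC add0P addNP.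

Let scalePA a b x : scaleP a (scaleP b x) = scaleP (a * b) x.
Proof. by apply: functional_extensionality_dep => i; exact: scalerA. Qed.
Let scale1P : left_id 1 scaleP.
Proof. by move=> x; apply: functional_extensionality_dep => i; exact: scale1r. Qed.
Let scalePDr : right_distributive scaleP +%R.
Proof. by move=> a x y; apply: functional_extensionality_dep => i; exact: scalerDr. Qed.
Let scalePDl x : {morph scaleP^~ x : a b / a + b}.
Proof. by move=> a b; apply: functional_extensionality_dep => i; exact: scalerDl. Qed.

HB.instance Definition _ :=
  GRing.Zmodule_isLmodule.Build K P scalePA scale1P scalePDr scalePDl.

Lemma prod_addE x y i : (x + y) i = x i + y i. Proof. by []. Qed.
Lemma prod_scaleE a x i : (a *: x) i = a *: x i. Proof. by []. Qed.


Lemma prod_cvg (F : set_system P) (x : P) : Filter F ->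
  (forall i, (fun y : P => y i) @ F --> x i) -> F --> x.
Proof.
move=> FF h; apply/cvg_sup => i U [_ [[A oA <-] Ax] AU].
by apply: (filterS AU); apply: (h i); exact: open_nbhs_nbhs.
Qed.

Lemma nbhs_prodP x (U : set P) : nbhs x U <->
  exists2 V : forall i, set (E i), (forall i, nbhs (x i) (V i))
    & [set y | forall i, V i (y i)] `<=` U.
Proof.
split=> [|[V xV VU]]; last first.
  apply: (@filterS _ _ (nbhs_filter x) _ _ VU).
  suff h : \forall y \near x, forall i, V i (y i) by exact: h.
  have := @filter_forall P I (fun i y => V i (y i)) (nbhs x) (nbhs_filter x).
  apply=> i.
  by apply: (@proj_continuous I E i x); exact: xV.
pose F : set_system P := filter_from
  [set V : forall i, set (E i) | forall i, nbhs (x i) (V i)]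
  (fun V => [set y | forall i, V i (y i)]).
have FF : Filter F.
  apply: filter_from_filter; first by exists (fun=> setT) => i; exact: filterT.
  move=> V W xV xW; exists (fun i => V i `&` W i).
    by move=> i; apply: filterI.
  by move=> y VWy; split=> i; have [] := VWy i.
suff : F --> x by apply.
apply: prod_cvg => i W xW.
exists (dfwith (fun=> setT) i W).
  by move=> j /=; case: dfwithP => // *; exact: filterT.
by move=> y /(_ i) /=; rewrite dfwithin.
Qed.

Let prod_add_continuous : continuous (fun x : P * P => x.1 + x.2).
Proof.
move=> [x y]; apply: prod_cvg => i /=.
apply: (@cvg_comp _ _ _ (fun z : P * P => (z.1 i, z.2 i))
  (fun z : E i * E i => z.1 + z.2) (nbhs (x, y)) (nbhs (x i, y i))); last first.
  exact: (@add_continuous (E i) (x i, y i)).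
apply: (@cvg_pair _ _ _ (nbhs (x, y)) (nbhs (x i)) (nbhs (y i))).
  by apply: (@cvg_comp _ _ _ fst (fun y : P => y i) _ (nbhs x));
    [exact: cvg_fst|exact: (@proj_continuous I E i)].
by apply: (@cvg_comp _ _ _ snd (fun y : P => y i) _ (nbhs y));
  [exact: cvg_snd|exact: (@proj_continuous I E i)].
Qed.

Let prod_scale_continuous : continuous (fun z : K^o * P => z.1 *: z.2).
Proof.
move=> [a x]; apply: prod_cvg => i /=.
apply: (@cvg_comp _ _ _ (fun z : K^o * P => (z.1, z.2 i))
  (fun z : K^o * E i => z.1 *: z.2) (nbhs (a, x)) (nbhs (a, x i))); last first.
  exact: (@scale_continuous K (E i) (a, x i)).
apply: (@cvg_pair _ _ _ (nbhs (a, x)) (nbhs (a : K^o)) (nbhs (x i))).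
  exact: cvg_fst.
by apply: (@cvg_comp _ _ _ snd (fun y : P => y i) _ (nbhs x));
  [exact: cvg_snd|exact: (@proj_continuous I E i)].
Qed.

HB.instance Definition _ :=
  PreTopologicalNmodule_isTopologicalNmodule.Build P prod_add_continuous.
HB.instance Definition _ :=
  TopologicalNmodule_isTopologicalLmodule.Build K P prod_scale_continuous.

Let prod_locally_convex :
  exists2 B : set_system P, (forall b, b \in B -> convex_set b) & basis B.
Proof.
apply: convex_nbhs_basis => //.
move=> x U /nbhs_prodP[V xV VU].
have /(_ _)/cid2-/all_sig2[N cN] i := tvs_convex_nbhs (xV i).
move=> /all_and2[xN NV].
exists [set y | forall i, N i (y i)]; last first.
  split; first by apply/nbhs_prodP; exists N.
  by move=> y Ny; apply: VU => i; exact: NV.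
apply/convex_setP => y z t t01 Ny Nz i.
by have /convex_setP := cN i; apply.
Qed.

HB.instance Definition _ := Uniform_isTvs.Build K P prod_locally_convex.

End ProductTvs.

Section MultilinearMaps.
Context (K : numFieldType) (I : finType).

Definition multilinear (E : I -> lmodType K) (F : lmodType K)
    (f : (forall i, E i) -> F) :=
  forall i v, linear (fun x : E i => f (dfwith v i x)).

Context (E : I -> tvsType K) (F : tvsType K).

Definition cmlin_pred : {pred prod_topology E -> F} :=
  fun f => `[< multilinear f /\ continuous f >].

(* The space $L^k(E_1, \ldots, E_k, F)$, still without a topology. *)
Record contMultilinear := ContMultilinear {
  cmlin_fun :> prod_topology E -> F ;
  _ : cmlin_fun \in cmlin_pred }.

HB.instance Definition _ := [isSub for cmlin_fun].
HB.instance Definition _ := [Choice of contMultilinear by <:].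

Lemma cmlin_submod : submod_closed cmlin_pred.
Proof.
split; first apply/asboolP.
  split; last exact: cst_continuous.
  by move=> i v a x y; rewrite scaler0 addr0.
move=> a f g /asboolP[mf cf] /asboolP[mg cg]; apply/asboolP; split.
  move=> i v b x y.
  change (a *: f (dfwith v i (b *: x + y)) + g (dfwith v i (b *: x + y)) =
    b *: (a *: f (dfwith v i x) + g (dfwith v i x)) +
    (a *: f (dfwith v i y) + g (dfwith v i y))).
  rewrite (mf i v b x y) (mg i v b x y) !scalerDr !scalerA (mulrC a b).
  by rewrite addrACA.
move=> x.
apply: (@cvg_comp _ _ _ (fun x => (a *: f x, g x)) (fun z : F * F => z.1 + z.2)
  _ (nbhs (a *: f x, g x))); last exact: (@add_continuous F (_, _)).
apply: (@cvg_pair _ _ _ (nbhs x) (nbhs (a *: f x)) (nbhs (g x)));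
  last exact: cg.
apply: (@cvg_comp _ _ _ (fun x => (a, f x)) (fun z : K^o * F => z.1 *: z.2)
  _ (nbhs (a, f x))); last exact: (@scale_continuous K F (_, _)).
by apply: (@cvg_pair _ _ _ (nbhs x) (nbhs (a : K^o)) (nbhs (f x)));
  [exact: cvg_cst|exact: cf].
Qed.

HB.instance Definition _ :=
  GRing.isSubmodClosed.Build K (prod_topology E -> F) cmlin_pred cmlin_submod.
HB.instance Definition _ := [SubChoice_isSubLmodule of contMultilinear by <:].

Lemma cmlin_multilinear (f : contMultilinear) : multilinear f.
Proof. by case: f => f /= /asboolP[]. Qed.

Lemma cmlin_continuous (f : contMultilinear) : continuous f.
Proof. by case: f => f /= /asboolP[]. Qed.

Lemma cmlin_addE (f g : contMultilinear) v : (f + g) v = f v + g v.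
Proof. by []. Qed.

Lemma cmlin_oppE (f : contMultilinear) v : (- f) v = - f v.
Proof. by []. Qed.

Lemma cmlin_scaleE a (f : contMultilinear) v : (a *: f) v = a *: f v.
Proof. by []. Qed.

Lemma multilinear_scale (f : prod_topology E -> F) (c : K) v :
  multilinear f -> f (c *: v) = c ^+ #|I| *: f v.
Proof.
move=> mf.
pose w (s : seq I) : prod_topology E := fun i => if i \in s then c *: v i else v i.
have ws s : uniq s -> f (w s) = c ^+ size s *: f v.
  elim: s => [_|i s ih /= /andP[nis us]].
    by rewrite scale1r; congr f; apply: functional_extensionality_dep.
  have -> : w (i :: s) = dfwith (w s) i (c *: v i).
    apply: functional_extensionality_dep => j; rewrite /w inE.
    by case: dfwithP => [|j' nj]; rewrite ?eqxx// eq_sym (negbTE nj).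
  have := mf i (w s) c (v i) 0; rewrite addr0 => ->.
  have -> : f (dfwith (w s) i (v i)) = f (w s).
    congr f; apply: functional_extensionality_dep => j.
    by case: dfwithP => [|j' nj]//; rewrite /w (negbTE nis).
  have -> : f (dfwith (w s) i 0) = 0.
    have := mf i (w s) 1 0 0; rewrite scaler0 addr0 scale1r.
    by move=> /eqP; rewrite -subr_eq0 opprD addNKr oppr_eq0 => /eqP.
  by rewrite addr0 ih// scalerA exprS.
have <- : w (enum I) = c *: v.
  by apply: functional_extensionality_dep => i; rewrite /w mem_enum.
by rewrite ws ?enum_uniq// -cardE.
Qed.

End MultilinearMaps.

(* $B$ is bounded if $c B \subseteq W$ for all sufficiently small scalars $c$,
   for each 0-neighbourhood $W$, i.e. if every 0-neighbourhood absorbs $B$. *)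
Definition tvs_bounded (K : numFieldType) (E : tvsType K) (B : set E) :=
  forall W : set E, nbhs 0 W ->
    \forall c \near (0 : K), forall x, B x -> W (c *: x).

Lemma compact_tvs_bounded (K : numFieldType) (E : tvsType K) (B : set E) :
  compact B -> tvs_bounded B.
Proof.
move=> /compact_near_coveringP cB W W0.
apply: (cB K (nbhs (0 : K)) (fun c x => W (c *: x))) => x Bx.
have := @scale_continuous K E (0, x) W; rewrite /= scale0r => /(_ W0).
case=> -[A1 A2] /= [A10 A2x] AW; exists (A2, A1) => //= -[y c] /= [A2y A1c].
exact: (AW (c, y)).
Qed.

Variant convergence_mode := on_compact | on_bounded.

Definition mode_sets (K : numFieldType) (E : tvsType K) (m : convergence_mode) :
    set (set E) :=
  match m with on_compact => compact | on_bounded => @tvs_bounded K E end.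

Section ModeSets.
Context (K : numFieldType) (E : tvsType K) (m : convergence_mode).

Lemma mode_sets0 : mode_sets m (@set0 E).
Proof.
by case: m => /=; [exact: compact0|move=> W _; near=> c].
Unshelve. all: by end_near. Qed.

Lemma mode_setsU (A B : set E) :
  mode_sets m A -> mode_sets m B -> mode_sets m (A `|` B).
Proof.
case: m => /=; first exact: compactU.
move=> bA bB W W0; near=> c => x [Ax|Bx].
  by move: x Ax; near: c; exact: bA.
by move: x Bx; near: c; exact: bB.
Unshelve. all: by end_near. Qed.

Lemma mode_sets_bounded (A : set E) : mode_sets m A -> tvs_bounded A.
Proof. by case: m => //=; exact: compact_tvs_bounded. Qed.

End ModeSets.

Lemma cmlin_bounded (K : numFieldType) (I : finType) (E : I -> tvsType K)
    (F : tvsType K) (f : contMultilinear E F) (B : set (prod_topology E)) :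
  tvs_bounded B -> forall W, nbhs 0 W ->
    \forall c \near (0 : K), forall v, B v -> W (c *: f v).
Proof.
move=> bB W W0.
have := @scale_continuous K F (0, f 0) W; rewrite /= scale0r => /(_ W0).
case=> -[A1 A2] /= [A10 A2x] AW.
have /bB : nbhs (0 : prod_topology E) (f @^-1` A2) by exact: cmlin_continuous.
move=> /nbhs_ballP[e /= e0 eB].
pose d := e / 2.
have d0 : 0 < d by rewrite divr_gt0.
have dB v : B v -> A2 (d ^+ #|I| *: f v).
  rewrite -multilinear_scale; last exact: cmlin_multilinear.
  apply: eB; rewrite /ball/= sub0r normrN gtr0_norm//.
  by rewrite /d ltr_pdivrMr// ltr_pMr// ltr1n.
have : nbhs (0 : K) [set c | A1 (c / d ^+ #|I|)].
  have : (fun c => c / d ^+ #|I| : K) @ (0 : K) --> (0 / d ^+ #|I| : K).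
    exact: (@cvgMr_tmp K K (nbhs (0 : K)) (nbhs_filter (0 : K)) id 0 (d ^+ #|I|)^-1 (fun A h => h)).
  by rewrite mul0r; apply.
apply: filterS => c /= Ac v Bv.
have -> : c *: f v = (c / d ^+ #|I|) *: (d ^+ #|I| *: f v).
  by rewrite scalerA divfK// expf_neq0// gt_eqF.
by apply: (AW (_, _)); split => //=; exact: dB.
Qed.

(* $L^k(E_1, \ldots, E_k, F)_c$ and $L^k(E_1, \ldots, E_k, F)_b$. The topology is
   defined from the 0-neighbourhoods of $F$ and not as [{family _, _ -> F}]: the
   uniform structure of a [tvsType] need not be translation invariant. *)
Definition multilinSpace (m : convergence_mode) (K : numFieldType) (I : finType)
  (E : I -> tvsType K) (F : tvsType K) : Type := contMultilinear E F.

Section MultilinearSpaceTvs.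
Context (m : convergence_mode) (K : numFieldType) (I : finType)
  (E : I -> tvsType K) (F : tvsType K).
Local Notation L := (multilinSpace m E F).

HB.instance Definition _ := GRing.Lmodule.on L.

Definition multilinSpace_nbhs (f : L) : set_system L :=
  filter_from [set BW : set (prod_topology E) * set F |
                 mode_sets m BW.1 /\ nbhs 0 BW.2]
    (fun BW => [set g : L | forall v, BW.1 v -> BW.2 (g v - f v)]).

HB.instance Definition _ := hasNbhs.Build L multilinSpace_nbhs.

Lemma multilin_nbhsP (f : L) (A : set L) : nbhs f A <->
  exists B : set (prod_topology E), exists W : set F,
  [/\ mode_sets m B, nbhs 0 W & forall g : L, (forall v, B v -> W (g v - f v)) -> A g].
Proof.
split; first by move=> [[B W] /= [? ?] ?]; exists B, W.
by move=> [B [W [? ? ?]]]; exists (B, W).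
Qed.

Let half (W : set F) : nbhs 0 W ->
  exists2 V, nbhs 0 V & forall x y, V x -> V y -> W (x + y).
Proof.
move=> W0; have := @add_continuous F (0, 0) W; rewrite /= addr0 => /(_ W0).
case=> -[A1 A2] /= [A10 A20] AW; exists (A1 `&` A2); first exact: filterI.
by move=> x y [A1x _] [_ A2y]; apply: (AW (x, y)).
Qed.

Let L_filter (f : L) : ProperFilter (nbhs f).
Proof.
apply: Build_ProperFilter_ex.
  move=> A /multilin_nbhsP[B [W [_ W0 BWA]]]; exists f; apply: BWA => v _.
  by rewrite subrr; exact: nbhs_singleton.
apply: filter_from_filter.
  by exists (set0, setT); split => /=; [exact: mode_sets0|exact: filterT].
move=> [B V] [B' V'] /= [mB V0] [mB' V'0]; exists (B `|` B', V `&` V').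
  by split => /=; [exact: mode_setsU|exact: filterI].
by move=> g /= gP; split => v Bv; [have [] := gP v (or_introl Bv)
  |have [] := gP v (or_intror Bv)].
Qed.

Let L_singleton (f : L) (A : set L) : nbhs f A -> A f.
Proof.
move=> /multilin_nbhsP[B [W [_ W0 BWA]]]; apply: BWA => v _.
by rewrite subrr; exact: nbhs_singleton.
Qed.

Let L_nbhs (f : L) (A : set L) : nbhs f A -> nbhs f (nbhs^~ A).
Proof.
move=> /multilin_nbhsP[B [W [mB W0 BWA]]]; have [V V0 VW] := half W0.
apply/multilin_nbhsP; exists B, V; split => // g gf.
apply/multilin_nbhsP; exists B, V; split => // h hg; apply: BWA => v Bv.
by rewrite -(subrKA (g v)); apply: VW; [exact: hg|exact: gf].
Qed.

HB.instance Definition _ :=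
  Nbhs_isNbhsTopological.Build L L_filter L_singleton L_nbhs.

Let L_add : continuous (fun x : L * L => x.1 + x.2).
Proof.
move=> [f g] A /multilin_nbhsP[B [W [mB W0 BWA]]]; have [V V0 VW] := half W0.
exists ([set h : L | forall v, B v -> V (h v - f v)],
        [set h : L | forall v, B v -> V (h v - g v)]).
  by split; apply/multilin_nbhsP; exists B, V.
move=> [f' g'] /= [ff' gg']; apply: BWA => v Bv.
rewrite !cmlin_addE opprD addrACA; apply: VW; [exact: ff'|exact: gg'].
Qed.

Let L_scale : continuous (fun z : K^o * L => z.1 *: z.2).
Proof.
move=> [a f] A /multilin_nbhsP[B [W [mB W0 BWA]]]; have [V V0 VW] := half W0.
have := @scale_continuous K F (a, 0) V; rewrite /= scaler0 => /(_ V0).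
case=> -[A1 A2] /= [A1a A20] AV.
have fB := cmlin_bounded f (mode_sets_bounded mB) V0.
exists (A1 `&` [set b | forall v, B v -> V ((b - a) *: f v)],
        [set h : L | forall v, B v -> A2 (h v - f v)]).
  split; last by apply/multilin_nbhsP; exists B, A2.
  apply: filterI => //=.
  move: fB => /nbhs_ballP[e /= e0 eB]; apply/nbhs_ballP; exists e => //= b ab.
  by apply: eB; move: ab; rewrite /ball/= sub0r normrN distrC.
move=> [b g] /= [[A1b bf] fg]; apply: BWA => v Bv.
rewrite !cmlin_scaleE.
have -> : b *: g v - a *: f v = b *: (g v - f v) + (b - a) *: f v.
  by rewrite scalerBr scalerBl addrA subrK.
by apply: VW; [apply: (AV (_, _)); split => //=; exact: fg|exact: bf].
Qed.

Let L_locally_convex :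
  exists2 B : set_system L, (forall b, b \in B -> convex_set b) & basis B.
Proof.
apply: convex_nbhs_basis => //.
move=> f A /multilin_nbhsP[B [W [mB W0 BWA]]].
have [N /convex_setP cN [N0 NW]] := tvs_convex_nbhs W0.
exists [set g : L | forall v, B v -> N (g v - f v)]; last first.
  split; first by apply/multilin_nbhsP; exists B, N.
  by move=> g /= gN; apply: BWA => v Bv; apply: NW; exact: gN.
apply/convex_setP => g h t t01 gN hN v Bv.
have -> : (t *: g + (1 - t) *: h) v - f v =
    t *: (g v - f v) + (1 - t) *: (h v - f v).
  rewrite !scalerBr addrACA -opprD -scalerDl addrC.
  by rewrite [t + _]addrC subrK scale1r addrC.
by apply: cN => //; [exact: gN|exact: hN].
Qed.

HB.instance Definition _ :=
  PreTopologicalLmod_isTvs.Build K L L_add L_scale L_locally_convex.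
HB.instance Definition _ :=
  PreTopologicalNmodule_isTopologicalNmodule.Build L L_add.
HB.instance Definition _ :=
  TopologicalNmodule_isTopologicalLmodule.Build K L L_scale.
HB.instance Definition _ := Uniform_isTvs.Build K L L_locally_convex.

End MultilinearSpaceTvs.

Variant scalars := Reals | Complexes.

Definition scal (R : realType) (K : scalars) : numFieldType :=
  match K with Reals => R | Complexes => R[i] end.

(* An element of [subfield K L] says that $K$ is $\mathbb R$ or $L$. *)
Variant subfield : scalars -> scalars -> Type :=
| real_subfield L : subfield Reals L
| self_subfield L : subfield L L.

Definition scal_incl (R : realType) (K L : scalars) (s : subfield K L) :
    scal R K -> scal R L :=
  match s with
  | real_subfield Reals => id
  | real_subfield Complexes => real_complex R
  | self_subfield _ => id
  end.

Section ScalarInclusion.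
Context (R : realType) (K L : scalars) (s : subfield K L).
Local Notation incl := (@scal_incl R K L s).

Lemma scal_incl1 : incl 1 = 1.
Proof. by case: s => -[]. Qed.

Lemma scal_inclM a b : incl (a * b) = incl a * incl b.
Proof. by case: s a b => -[] //=; exact: rmorphM. Qed.

Lemma scal_inclD a b : incl (a + b) = incl a + incl b.
Proof. by case: s a b => -[] //=; exact: rmorphD. Qed.

Lemma scal_inclB1 a : incl (1 - a) = 1 - incl a.
Proof. by case: s a => -[] //= a; rewrite rmorphB rmorph1. Qed.

Lemma scal_incl_ge0 a : 0 <= a -> 0 <= incl a.
Proof. by case: s a => -[] //= a; rewrite lecR. Qed.

Lemma scal_incl_continuous : continuous incl.
Proof.
case: s => -[] /=; do ?[by move=> x; exact: cvg_id].
move=> x A /nbhs_ballP[e /= e0 eA].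
have [er re] : exists r : R, e = r%:C%C.
  by exists (complex.Re e); rewrite RRe_real// ger0_real// ltW.
move: e0 eA; rewrite {}re => e0 eA.
apply/nbhs_ballP; exists er => /=; first by rewrite -ltcR.
move=> y; rewrite -!ball_normE /= => xy; apply: eA.
rewrite -!ball_normE /= -rmorphB /= normc_def /= expr0n /= addr0 sqrtr_sqr.
by rewrite ltcR.
Qed.

End ScalarInclusion.

(* A locally convex L-vector space, regarded as one over K. *)
Definition restrictScal (R : realType) (K L : scalars) (s : subfield K L)
  (E : tvsType (scal R L)) : Type := E.

Section RestrictScalars.
Context (R : realType) (K L : scalars) (s : subfield K L)
  (E : tvsType (scal R L)).
Local Notation E' := (restrictScal s E).

HB.instance Definition _ := Uniform.on E'.
HB.instance Definition _ := GRing.Zmodule.on E'.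

Let scaleE' (a : scal R K) (x : E') : E' := scal_incl s a *: (x : E).

Let scaleA a b (x : E') : scaleE' a (scaleE' b x) = scaleE' (a * b) x.
Proof. by rewrite /scaleE' scalerA scal_inclM. Qed.
Let scale1 : left_id 1 scaleE'.
Proof. by move=> x; rewrite /scaleE' scal_incl1 scale1r. Qed.
Let scaleDr : right_distributive scaleE' +%R.
Proof. by move=> a x y; exact: scalerDr. Qed.
Let scaleDl x : {morph scaleE'^~ x : a b / a + b}.
Proof. by move=> a b; rewrite /scaleE' scal_inclD; exact: scalerDl. Qed.

HB.instance Definition _ := GRing.Zmodule_isLmodule.Build (scal R K) E'
  scaleA scale1 scaleDr scaleDl.

Lemma restrictScalE (a : scal R K) (x : E') :
  a *: x = (scal_incl s a *: (x : E)) :> E.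
Proof. by []. Qed.

Let E'_add : continuous (fun x : E' * E' => x.1 + x.2).
Proof. exact: (@add_continuous E). Qed.

Let E'_scale : continuous (fun z : (scal R K)^o * E' => z.1 *: z.2).
Proof.
move=> [a x].
apply: (@cvg_comp _ _ _ (fun z : (scal R K)^o * E' => (scal_incl s z.1, z.2))
  (fun z : (scal R L)^o * E => z.1 *: z.2) (nbhs (a, x))
  (nbhs (scal_incl s a, x))); last exact: (@scale_continuous _ E (_, _)).
apply: (@cvg_pair _ _ _ (nbhs (a, x)) (nbhs (scal_incl s a : (scal R L)^o))
  (nbhs x)); last exact: cvg_snd.
by apply: (@cvg_comp _ _ _ fst (scal_incl s) _ (nbhs a));
  [exact: cvg_fst|exact: scal_incl_continuous].
Qed.

Let E'_locally_convex :
  exists2 B : set_system E', (forall b, b \in B -> convex_set b) & basis B.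
Proof.
apply: convex_nbhs_basis => // x U xU.
have [N /convex_setP cN NU] := @tvs_convex_nbhs _ E x U xU.
exists N => //; apply/convex_setP => y z t /andP[t0 t1] Ny Nz.
rewrite !restrictScalE scal_inclB1; apply: cN => //.
by rewrite scal_incl_ge0//= -subr_ge0 -scal_inclB1 scal_incl_ge0// subr_ge0.
Qed.

HB.instance Definition _ :=
  PreTopologicalNmodule_isTopologicalNmodule.Build E' E'_add.
HB.instance Definition _ :=
  TopologicalNmodule_isTopologicalLmodule.Build (scal R K) E' E'_scale.
HB.instance Definition _ := Uniform_isTvs.Build (scal R K) E' E'_locally_convex.

End RestrictScalars.

(* $E_{\mathbb C} = E \oplus iE$; the pair (x, y) stands for x + iy. *)
Definition complexification (R : realType) (E : tvsType R) : Type := (E * E)%type.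

Section Complexification.
Context (R : realType) (E : tvsType R).
Local Notation Ec := (complexification E).

HB.instance Definition _ := Uniform.on Ec.
HB.instance Definition _ := GRing.Zmodule.on Ec.

Let scaleC (a : R[i]) (z : Ec) : Ec :=
  (complex.Re a *: z.1 - complex.Im a *: z.2, complex.Re a *: z.2 + complex.Im a *: z.1).

Let scaleA a b z : scaleC a (scaleC b z) = scaleC (a * b) z.
Proof.
case: a b z => [a a'] [b b'] [x y]; rewrite /scaleC /=; congr pair.
  rewrite scalerBr scalerDr scalerBl scalerDl !scalerA !opprD.
  by rewrite (addrC (- ((a' * b) *: y))) addrACA.
rewrite scalerBr scalerDr scalerBl scalerDl !scalerA.
by rewrite (addrC ((a' * b) *: x)) addrACA.
Qed.
Let scale1 : left_id 1 scaleC.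
Proof. by move=> [x y]; rewrite /scaleC /= !scale1r !scale0r subr0 addr0. Qed.
Let scaleDr : right_distributive scaleC +%R.
Proof.
move=> a [x y] [x' y']; rewrite /scaleC /=; congr pair => /=.
  by rewrite !scalerDr opprD addrACA.
by rewrite !scalerDr addrACA.
Qed.
Let scaleDl z : {morph scaleC^~ z : a b / a + b}.
Proof.
case: z => x y a b; rewrite /scaleC /=; congr pair => /=.
  by rewrite !raddfD/= !scalerDl opprD addrACA.
by rewrite !raddfD/= !scalerDl addrACA.
Qed.

HB.instance Definition _ := GRing.Zmodule_isLmodule.Build R[i] Ec
  scaleA scale1 scaleDr scaleDl.

Lemma complexification_scaleE (a : R[i]) (z : Ec) :
  a *: z = (complex.Re a *: z.1 - complex.Im a *: z.2, complex.Re a *: z.2 + complex.Im a *: z.1).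
Proof. by []. Qed.

Let Ec_add : continuous (fun x : Ec * Ec => x.1 + x.2).
Proof. exact: (@add_continuous (E * E)%type). Qed.


Let Re_continuous : continuous (@complex.Re R : R[i]^o -> R).
Proof.
move=> x A /nbhs_ballP[e /= e0 eA]; apply/nbhs_ballP.
exists (e%:C)%C => /=; first by rewrite ltcR.
move=> y; rewrite -ball_normE /= => xy; apply: eA; rewrite -ball_normE /=.
by rewrite -ltcR (le_lt_trans _ xy)// -raddfB normc_ge_Re.
Qed.

Let Im_continuous : continuous (@complex.Im R : R[i]^o -> R).
Proof.
move=> x A /nbhs_ballP[e /= e0 eA]; apply/nbhs_ballP.
exists (e%:C)%C => /=; first by rewrite ltcR.
move=> y; rewrite -ball_normE /= => xy; apply: eA; rewrite -ball_normE /=.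
rewrite -ltcR (le_lt_trans _ xy)// -raddfB normc_def lecR -sqrtr_sqr.
by rewrite ler_wsqrtr// lerDr sqr_ge0.
Qed.

Let add_cvg (T : Type) (F : set_system T) (f g : T -> E) (x y : E) : Filter F ->
  f @ F --> x -> g @ F --> y -> (fun t => f t + g t) @ F --> x + y.
Proof.
move=> FF fx gy; apply: (@cvg_comp _ _ _ (fun t => (f t, g t))
  (fun z : E * E => z.1 + z.2) F (nbhs (x, y))).
  exact: (@cvg_pair _ _ _ F (nbhs x) (nbhs y)).
exact: (@add_continuous E (x, y)).
Qed.

Let scale_cvg (T : Type) (F : set_system T) (c : T -> R) (f : T -> E)
  (a : R) (x : E) : Filter F ->
  c @ F --> a -> f @ F --> x -> (fun t => c t *: f t) @ F --> a *: x.
Proof.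
move=> FF ca fx; apply: (@cvg_comp _ _ _ (fun t => (c t, f t))
  (fun z : R^o * E => z.1 *: z.2) F (nbhs (a, x))).
  exact: (@cvg_pair _ _ _ F (nbhs (a : R^o)) (nbhs x)).
exact: (@scale_continuous R E (a, x)).
Qed.

Let Ec_scale : continuous (fun z : R[i]^o * Ec => z.1 *: z.2).
Proof.
move=> [a [x y]].
pose F := nbhs ((a, (x, y)) : R[i]^o * (E * E)).
have FF : Filter F := nbhs_filter _.
have re : (fun z : R[i]^o * (E * E) => complex.Re z.1) @ F --> complex.Re a.
  by apply: (@cvg_comp _ _ _ fst (@complex.Re R) F (nbhs a));
    [exact: cvg_fst|exact: Re_continuous].
have im : (fun z : R[i]^o * (E * E) => complex.Im z.1) @ F --> complex.Im a.
  by apply: (@cvg_comp _ _ _ fst (@complex.Im R) F (nbhs a));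
    [exact: cvg_fst|exact: Im_continuous].
have sndF : (fun z : R[i]^o * (E * E) => z.2) @ F --> (x, y) by exact: cvg_snd.
have cx : (fun z : R[i]^o * (E * E) => z.2.1) @ F --> x.
  apply: (@cvg_comp _ _ _ snd fst F (nbhs (x, y))); [exact: sndF|exact: cvg_fst].
have cy : (fun z : R[i]^o * (E * E) => z.2.2) @ F --> y.
  apply: (@cvg_comp _ _ _ snd snd F (nbhs (x, y))); [exact: sndF|exact: cvg_snd].
have cNr c f (b : R) (z : E) : c @ F --> b -> f @ F --> z ->
    (fun t => - (c t *: f t)) @ F --> - (b *: z).
  move=> cb fz; apply: (@cvg_comp _ _ _ _ -%R F (nbhs (b *: z))).
    exact: scale_cvg.
  exact: (@opp_continuous E (b *: z)).
apply: (@cvg_pair _ _ _ F (nbhs (complex.Re a *: x - complex.Im a *: y))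
  (nbhs (complex.Re a *: y + complex.Im a *: x))).
  by apply: add_cvg; [exact: scale_cvg|exact: cNr].
by apply: add_cvg; exact: scale_cvg.
Qed.

Let Ec_locally_convex :
  exists2 B : set_system Ec, (forall b, b \in B -> convex_set b) & basis B.
Proof.
apply: convex_nbhs_basis => // x U xU.
have [N /convex_setP cN NU] := @tvs_convex_nbhs _ (E * E)%type x U xU.
exists N => //; apply/convex_setP => y z t t01 Ny Nz.
have [re im] : complex.Im t = 0 /\ complex.Im (1 - t) = 0.
  by move: t01 => /andP[/ger0_Im t0 /[!lecE]/= _]; split; rewrite ?raddfB/= ?t0 ?subr0.
rewrite !complexification_scaleE re im !scale0r !subr0 !addr0.
have /andP[t0 t1] := t01; have := cN y z (complex.Re t).
move: t0 t1; rewrite !lecE /= => /andP[_ t0] /andP[_ t1].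
rewrite t0 t1 => /(_ isT Ny Nz); rewrite raddfB/=.
by [].
Qed.

HB.instance Definition _ :=
  PreTopologicalNmodule_isTopologicalNmodule.Build Ec Ec_add.
HB.instance Definition _ :=
  TopologicalNmodule_isTopologicalLmodule.Build R[i] Ec Ec_scale.
HB.instance Definition _ := Uniform_isTvs.Build R[i] Ec Ec_locally_convex.

End Complexification.

(* The orders of differentiability $\mathbb N_0 \cup \{\infty, \omega\}$. *)
Variant smoothness := finite_order of nat | infinite_order | analytic_order.

Definition order_le (j : nat) (r : smoothness) : bool :=
  if r is finite_order n then (j <= n)%N else true.

(* only meaningful for r >= 1 *)
Definition order_pred (r : smoothness) : smoothness :=
  if r is finite_order n then finite_order n.-1 else r.

(* Maps on a subset U are represented by total functions; on open sets U, none
   of the notions below depends on the values outside U. *)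
Section KellerCalculus.
Context (K : numFieldType) (E F : tvsType K).
Implicit Types (f : E -> F) (x y : E).

(* [derive] is only available on normed modules. *)
Definition is_dirderiv f y x (l : F) :=
  (fun t : K => t^-1 *: (f (x + t *: y) - f x)) @ 0^' --> l.

Definition dirderivable f y x := exists l, is_dirderiv f y x l.

(* the value of the limit if it exists, else 0 *)
Definition dirderiv f y x : F := xget 0 (is_dirderiv f y x).

Fixpoint iter_dirderiv f (ys : seq E) : E -> F :=
  if ys is y :: ys' then iter_dirderiv (dirderiv f y) ys' else f.

Fixpoint iter_dirderivable (U : set E) f (ys : seq E) : Prop :=
  if ys is y :: ys' then
    (forall x, U x -> dirderivable f y x) /\
    iter_dirderivable U (dirderiv f y) ys'
  else True.

(* $d^j f(x, y_1, \ldots, y_j) = (D_{y_j} \cdots D_{y_1} f)(x)$ *)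
Definition dpow (j : nat) f x (y : prod_topology (fun _ : 'I_j => E)) : F :=
  iter_dirderiv f [seq y i | i <- enum 'I_j] x.

Definition keller_smooth (r : smoothness) (U : set E) f :=
  {within U, continuous f} /\
  forall j, (0 < j)%N -> order_le j r ->
    (forall y : 'I_j -> E, iter_dirderivable U f [seq y i | i <- enum 'I_j]) /\
    {within U `*` setT, continuous (fun p => @dpow j f p.1 p.2)}.

Definition homogeneous_poly (n : nat) (b : E -> F) :=
  exists2 B : ('I_n -> E) -> F,
    multilinear (E := fun=> E) B & forall y, b y = B (fun=> y).

End KellerCalculus.

Definition complex_analytic (R : realType) (E F : tvsType R[i])
    (U : set E) (f : E -> F) :=
  {within U, continuous f} /\
  forall x, U x -> exists Y : set E,
    [/\ nbhs 0 Y, forall y, Y y -> U (x + y)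
      & exists2 b : nat -> E -> F,
          forall n, homogeneous_poly n (b n) /\ continuous (b n)
        & forall y, Y y -> (fun N => \sum_(n < N) b n y) @ \oo --> f (x + y)].

Definition real_analytic (R : realType) (E F : tvsType R)
    (U : set E) (f : E -> F) :=
  exists (V : set (complexification E))
         (g : complexification E -> complexification F),
    [/\ open V, forall x, U x -> V (x, 0), complex_analytic V g
      & forall x, U x -> g (x, 0) = (f x, 0)].

Definition analytic (R : realType) (K : scalars) :
    forall E F : tvsType (scal R K), set E -> (E -> F) -> Prop :=
  match K with
  | Reals => @real_analytic R
  | Complexes => @complex_analytic R
  end.

(* $f$ is $C^r_{\mathbb K}$ on $U$ *)
Definition smooth (R : realType) (K : scalars) (E F : tvsType (scal R K))
    (r : smoothness) (U : set E) (f : E -> F) :=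
  if r is analytic_order then analytic U f else keller_smooth r U f.

Section Proposition.
Context (R : realType) (K L : scalars) (s : subfield K L) (k : nat)
  (E : 'I_k -> tvsType (scal R L)) (F : tvsType (scal R L))
  (X : tvsType (scal R K)).

(* $f^\wedge$, between locally convex K-vector spaces *)
Definition uncurried (f : X -> contMultilinear E F)
    (p : X * restrictScal s (prod_topology E)) : restrictScal s F :=
  f p.1 p.2.

(* $f$ as a map to $L^k_L(E_1, \ldots, E_k, F)_c$, resp. $\ldots_b$, the latter
   being regarded as a locally convex K-vector space *)
Definition into (m : convergence_mode) (f : X -> contMultilinear E F) :
  X -> restrictScal s (multilinSpace m E F) := f.

End Proposition.

Arguments uncurried {R K L} s {k E F X} f p.
Arguments into {R K L} s {k E F X} m f.

(* Main.v *)
Require Import Defs.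
From mathcomp Require Import all_boot all_order all_algebra.
From mathcomp Require Import all_classical all_reals all_analysis.
From mathcomp.real_closed Require Import complex.
From mathcomp Require Import ring lra zify.
From mathcomp Require cyclic separable cyclotomic.
Import Order.TTheory GRing.Theory Num.Theory.
Import numFieldNormedType.Exports.
Local Open Scope classical_set_scope.
Local Open Scope ring_scope.

Set Implicit Arguments.
Unset Strict Implicit.
Unset Printing Implicit Defensive.

(* Fix v. The curve x |-> f(x)(v) has the directional derivatives of f^ along the
   vectors (y, 0), which are again k-linear in v. Hence the difference quotients of
   f converge in the function space as soon as they converge uniformly on the sets
   B defining the topology, which the mean value theorem reduces to a uniform
   continuity statement for d f^. For compact B the latter is the tube lemma. For
   bounded B one uses that c B lies in a given 0-neighbourhood W for some c > 0,
   rescales v by c and y by c^(-k), and pays with one more derivative.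

   If f^ is complex analytic, its expansion at (x, 0) is k-linear in v degree by
   degree, by uniqueness of power series, so it is an expansion of f with values in
   the function space. Cauchy estimates in y, with v in a rescaled copy c B of B,
   make it converge uniformly on B, so no order is lost even for bounded B.
   If f^ is real analytic with complex analytic extension g, the
   expansions of g at the points ((x, 0), 0) are k-linear in v: for real directions
   by uniqueness, and for complex ones because a polynomial in z is determined by
   its values at real z. Hence g itself comes from a map to the complexified
   function space near U, and the complex case applies to that map. *)

(** * Identities in modules *)

(** The spaces are not assumed complete, so neither derivatives nor sums of series can be produced
    as limits of Cauchy nets, and no integrals are available: every limit is first known pointwise
    in v, recognised as a continuous multilinear map, and only then shown to be attained uniformly
    on B. The Cauchy estimates accordingly come from finite averages over roots of unity, and the
    mean value inequality from a supremum argument for one seminorm. The multilinear form behind a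
    homogeneous polynomial is assumed neither continuous nor symmetric; a form with values in the
    function space is rebuilt by polarization. Two scalar structures meet on the values. For K = R
    and L = C the real analytic case complexifies F, and F_C then carries a new i besides the old
    complex structure of F: linearity in v refers to the old one, analyticity to the new one. Hence
    the abstract record [function_space] with a separate action [act]; it is instantiated by the
    given space of multilinear maps and again by its complexification. *)

Section LinearExpressions.
Variables (K : nzRingType) (V : lmodType K).

(** Syntax of linear expressions for the tactic [lmod_eq], which reduces an identity in a module to
    one scalar identity per atom; these are left to [ring]. *)
Inductive lexpr :=
| LVar of nat | LZero | LAdd of lexpr & lexpr | LOpp of lexpr | LScale of K & lexpr.

Fixpoint lvar (xs : seq V) (n : nat) : V :=
  match xs, n with
  | x :: _, O => x
  | _ :: xs, S n => lvar xs n
  | [::], _ => 0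
  end.

Fixpoint leval (xs : seq V) (e : lexpr) : V :=
  match e with
  | LVar n => lvar xs n
  | LZero => 0
  | LAdd a b => leval xs a + leval xs b
  | LOpp a => - leval xs a
  | LScale c a => c *: leval xs a
  end.

(** A private comparison of indices: [lmod_eq] can unfold it without touching anything inside the
    scalars. *)
Fixpoint nat_eq (m n : nat) : bool :=
  match m, n with
  | O, O => true
  | S m, S n => nat_eq m n
  | _, _ => false
  end.

Fixpoint lcoef (i : nat) (e : lexpr) : K :=
  match e with
  | LVar n => if nat_eq n i then 1 else 0
  | LZero => 0
  | LAdd a b => lcoef i a + lcoef i b
  | LOpp a => - lcoef i a
  | LScale c a => c * lcoef i a
  end.

Fixpoint lcond (n : nat) (a b : lexpr) : Prop :=
  match n with
  | O => True
  | S m => lcoef m a = lcoef m b /\ lcond m a b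
  end.

Lemma leval_coef xs e : leval xs e = \sum_(i < size xs) lcoef i e *: lvar xs i.
Proof.
elim: e => /= [n||a -> b ->|a ->|c a ->].
- elim: xs n => [|x xs ih] [|n] /=; rewrite ?big_ord0// big_ord_recl /=.
    by rewrite scale1r big1 ?addr0// => i _; rewrite scale0r.
  by rewrite scale0r add0r ih.
- by rewrite big1// => i _; rewrite scale0r.
- by rewrite -big_split; apply: eq_bigr => i _; rewrite scalerDl.
- by rewrite -sumrN; apply: eq_bigr => i _; rewrite scaleNr.
- by rewrite scaler_sumr; apply: eq_bigr => i _; rewrite scalerA.
Qed.

Lemma leval_eq xs a b : lcond (size xs) a b -> leval xs a = leval xs b.
Proof.
move=> h; rewrite !leval_coef; apply: eq_bigr => i _; congr (_ *: _).
case: i => i /=; elim: (size xs) h => //= n ih [e h].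
by rewrite ltnS leq_eqVlt => /predU1P[->|/ih->].
Qed.

End LinearExpressions.

Ltac lmod_index x xs :=
  match xs with
  | cons x _ => constr:(O)
  (* Atoms that differ syntactically are still identified when they are convertible. *)
  | cons ?y _ => let _ := constr:(erefl _ : x = y) in constr:(O)
  | cons _ ?t => let n := lmod_index x t in constr:(S n)
  end.
Ltac lmod_insert x xs :=
  match constr:(Set) with
  | _ => let _ := lmod_index x xs in xs
  | _ => constr:(cons x xs)
  end.
Ltac lmod_atoms e xs :=
  lazymatch e with
  | (?a + ?b)%R => let xs := lmod_atoms a xs in lmod_atoms b xs
  | (- ?a)%R => lmod_atoms a xs
  | (_ *: ?a)%R => lmod_atoms a xs
  | 0%R => xs
  | _ => lmod_insert e xs
  end.
Ltac lmod_reify K e xs :=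
  lazymatch e with
  | (?a + ?b)%R =>
    let a' := lmod_reify K a xs in let b' := lmod_reify K b xs in
    constr:(@LAdd K a' b')
  | (- ?a)%R => let a' := lmod_reify K a xs in constr:(@LOpp K a')
  | (?c *: ?a)%R => let a' := lmod_reify K a xs in constr:(@LScale K c a')
  | 0%R => constr:(@LZero K)
  | _ => let n := lmod_index e xs in constr:(@LVar K n)
  end.
Ltac lmod_eq K :=
  lazymatch goal with
  | |- @eq ?T ?u ?v =>
    let V := constr:((T : lmodType K)) in
    let xs := lmod_atoms u (@nil T) in
    let xs := lmod_atoms v xs in
    let a := lmod_reify K u xs in
    let b := lmod_reify K v xs in
    change (@leval K V xs a = @leval K V xs b);
    apply: leval_eq; cbv beta iota zeta delta [size lcond lcoef nat_eq];
    repeat split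
  end.

(** * Scalars and continuous seminorms *)

Section Scalars.
Context (R : realType) (K : scalars).

Definition rinc : R -> scal R K := scal_incl (real_subfield K).

(** The norm of [R[i]] takes its values in [R[i]]. A modulus with real values lets all estimates run
    in [R], where [lra] and suprema apply, for both choices of scalars. *)
Definition sabs : scal R K -> R :=
  match K return scal R K -> R with
  | Reals => fun c => `|c|
  | Complexes => fun c => complex.Re `|c|
  end.

Lemma rinc1 : rinc 1 = 1. Proof. exact: scal_incl1. Qed.
Lemma rincM a b : rinc (a * b) = rinc a * rinc b.
Proof. exact: scal_inclM. Qed.
Lemma rincD a b : rinc (a + b) = rinc a + rinc b.
Proof. exact: scal_inclD. Qed.
Lemma rinc0 : rinc 0 = 0.
Proof. by apply: (addrI (rinc 0)); rewrite -rincD !addr0. Qed.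
Lemma rincN a : rinc (- a) = - rinc a.
Proof. by apply: (addrI (rinc a)); rewrite -rincD !subrr rinc0. Qed.
Lemma rincB a b : rinc (a - b) = rinc a - rinc b.
Proof. by rewrite rincD rincN. Qed.
Lemma rincV a : rinc a^-1 = (rinc a)^-1.
Proof.
have [->|a0] := eqVneq a 0; first by rewrite invr0 rinc0 invr0.
have aV : rinc a * rinc a^-1 = 1 by rewrite -rincM divff// rinc1.
by rewrite -[LHS]mul1r -(@mulVf _ (rinc a)) ?mulfK -?mulrA ?aV ?mulr1//;
  apply: contra_eq_neq aV => ->; rewrite mul0r eq_sym oner_eq0.
Qed.
Lemma rincX a n : rinc (a ^+ n) = rinc a ^+ n.
Proof. by elim: n => [|n ih]; rewrite ?expr0 ?rinc1// !exprS rincM ih. Qed.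

Lemma sabs_norm c : rinc (sabs c) = `|c|.
Proof. by rewrite /rinc /sabs; case: K c. Qed.

Lemma rinc_le a b : (rinc a <= rinc b) = (a <= b).
Proof. by rewrite /rinc; case: K => //=; rewrite lecR. Qed.
Lemma rinc_inj : injective rinc.
Proof. by move=> a b ab; apply/eqP; rewrite eq_le -!rinc_le ab lexx. Qed.
Lemma rinc_lt a b : (rinc a < rinc b) = (a < b).
Proof. by rewrite !lt_neqAle rinc_le (inj_eq rinc_inj). Qed.
Lemma rinc_eq0 a : (rinc a == 0) = (a == 0).
Proof. by rewrite -rinc0 (inj_eq rinc_inj). Qed.
Lemma rinc_norm a : `|rinc a| = rinc `|a|.
Proof.
have [a0|a0] := leP 0 a.
  have ra : 0 <= rinc a by rewrite -[X in X <= _]rinc0 rinc_le.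
  by rewrite (ger0_norm ra) (ger0_norm a0).
have ra : rinc a < 0 by rewrite -[X in _ < X]rinc0 rinc_lt.
by rewrite (ltr0_norm ra) (ltr0_norm a0) rincN.
Qed.

Lemma sabs_ge0 c : 0 <= sabs c.
Proof. by rewrite -rinc_le rinc0 sabs_norm. Qed.
Lemma sabsM c d : sabs (c * d) = sabs c * sabs d.
Proof. by apply: rinc_inj; rewrite rincM !sabs_norm normrM. Qed.
Lemma sabs_rinc a : sabs (rinc a) = `|a|.
Proof. by apply: rinc_inj; rewrite sabs_norm rinc_norm. Qed.
Lemma sabs_eq0 c : (sabs c == 0) = (c == 0).
Proof. by rewrite -rinc_eq0 sabs_norm normr_eq0. Qed.
Lemma sabs1 : sabs 1 = 1.
Proof. by rewrite -rinc1 sabs_rinc normr1. Qed.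
Lemma sabs0 : sabs 0 = 0.
Proof. by apply/eqP; rewrite sabs_eq0. Qed.
Lemma sabsV c : sabs c^-1 = (sabs c)^-1.
Proof. by apply: rinc_inj; rewrite rincV !sabs_norm normfV. Qed.
Lemma sabsX c n : sabs (c ^+ n) = sabs c ^+ n.
Proof. by elim: n => [|n ih]; rewrite ?expr0 ?sabs1// !exprS sabsM ih. Qed.
Lemma sabsN c : sabs (- c) = sabs c.
Proof. by apply: rinc_inj; rewrite !sabs_norm normrN. Qed.
Lemma sabsD c d : sabs (c + d) <= sabs c + sabs d.
Proof. by rewrite -rinc_le rincD !sabs_norm ler_normD. Qed.

Lemma rinc_continuous : continuous rinc.
Proof. by move=> x; exact: (@scal_incl_continuous R Reals K (real_subfield K) x). Qed.

Lemma sabs_near0 (e : R) : 0 < e -> \forall c \near (0 : scal R K), sabs c < e.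
Proof.
move=> e0; apply/nbhs_ballP; exists (rinc e); first by rewrite /= -rinc0 rinc_lt.
by move=> c; rewrite -ball_normE /= sub0r normrN -sabs_norm rinc_lt.
Qed.

Lemma near0_sabs (A : set (scal R K)) : nbhs 0 A ->
  exists2 e : R, 0 < e & forall c, sabs c < e -> A c.
Proof.
move=> /nbhs_ballP[e /= e0 eA].
have er : rinc (sabs e) = e by rewrite sabs_norm gtr0_norm.
exists (sabs e); first by rewrite -rinc_lt rinc0 er.
move=> c ce; apply: eA; rewrite -ball_normE /= sub0r normrN -er -sabs_norm.
by rewrite rinc_lt.
Qed.

End Scalars.
Arguments rinc {R K} _ : simpl never.
Arguments sabs {R K} _ : simpl never.

Section TvsLemmas.
Context (K : numFieldType).

Lemma cvg_addT (F : tvsType K) T (G : set_system T) (f g : T -> F) (x y : F) : Filter G ->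
  f @ G --> x -> g @ G --> y -> (fun t => f t + g t) @ G --> x + y.
Proof.
move=> FG fx gy; apply: (@cvg_comp _ _ _ (fun t => (f t, g t))
  (fun z : F * F => z.1 + z.2) G (nbhs (x, y))).
  exact: (@cvg_pair _ _ _ G (nbhs x) (nbhs y)).
exact: (@add_continuous F (x, y)).
Qed.

Lemma cvg_scaleT (F : tvsType K) T (G : set_system T) (c : T -> K) (f : T -> F) (a : K) (x : F) :
  Filter G -> c @ G --> a -> f @ G --> x -> (fun t => c t *: f t) @ G --> a *: x.
Proof.
move=> FG ca fx; apply: (@cvg_comp _ _ _ (fun t => (c t, f t))
  (fun z : K^o * F => z.1 *: z.2) G (nbhs (a, x))).
  exact: (@cvg_pair _ _ _ G (nbhs (a : K^o)) (nbhs x)).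
exact: (@scale_continuous K F (a, x)).
Qed.

Lemma cvg_oppT (F : tvsType K) T (G : set_system T) (f : T -> F) (x : F) : Filter G ->
  f @ G --> x -> (fun t => - f t) @ G --> - x.
Proof.
move=> FG fx; apply: (@cvg_comp _ _ _ f -%R G (nbhs x)) => //.
exact: (@opp_continuous F x).
Qed.

Lemma cvg_subT (F : tvsType K) T (G : set_system T) (f g : T -> F) (x y : F) : Filter G ->
  f @ G --> x -> g @ G --> y -> (fun t => f t - g t) @ G --> x - y.
Proof. by move=> FG fx gy; apply: cvg_addT => //; exact: cvg_oppT. Qed.

Lemma cvg_sumT (F : tvsType K) T (G : set_system T) I (r : seq I) (P : pred I)
    (f : I -> T -> F) (l : I -> F) : Filter G ->
  (forall i, P i -> f i @ G --> l i) ->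
  (fun t => \sum_(i <- r | P i) f i t) @ G --> \sum_(i <- r | P i) l i.
Proof.
move=> FG h; elim: r => [|i r ih].
  rewrite big_nil; rewrite [X in X @ _](_ : _ = fun=> 0); first exact: cvg_cst.
  by apply/funext => t; rewrite big_nil.
rewrite big_cons; case: ifPn => Pi; last first.
  rewrite [X in X @ _](_ : _ = fun t => \sum_(i <- r | P i) f i t) //.
  by apply/funext => t; rewrite big_cons (negbTE Pi).
rewrite [X in X @ _](_ : _ = fun t => f i t + \sum_(i <- r | P i) f i t); last first.
  by apply/funext => t; rewrite big_cons Pi.
by apply: cvg_addT => //; exact: h.
Qed.

Lemma nbhs_add (F : tvsType K) (x : F) (A : set F) :
  nbhs x A <-> nbhs 0 [set y | A (x + y)].
Proof.
split => [xA|].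
  have : (fun y => x + y) @ (0 : F) --> x + 0.
    by apply: cvg_addT; [exact: cvg_cst|exact: cvg_id].
  by rewrite addr0 => /(_ _ xA).
move=> h; have : (fun y => y - x) @ x --> x - x.
  by apply: cvg_subT; [exact: cvg_id|exact: cvg_cst].
rewrite subrr => /(_ _ h); apply: (@filterS _ (nbhs x)) => y /=.
by rewrite addrC subrK.
Qed.

Lemma cvg_sub0 (F : tvsType K) T (G : set_system T) {FG : Filter G} (f : T -> F) (x : F) :
  f @ G --> x <-> (fun t => f t - x) @ G --> 0.
Proof.
split => h; first by rewrite -(subrr x); apply: cvg_subT => //; exact: cvg_cst.
have : (fun t => f t - x + x) @ G --> 0 + x by apply: cvg_addT => //; exact: cvg_cst.
rewrite add0r; rewrite (_ : (fun t => _) = f)//.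
by apply/funext => t; rewrite subrK.
Qed.

Lemma cvg_near_eq (F : topologicalType) T (G : set_system T) (f g : T -> F) (x : F) : Filter G ->
  (\forall t \near G, f t = g t) -> f @ G --> x -> g @ G --> x.
Proof.
move=> FG fg fx A xA; have := fx A xA; rewrite /nbhs/= => fA.
by apply: filterS2 fg fA => t /= <-.
Qed.

End TvsLemmas.

Section Seminorms.
Context (R : realType) (K : scalars) (F : tvsType (scal R K)).

Record cont_seminorm (p : F -> R) : Prop := ContSeminorm {
  csn_add : forall x y, p (x + y) <= p x + p y ;
  csn_scale : forall c x, p (c *: x) = sabs c * p x ;
  csn_near : forall e, 0 < e -> \forall x \near (0 : F), p x < e }.

Section Theory.
Variables (p : F -> R) (hp : cont_seminorm p).

Lemma csn0 : p 0 = 0.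
Proof. by rewrite -(scale0r 0) (csn_scale hp) sabs0 mul0r. Qed.
Lemma csnN x : p (- x) = p x.
Proof. by rewrite -scaleN1r (csn_scale hp) sabsN sabs1 mul1r. Qed.
Lemma csn_ge0 x : 0 <= p x.
Proof. by have := csn_add hp x (- x); rewrite subrr csn0 csnN; lra. Qed.
Lemma csn_sub x y : p (x - y) <= p x + p y.
Proof. by rewrite -(csnN y) (csn_add hp). Qed.
Lemma csnB x y : p (x - y) = p (y - x).
Proof. by rewrite -csnN opprB. Qed.
Lemma csn_le x y : p x <= p y + p (x - y).
Proof. by rewrite -{1}(subrK y x) addrC (csn_add hp). Qed.
Lemma csn_sum I (r : seq I) (P : pred I) (f : I -> F) :
  p (\sum_(i <- r | P i) f i) <= \sum_(i <- r | P i) p (f i).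
Proof.
elim/big_rec2: _ => [|i a b _ ab]; first by rewrite csn0.
by rewrite (le_trans (csn_add hp _ _))// lerD2l.
Qed.
Lemma csn_rinc c x : p (rinc c *: x) = `|c| * p x.
Proof. by rewrite (csn_scale hp) sabs_rinc. Qed.
Lemma csn_nbhs e : 0 < e -> nbhs 0 [set x | p x < e].
Proof. exact: (csn_near hp). Qed.
Lemma csn_cvg T (G : set_system T) {FG : Filter G} (f : T -> F) (l : F) (e : R) :
  f @ G --> l -> 0 < e -> \forall t \near G, p (f t - l) < e.
Proof. by move=> /cvg_sub0 fl e0; exact: (fl _ (csn_nbhs e0)). Qed.
End Theory.

(* The gauge of a convex balanced 0-neighbourhood inside N: the set of the x
   such that c x is in N for all |c| <= 1 is convex and balanced. *)
Lemma csn_exists (U : set F) : nbhs 0 U ->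
  exists2 p, cont_seminorm p & forall x, p x < 1 -> U x.
Proof.
move=> /tvs_convex_nbhs[N /convex_setP cN [N0 NU]].
pose B : set F := [set x | forall c : scal R K, sabs c <= 1 -> N (c *: x)].
have NB : nbhs 0 B.
  have /(_ N) := @scale_continuous _ F (0, 0); rewrite /= scaler0 => /(_ N0).
  case=> -[A1 A2] /= [A10 A20] AN.
  have [e e0 eA] := near0_sabs A10.
  (* For |c| <= 1 the scalar c e / 2 lies in [A1], so c x = (c e / 2) (2 / e) x is in N once (2 / e)
     x is in [A2]. *)
  have : (fun x : F => rinc (2 / e) *: x) @ (0 : F) --> rinc (2 / e) *: (0 : F).
    by apply: cvg_scaleT; [exact: cvg_cst|exact: cvg_id].
  rewrite scaler0 => /(_ _ A20); apply: (@filterS _ (nbhs (0 : F))) => x /= Ax c c1.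
  have -> : c *: x = (c * rinc (e / 2)) *: (rinc (2 / e) *: x).
    rewrite scalerA -mulrA -rincM; have -> : e / 2 * (2 / e) = 1.
      by field; rewrite gt_eqF.
    by rewrite rinc1 mulr1.
  apply: (AN (_, _)); split => //=; apply: eA.
  rewrite sabsM sabs_rinc gtr0_norm; last by lra.
  by have := sabs_ge0 c; nra.
have Bcx x y (t : R) : 0 <= t <= 1 -> B x -> B y -> B (rinc t *: x + rinc (1 - t) *: y).
  move=> /andP[t0 t1] Bx By c c1; rewrite scalerDr !scalerA ![c * _]mulrC -!scalerA.
  rewrite rincB rinc1; apply: cN; [|exact: Bx|exact: By].
  by rewrite -rinc0 -rinc1 !rinc_le t0.
have Bbal c x : sabs c <= 1 -> B x -> B (c *: x).
  move=> c1 Bx d d1; rewrite scalerA; apply: Bx.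
  by rewrite sabsM; have := sabs_ge0 c; have := sabs_ge0 d; nra.
have B0 : B 0 by exact: nbhs_singleton NB.
(* The infimum [p] of these sets is the Minkowski gauge of [B]. *)
pose S x : set R := [set r | 0 < r /\ B (rinc r^-1 *: x)].
have Babs x : S x !=set0.
  have : (fun t : scal R K => t *: x) @ (0 : scal R K) --> (0 : scal R K) *: x.
    by apply: (@cvg_scaleT _ F _ (nbhs (0 : scal R K)) id (fun=> x)); [exact: cvg_id|exact: cvg_cst].
  rewrite scale0r => /(_ _ NB) /near0_sabs[e e0 eB].
  exists (2 / e); split; first by rewrite divr_gt0.
  by apply: eB; rewrite sabs_rinc invf_div ger0_norm; lra.
have lS x : has_inf (S x).
  by split => //; exists 0 => r [/ltW].
pose p x := inf (S x).
have pup x r : 0 < r -> B (rinc r^-1 *: x) -> p x <= r.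
  by move=> r0 Bx; apply: ge_inf; [exact: (lS x).2|split].
have p0 x : 0 <= p x by apply: lb_le_inf => // r [/ltW].
have pB x r : p x < r -> B (rinc r^-1 *: x).
  move=> pr; have r0 : 0 < r by apply: le_lt_trans pr.
  have [|q [q0 Bq] qr] := @inf_adherent _ (S x) (r - p x) _ (lS x).
    by rewrite subr_gt0.
  have -> : rinc r^-1 *: x = rinc (q / r) *: (rinc q^-1 *: x) :> F.
    by rewrite scalerA -rincM mulrAC divff ?gt_eqF// mul1r.
  apply: Bbal => //; rewrite sabs_rinc ger0_norm ?divr_ge0 1?ltW//.
  rewrite ltr_pdivrMr// mul1r; move: qr; rewrite -/(p x); lra.
have padd x y : p (x + y) <= p x + p y.
  apply/ler_addgt0Pr => e e0.
  pose a := p x + e / 2; pose b := p y + e / 2.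
  have a0 : 0 < a by have := p0 x; rewrite /a; lra.
  have b0 : 0 < b by have := p0 y; rewrite /b; lra.
  have -> : p x + p y + e = a + b by rewrite /a /b; lra.
  apply: pup; first by lra.
  have Ba : B (rinc a^-1 *: x) by apply: pB; rewrite /a; lra.
  have Bb : B (rinc b^-1 *: y) by apply: pB; rewrite /b; lra.
  have := Bcx _ _ (a / (a + b)) _ Ba Bb.
  rewrite !scalerA -!rincM.
  have -> : a / (a + b) / a = (a + b)^-1 by field; rewrite !gt_eqF//; lra.
  have -> : (1 - a / (a + b)) / b = (a + b)^-1 by field; rewrite !gt_eqF//; lra.
  rewrite -scalerDr; apply.
  by rewrite divr_ge0 ?ltW//= ?ltr_pdivrMr ?mul1r; lra.
have pscale1 c x : p (c *: x) <= sabs c * p x.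
  have [->|c0] := eqVneq c 0.
    rewrite scale0r sabs0 mul0r; apply/ler_addgt0Pr => e e0; rewrite add0r.
    by apply: pup => //; rewrite scaler0.
  have sc0 : 0 < sabs c by rewrite lt_neqAle sabs_ge0 eq_sym sabs_eq0 c0.
  apply/ler_addgt0Pr => e e0.
  pose r := p x + e / sabs c.
  have r0 : 0 < r by have := p0 x; have := divr_gt0 e0 sc0; rewrite /r; lra.
  have -> : sabs c * p x + e = sabs c * r.
    by rewrite /r mulrDr mulrCA divff ?mulr1// gt_eqF.
  apply: pup; first exact: mulr_gt0.
  have -> : rinc (sabs c * r)^-1 *: (c *: x) =
      (rinc (sabs c)^-1 * c) *: (rinc r^-1 *: x).
    by rewrite !scalerA invfM rincM; congr (_ *: _); rewrite -!mulrA; congr (_ * _); rewrite mulrC.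
  apply: Bbal.
    by rewrite sabsM sabs_rinc ger0_norm ?invr_ge0 ?sabs_ge0// mulVf// gt_eqF.
  apply: pB; have := divr_gt0 e0 sc0; rewrite /r; lra.
have pscale c x : p (c *: x) = sabs c * p x.
  apply/eqP; rewrite eq_le pscale1/=.
  have [->|c0] := eqVneq c 0; first by rewrite sabs0 mul0r p0.
  have sc0 : 0 < sabs c by rewrite lt_neqAle sabs_ge0 eq_sym sabs_eq0 c0.
  have := pscale1 c^-1 (c *: x); rewrite scalerA mulVf// scale1r sabsV.
  by rewrite -ler_pdivlMl// invrK mulrC.
exists p.
  split => // e e0.
  have : (fun x : F => rinc (2 / e) *: x) @ (0 : F) --> rinc (2 / e) *: (0 : F).
    by apply: cvg_scaleT; [exact: cvg_cst|exact: cvg_id].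
  rewrite scaler0 => /(_ _ NB); apply: (@filterS _ (nbhs (0 : F))) => x /= Bx.
  have /pup : B (rinc (e / 2)^-1 *: x) by rewrite invf_div.
  by lra.
move=> x px; apply: NU.
have := pB _ _ px; rewrite invr1 rinc1 scale1r => /(_ 1).
by rewrite sabs1 scale1r; exact.
Qed.

Lemma csn_cvgP T (G : set_system T) (f : T -> F) (l : F) : Filter G ->
  f @ G --> l <->
  forall p, cont_seminorm p -> forall e, 0 < e -> \forall t \near G, p (f t - l) < e.
Proof.
move=> FG; split => [fl p hp e e0|h]; first exact: (csn_cvg hp).
apply/cvg_sub0 => A A0; have [p hp pA] := csn_exists A0.
by apply: filterS (h p hp 1 ltr01) => t /pA.
Qed.

Lemma csn_eq0 : hausdorff_space F -> forall x : F,
  (forall p, cont_seminorm p -> p x = 0) -> x = 0.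
Proof.
move=> hF x px; apply/esym; apply: hF => A B A0 Bx.
have [p hp pB] := csn_exists ((nbhs_add _ _).1 Bx).
exists 0; split; first exact: nbhs_singleton A0.
by rewrite -(subrr x); apply: pB; rewrite csnN// px.
Qed.

End Seminorms.

Lemma tvs_cvg_unique (K : numFieldType) (F : tvsType K) T (G : set_system T) (f : T -> F) (x y : F) :
  hausdorff_space F -> ProperFilter G -> f @ G --> x -> f @ G --> y -> x = y.
Proof. by move=> hF FG fx fy; apply: (cvg_unique hF fx fy). Qed.

(** * Directional derivatives *)

Section MeanValue.
Context (R : realType) (K : scalars) (F : tvsType (scal R K)).
Variables (p : F -> R) (hp : cont_seminorm p).

(** Continuous induction in place of duality. With slack e, the set of s satisfying the estimate p
    (g s - g 0) <= (M + e) s contains its supremum c, by the local bound at c; if c < 1, the same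
    bound produces a larger element. *)
Lemma seminorm_mean_value (g : R -> F) (M : R) :
  (forall e s, 0 < e -> 0 <= s <= 1 -> exists2 d, 0 < d &
     forall s', 0 <= s' <= 1 -> `|s' - s| < d -> p (g s' - g s) <= (M + e) * `|s' - s|) ->
  p (g 1 - g 0) <= M.
Proof.
move=> h; apply/ler_addgt0Pr => e e0.
pose S : set R := [set s | 0 <= s <= 1 /\ p (g s - g 0) <= (M + e) * s].
have S0 : S 0 by split; rewrite ?lexx ?ler01// subrr (csn0 hp) mulr0.
have hS : has_sup S by split; [exists 0|exists 1 => s [/andP[]]].
pose c := sup S.
have c01 : 0 <= c <= 1.
  rewrite (ub_le_sup hS.2 S0)/=; apply: ge_sup; first by exists 0.
  by move=> s [/andP[]].
have [d d0 dP] := h e c e0 c01.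
have Sc : S c.
  split=> //; have [s Ss sc] := sup_adherent d0 hS.
  have sc' : s <= c by exact: ub_le_sup hS.2 _ Ss.
  have sN : `|s - c| = c - s by rewrite ler0_norm ?opprB//; lra.
  have [s01 gs] := Ss.
  have := dP s s01; rewrite sN => /(_ _); rewrite -/c in sc.
  move=> /(_ ltac:(lra)) gsc.
  have -> : g c - g 0 = (g c - g s) + (g s - g 0) by rewrite subrKA.
  rewrite (le_trans (csn_add hp _ _))// (csnB hp); lra.
have [c1|c1] := eqVneq c 1; first by have := Sc.2; rewrite c1 mulr1.
have cl1 : c < 1 by have /andP[_] := c01; rewrite le_eqVlt (negbTE c1).
pose u := Num.min 1 (c + d / 2).
have cu : c < u by rewrite /u lt_min cl1; lra.
have ucd : u <= c + d / 2 by rewrite /u ge_min lexx orbT.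
have u01 : 0 <= u <= 1 by rewrite /u ge_min lexx /= le_min ler01/=; have /andP[] := c01; lra.
have uN : `|u - c| = u - c by rewrite ger0_norm//; lra.
have := dP u u01; rewrite uN => /(_ ltac:(lra)) guc.
suff /(ub_le_sup hS.2) : S u by rewrite -/c; lra.
split=> //; have -> : g u - g 0 = (g u - g c) + (g c - g 0) by rewrite subrKA.
rewrite (le_trans (csn_add hp _ _))//; have := Sc.2; lra.
Qed.

End MeanValue.

Section DirDeriv.
Context (R : realType) (K : scalars) (E F : tvsType (scal R K)).
Implicit Types (f g : E -> F) (x y z : E).
Local Notation k := (scal R K).

(** This first-order form is free of division, and t = 0 satisfies it trivially, so the punctured
    filter disappears from later arguments. *)
Lemma is_dirderivP f y x l : is_dirderiv f y x l <->
  forall p, cont_seminorm p -> forall e, 0 < e -> exists2 d, 0 < d &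
    forall t : k, sabs t < d -> p (f (x + t *: y) - f x - t *: l) <= e * sabs t.
Proof.
split=> [h p hp e e0|h].
  have : nbhs (0 : k) [set t | t != 0 -> p (t^-1 *: (f (x + t *: y) - f x) - l) < e].
    exact (csn_cvg hp h e0).
  move=> /near0_sabs[d d0 dP].
  exists d => // t td; have [->|t0] := eqVneq t 0.
    by rewrite !scale0r addr0 subr0 subrr (csn0 hp) sabs0 mulr0.
  have -> : f (x + t *: y) - f x - t *: l =
      t *: (t^-1 *: (f (x + t *: y) - f x) - l).
    by rewrite [RHS]scalerBr scalerA mulfV// scale1r.
  by rewrite (csn_scale hp) mulrC ler_wpM2r ?sabs_ge0// ltW// dP.
apply/csn_cvgP => p hp e e0.
have [|d d0 dP] := h p hp (e / 2); first by rewrite divr_gt0.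
have := sabs_near0 K d0; rewrite /dnbhs /within /=; apply: filterS => t td t0.
have st0 : 0 < sabs t by rewrite lt_neqAle sabs_ge0 eq_sym sabs_eq0 t0.
have := dP t td; have -> : f (x + t *: y) - f x - t *: l =
    t *: (t^-1 *: (f (x + t *: y) - f x) - l).
  by rewrite [RHS]scalerBr scalerA mulfV// scale1r.
rewrite (csn_scale hp) mulrC ler_pM2r// => /le_lt_trans; apply; lra.
Qed.

Lemma is_dirderiv_unique f y x l l' : hausdorff_space F ->
  is_dirderiv f y x l -> is_dirderiv f y x l' -> l = l'.
Proof. by move=> hF; exact: tvs_cvg_unique. Qed.

Lemma dirderivE f y x l : hausdorff_space F -> is_dirderiv f y x l ->
  dirderiv f y x = l.
Proof.
move=> hF fl; apply: xget_unique => // l' fl'; exact: is_dirderiv_unique fl' fl.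
Qed.

Lemma dirderivP f y x : dirderivable f y x -> is_dirderiv f y x (dirderiv f y x).
Proof. by move=> [l fl]; exact: (xgetPex 0 (ex_intro _ l fl)). Qed.

Lemma segment_near x y z (A : set E) : nbhs x A -> exists2 d, 0 < d &
  forall a b : k, sabs a < d -> sabs b < d -> A (x + a *: y + b *: z).
Proof.
move=> xA.
have : (fun ab : k * k => x + ab.1 *: y + ab.2 *: z) @ (nbhs ((0 : k), (0 : k))) --> x + (0 : k) *: y + (0 : k) *: z.
  apply: cvg_addT; [apply: cvg_addT; first exact: cvg_cst|];
    by apply: cvg_scaleT; [exact: cvg_fst || exact: cvg_snd|exact: cvg_cst].
rewrite !scale0r !addr0 => /(_ _ xA) [[A1 A2] /= [A10 A20] AP].
have [d1 d10 d1P] := near0_sabs A10; have [d2 d20 d2P] := near0_sabs A20.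
exists (Num.min d1 d2); first by rewrite lt_min d10.
move=> a b; rewrite !lt_min => /andP[a1 _] /andP[_ b2].
by apply: (AP (a, b)); split; [exact: d1P|exact: d2P].
Qed.

Lemma eq_is_dirderiv (U : set E) f g y x : open U -> U x -> {in U, f =1 g} ->
  is_dirderiv f y x = is_dirderiv g y x.
Proof.
move=> oU Ux fg; suff h f' g' l : {in U, f' =1 g'} -> is_dirderiv f' y x l ->
    is_dirderiv g' y x l.
  by apply/funext => l; apply/propext; split; apply: h => // z /fg.
move=> {}fg /is_dirderivP h; apply/is_dirderivP => p hp e e0.
have [d d0 dP] := h p hp e e0.
have [d' d'0 d'P] := segment_near y 0 (open_nbhs_nbhs (conj oU Ux)).
exists (Num.min d d'); first by rewrite lt_min d0.
move=> t; rewrite lt_min => /andP[td td'].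
rewrite -!fg ?inE//; first exact: dP.
by have := d'P t 0 td'; rewrite scaler0 addr0; apply; rewrite sabs0.
Qed.

Lemma eq_dirderiv (U : set E) f g y : open U -> {in U, f =1 g} ->
  {in U, dirderiv f y =1 dirderiv g y}.
Proof.
move=> oU fg x; rewrite inE => Ux; rewrite /dirderiv.
by rewrite (eq_is_dirderiv y oU Ux fg).
Qed.

Lemma eq_dirderivable (U : set E) f g y x : open U -> U x -> {in U, f =1 g} ->
  dirderivable f y x -> dirderivable g y x.
Proof.
by move=> oU Ux fg [l]; rewrite (eq_is_dirderiv y oU Ux fg); exists l.
Qed.

Lemma is_dirderivZ f y x l (c : k) : is_dirderiv f y x l ->
  is_dirderiv f (c *: y) x (c *: l).
Proof.
move=> /is_dirderivP h; apply/is_dirderivP => p hp e e0.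
have c0 := sabs_ge0 c.
(* Dividing by [sabs c + 1] spares a separate case for c = 0. *)
have c10 : 0 < sabs c + 1 by lra.
have [|d d0 dP] := h p hp (e / (sabs c + 1)); first by rewrite divr_gt0.
exists (d / (sabs c + 1)); first by rewrite divr_gt0.
move=> t td; rewrite !scalerA.
have t0 := sabs_ge0 t.
have /dP : sabs (t * c) < d.
  by rewrite sabsM; move: td; rewrite ltr_pdivlMr//; nra.
move/le_trans; apply; rewrite sabsM.
have -> : e / (sabs c + 1) * (sabs t * sabs c) = e * sabs t * (sabs c / (sabs c + 1)).
  by field; rewrite gt_eqF.
by rewrite ler_piMr ?mulr_ge0 ?(ltW e0)// ler_pdivrMr// mul1r; lra.
Qed.

Lemma is_dirderiv_lin f g y x l l' (a : k) : is_dirderiv f y x l ->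
  is_dirderiv g y x l' -> is_dirderiv (fun z => a *: f z + g z) y x (a *: l + l').
Proof.
move=> fl gl; rewrite /is_dirderiv.
rewrite [X in X @ _](_ : _ = (fun t : k => a *: (t^-1 *: (f (x + t *: y) - f x)) +
    t^-1 *: (g (x + t *: y) - g x))); last first.
  by apply/funext => t; lmod_eq (scal R K); ring.
by apply: cvg_addT gl; apply: cvg_scaleT fl; exact: cvg_cst.
Qed.

(** The mean value inequality for s |-> f (x + s y) - s c: subtracting c turns a bound on the
    oscillation of the derivative into a bound on the error of the linear approximation. *)
Lemma mean_value f x y (l : R -> F) (c : F) (M : R) (p : F -> R) :
  cont_seminorm p ->
  (forall s, 0 <= s <= 1 -> is_dirderiv f y (x + rinc s *: y) (l s)) ->
  (forall s, 0 <= s <= 1 -> p (l s - c) <= M) ->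
  p (f (x + y) - f x - c) <= M.
Proof.
move=> hp fl lM.
have := @seminorm_mean_value _ _ _ p hp (fun s => f (x + rinc s *: y) - rinc s *: c) M.
rewrite rinc1 rinc0 !scale1r !scale0r addr0 subr0 addrAC; apply.
move=> e s e0 s01; have /is_dirderivP/(_ p hp e e0)[d d0 dP] := fl s s01.
exists d => // s' s'01 ss'.
have := dP (rinc (s' - s)); rewrite sabs_rinc => /(_ ss').
have -> : x + rinc s *: y + rinc (s' - s) *: y = x + rinc s' *: y.
  by rewrite rincB; lmod_eq (scal R K); ring.
set a := f _; set b := f _ => h.
have -> : a - rinc s' *: c - (b - rinc s *: c) =
    (a - b - rinc (s' - s) *: l s) + rinc (s' - s) *: (l s - c).
  by rewrite rincB; lmod_eq (scal R K); ring.
rewrite (le_trans (csn_add hp _ _))// csn_rinc// mulrDl addrC lerD//.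
by rewrite mulrC ler_wpM2r// lM.
Qed.

(** The step t (y + z) is made along t y and then along t z. The first part needs the derivative at
    x only; the second starts at x + t y, whence the mean value inequality and the continuity of [b]
    at x. *)
Lemma is_dirderivD f y z x a (b : E -> F) : is_dirderiv f y x a ->
  (\forall x' \near x, is_dirderiv f z x' (b x')) -> b @ x --> b x ->
  is_dirderiv f (y + z) x (a + b x).
Proof.
move=> /is_dirderivP fy fz cb; apply/is_dirderivP => p hp e e0.
have e20 : 0 < e / 2 by lra.
have [d d0 dP] := fy p hp _ e20.
have bx : \forall x' \near x, p (b x' - b x) < e / 2 by exact (csn_cvg hp cb e20).
have [d' d'0 d'P] := segment_near y z (filterI fz bx).
exists (Num.min d d'); first by rewrite lt_min d0.
move=> t; rewrite lt_min => /andP[td td'].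
have seg s : 0 <= s <= 1 -> sabs (rinc s * t) < d'.
  by move=> /andP[s0 s1]; rewrite sabsM sabs_rinc ger0_norm//; have := sabs_ge0 t; nra.
have h2 : p (f (x + t *: y + t *: z) - f (x + t *: y) - t *: b x) <= sabs t * (e / 2).
  apply: (@mean_value f _ (t *: z) (fun s => t *: b (x + t *: y + rinc s *: (t *: z)))) => // s /seg s01.
    apply: is_dirderivZ.
    by have [] := d'P t (rinc s * t) td' s01; rewrite scalerA.
  rewrite -scalerBr (csn_scale hp) ler_wpM2l ?sabs_ge0//.
  by apply: ltW; have [_] := d'P t (rinc s * t) td' s01; rewrite scalerA.
have h1 := dP t td; set u := f (x + t *: y) in h1 h2.
have -> : f (x + t *: (y + z)) - f x - t *: (a + b x) =
  (f (x + t *: y + t *: z) - u - t *: b x) + (u - f x - t *: a).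
  by rewrite (scalerDr t y z) addrA; lmod_eq (scal R K); ring.
rewrite (le_trans (csn_add hp _ _))// (le_trans (lerD h2 h1))//; lra.
Qed.

End DirDeriv.

Section IteratedDerivatives.
Context (R : realType) (K : scalars) (E F : tvsType (scal R K)).
Context (hF : hausdorff_space F) (U : set E) (oU : open U).
Implicit Types (f g : E -> F) (x y z : E) (ys zs : seq E).
Local Notation k := (scal R K).

Lemma iter_dirderiv_cat f ys zs :
  iter_dirderiv f (ys ++ zs) = iter_dirderiv (iter_dirderiv f ys) zs.
Proof. by elim: ys f => //= y ys ih f. Qed.

Lemma iter_dirderivable_cat f ys zs : iter_dirderivable U f (ys ++ zs) <->
  iter_dirderivable U f ys /\ iter_dirderivable U (iter_dirderiv f ys) zs.
Proof.
elim: ys f => [|y ys ih] f /=; first by split=> [|[]].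
by split=> [[fy /ih[? ?]]|[[fy ?] ?]]; do !split => //; exact/ih.
Qed.

Lemma eq_iter_dirderiv f g ys : {in U, f =1 g} ->
  {in U, iter_dirderiv f ys =1 iter_dirderiv g ys}.
Proof.
elim: ys f g => //= y ys ih f g fg; apply: ih; exact: eq_dirderiv.
Qed.

Lemma eq_iter_dirderivable f g ys : {in U, f =1 g} ->
  iter_dirderivable U f ys -> iter_dirderivable U g ys.
Proof.
elim: ys f g => //= y ys ih f g fg [fy fys]; split=> [x Ux|].
  exact: (eq_dirderivable oU Ux fg) (fy x Ux).
by apply: ih fys; exact: eq_dirderiv.
Qed.

Lemma iter_dirderiv_lin f g (a : k) ys :
  iter_dirderivable U f ys -> iter_dirderivable U g ys ->
  iter_dirderivable U (fun x => a *: f x + g x) ys /\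
  {in U, iter_dirderiv (fun x => a *: f x + g x) ys =1
    (fun x => a *: iter_dirderiv f ys x + iter_dirderiv g ys x)}.
Proof.
elim: ys f g => //= y ys ih f g [fy fys] [gy gys].
have D x : U x -> is_dirderiv (fun x => a *: f x + g x) y x
    (a *: dirderiv f y x + dirderiv g y x).
  by move=> Ux; apply: is_dirderiv_lin; apply: dirderivP; [exact: fy|exact: gy].
have De : {in U, (fun x => a *: dirderiv f y x + dirderiv g y x) =1
    dirderiv (fun x => a *: f x + g x) y}.
  by move=> x; rewrite inE => /D/dirderivE->.
have [h1 h2] := ih _ _ fys gys; split; last first.
  by move=> x Ux; rewrite -h2//; apply/esym; exact: eq_iter_dirderiv De _ Ux.
split=> [x /D Dx|]; first by eexists; exact: Dx.
exact: eq_iter_dirderivable h1.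
Qed.

(** Continuity in x alone, for each fixed list of directions: this is all that linearity in the
    directions requires. *)
Definition dsmooth n f := forall ys, (size ys <= n)%N ->
  iter_dirderivable U f ys /\ {in U, continuous (iter_dirderiv f ys)}.

Lemma dsmooth_dirderiv n f y : dsmooth n.+1 f -> dsmooth n (dirderiv f y).
Proof. by move=> fs ys ysn; have [[]] := fs (y :: ys) ysn. Qed.

Lemma is_dirderiv_comb f a y z x : dsmooth 1 f -> U x ->
  is_dirderiv f (a *: y + z) x (a *: dirderiv f y x + dirderiv f z x).
Proof.
move=> fs Ux; have [/= [fy _] _] := fs [:: y] isT; have [/= [fz _] cz] := fs [:: z] isT.
apply: is_dirderivD; first by apply/is_dirderivZ/dirderivP/fy.
  near=> x'; apply/dirderivP/fz; near: x'; exact: (open_nbhs_nbhs (conj oU Ux)).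
by apply: cz; rewrite inE.
Unshelve. all: by end_near. Qed.

(** The directions in [ys] are absorbed into f until the slot comes first. There [is_dirderiv_comb]
    applies, and the derivatives along [zs] are linear in the function. *)
Lemma iter_dirderiv_comb f a y z ys zs x : dsmooth (size (ys ++ y :: zs)) f -> U x ->
  iter_dirderiv f (ys ++ (a *: y + z) :: zs) x =
  a *: iter_dirderiv f (ys ++ y :: zs) x + iter_dirderiv f (ys ++ z :: zs) x.
Proof.
move=> + Ux; elim: ys f => [|y' ys ih] f /= fs; last first.
  by apply: ih; exact: dsmooth_dirderiv.
have fs1 : dsmooth 1 f by move=> ys ys1; apply: fs; exact: leq_trans ys1 _.
have [_ <-] := @iter_dirderiv_lin (dirderiv f y) (dirderiv f z) a zs
  (dsmooth_dirderiv y fs (leqnn _)).1 (dsmooth_dirderiv z fs (leqnn _)).1; last by rewrite inE.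
apply: eq_iter_dirderiv; last by rewrite inE.
by move=> x'; rewrite inE => Ux'; apply: dirderivE => //; exact: is_dirderiv_comb.
Qed.

End IteratedDerivatives.

(** * Spaces of multilinear maps *)

Section FunctionSpace.
Context (R : realType) (K L : scalars) (I : finType)
  (E : I -> tvsType (scal R L)) (F T : tvsType (scal R K))
  (m : convergence_mode) (ev : T -> prod_topology E -> F)
  (act : scal R L -> F -> F).
Local Notation D := (prod_topology E).

Definition act_multilinear (u : D -> F) := forall i (v : D) (a : scal R L) (x y : E i),
  u (dfwith v i (a *: x + y)) = act a (u (dfwith v i x)) + u (dfwith v i y).

(* T is a space of multilinear maps with the topology of uniform convergence on
   the sets of mode m; act is the action of the scalars of E on the values, which
   need not be the K-scalar multiplication of F. *)
Record function_space : Prop := FunctionSpace {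
  fs_hausdorff : hausdorff_space F ;
  fs_index : (0 < #|I|)%N ;
  fs_lin : forall a t t' v, ev (a *: t + t') v = a *: ev t v + ev t' v ;
  fs_nbhs : forall t A, nbhs t A <-> exists B W,
    [/\ mode_sets m B, nbhs 0 W & forall t', (forall v, B v -> W (ev t' v - ev t v)) -> A t'] ;
  fs_mlin : forall t, act_multilinear (ev t) ;
  fs_cont : forall t, continuous (ev t) ;
  fs_surj : forall u, act_multilinear u -> continuous u -> exists t, ev t = u ;
  fs_inj : injective ev ;
  fs_act_lin : forall c a x y, act c (a *: x + y) = a *: act c x + act c y ;
  fs_act_cont : forall c, continuous (act c) ;
  fs_act_real : forall a x, act (rinc a) x = rinc a *: x }.

Context (S : function_space).

Lemma fs_ev0 v : ev 0 v = 0.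
Proof.
have := fs_lin S 1 0 0 v; rewrite !scale1r addr0 => /eqP.
by rewrite -subr_eq0 opprD addNKr oppr_eq0 => /eqP.
Qed.
Lemma fs_evD t t' v : ev (t + t') v = ev t v + ev t' v.
Proof. by rewrite -[t]scale1r (fs_lin S) !scale1r. Qed.
Lemma fs_evZ a t v : ev (a *: t) v = a *: ev t v.
Proof. by rewrite -[a *: t]addr0 (fs_lin S) fs_ev0 addr0. Qed.
Lemma fs_evN t v : ev (- t) v = - ev t v.
Proof. by rewrite -scaleN1r fs_evZ scaleN1r. Qed.
Lemma fs_evB t t' v : ev (t - t') v = ev t v - ev t' v.
Proof. by rewrite fs_evD fs_evN. Qed.
Lemma fs_ev_sum J (r : seq J) (P : pred J) (f : J -> T) v :
  ev (\sum_(j <- r | P j) f j) v = \sum_(j <- r | P j) ev (f j) v.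
Proof. by apply: (big_morph (ev^~ v)) => [t t'|]; rewrite ?fs_evD ?fs_ev0. Qed.

Lemma act0 c : act c 0 = 0.
Proof.
have := fs_act_lin S c 1 0 0; rewrite !scale1r addr0 => /eqP.
by rewrite -subr_eq0 opprD addNKr oppr_eq0 => /eqP.
Qed.
Lemma actD c x y : act c (x + y) = act c x + act c y.
Proof. by rewrite -[x]scale1r (fs_act_lin S) !scale1r. Qed.
Lemma actZ c a x : act c (a *: x) = a *: act c x.
Proof. by rewrite -[a *: x]addr0 (fs_act_lin S) act0 addr0. Qed.
Lemma actN c x : act c (- x) = - act c x.
Proof. by rewrite -scaleN1r actZ scaleN1r. Qed.
Lemma act1 x : act 1 x = x.
Proof. by have := fs_act_real S 1 x; rewrite !rinc1 scale1r. Qed.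
Lemma act_sum c J (r : seq J) (P : pred J) (f : J -> F) :
  act c (\sum_(j <- r | P j) f j) = \sum_(j <- r | P j) act c (f j).
Proof. by apply: (big_morph (act c)) => [t t'|]; rewrite ?actD ?act0. Qed.

(** Real scalars only, because on these [act] agrees with the scalar multiplication of F. The slots
    are rescaled one after the other; [w s] has those in s done. *)
Lemma act_multilinear_homog u (c : R) v : act_multilinear u ->
  u (rinc c *: v) = rinc (c ^+ #|I|) *: u v.
Proof.
move=> mu.
pose w (s : seq I) : D := fun i => if i \in s then rinc c *: v i else v i.
have ws s : uniq s -> u (w s) = rinc (c ^+ size s) *: u v.
  elim: s => [_|i s ih /= /andP[nis us]].
    by rewrite rinc1 scale1r; congr u; apply: functional_extensionality_dep.
  have -> : w (i :: s) = dfwith (w s) i (rinc c *: v i).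
    apply: functional_extensionality_dep => j; rewrite /w inE.
    by case: dfwithP => [|j' nj]; rewrite ?eqxx// eq_sym (negbTE nj).
  have := mu i (w s) (rinc c) (v i) 0; rewrite addr0 => ->.
  have -> : u (dfwith (w s) i (v i)) = u (w s).
    congr u; apply: functional_extensionality_dep => j.
    by case: dfwithP => [|j' nj]//; rewrite /w (negbTE nis).
  have -> : u (dfwith (w s) i 0) = 0.
    have := mu i (w s) 1 0 0; rewrite scaler0 addr0 act1.
    by move=> /eqP; rewrite -subr_eq0 opprD addNKr oppr_eq0 => /eqP.
  by rewrite addr0 ih// (fs_act_real S) scalerA -rincM exprS.
have <- : w (enum I) = rinc c *: v.
  by apply: functional_extensionality_dep => i; rewrite /w mem_enum.
by rewrite ws ?enum_uniq// -cardE.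
Qed.

(** Homogeneity at c = 0; since there is at least one slot, [0 ^+ #|I|] vanishes. *)
Lemma act_multilinear0 u : act_multilinear u -> u 0 = 0.
Proof.
move=> mu; have := act_multilinear_homog 0 0 mu.
by rewrite rinc0 scale0r expr0n gtn_eqF ?(fs_index S)// rinc0 scale0r.
Qed.

Lemma act_multilinear_cvg J (G : set_system J) {PG : ProperFilter G}
    (h : J -> D -> F) (u : D -> F) :
  (\forall j \near G, act_multilinear (h j)) ->
  (forall v, (fun j => h j v) @ G --> u v) -> act_multilinear u.
Proof.
move=> mh hu i v a x y.
have h1 : (fun j => act a (h j (dfwith v i x)) + h j (dfwith v i y)) @ G -->
    act a (u (dfwith v i x)) + u (dfwith v i y).
  apply: cvg_addT (hu _).
  apply: (@cvg_comp _ _ _ (fun j => h j (dfwith v i x)) (act a) G (nbhs (u (dfwith v i x)))); last exact: (fs_act_cont S).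
  exact: hu.
apply: (tvs_cvg_unique (fs_hausdorff S) PG (hu _)); apply: cvg_near_eq h1.
by apply: filterS mh => j ->.
Qed.

Lemma fs_cvgP J (G : set_system J) {FG : Filter G} (f : J -> T) t :
  f @ G --> t <-> forall B p e, mode_sets m B -> cont_seminorm p -> 0 < e ->
    \forall j \near G, forall v, B v -> p (ev (f j) v - ev t v) < e.
Proof.
split=> [ft B p e mB hp e0|h].
  apply: (ft [set t' | forall v, B v -> p (ev t' v - ev t v) < e]).
  apply/(fs_nbhs S); exists B, [set x | p x < e]; split => //.
  exact: csn_nbhs.
move=> A /(fs_nbhs S)[B [W [mB W0 BW]]].
have [p hp pW] := csn_exists W0.
have := h B p 1 mB hp ltr01; rewrite /nbhs/=; apply: filterS => j Bj.
by apply: BW => v Bv; apply: pW; exact: Bj.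
Qed.

Lemma mode_sets1 (v : D) : mode_sets m [set v].
Proof.
case: m => /=; first exact: compact_set1.
by apply: compact_tvs_bounded; exact: compact_set1.
Qed.

Lemma fs_ev_cvg J (G : set_system J) {FG : Filter G} (f : J -> T) t v :
  f @ G --> t -> (fun j => ev (f j) v) @ G --> ev t v.
Proof.
move=> /fs_cvgP ft; apply/csn_cvgP => p hp e e0.
by apply: filterS (ft _ _ _ (mode_sets1 v) hp e0) => j; exact.
Qed.

Lemma fs_T_hausdorff : hausdorff_space T.
Proof.
move=> t t' tt'; apply: (fs_inj S); apply/funext => v.
apply/eqP; rewrite -subr_eq0; apply/eqP/(csn_eq0 (fs_hausdorff S)) => p hp.
apply/eqP; rewrite eq_le csn_ge0// andbT; apply/ler_addgt0Pr => e e0.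
have nb s : nbhs s [set t'' | p (ev t'' v - ev s v) < e / 2].
  apply/(fs_nbhs S); exists [set v], [set x | p x < e / 2].
  split; [exact: mode_sets1|by apply: csn_nbhs => //; lra|].
  by move=> t''; exact.
have [t'' [/= h1 h2]] := tt' _ _ (nb t) (nb t').
have -> : ev t v - ev t' v = - (ev t'' v - ev t v) + (ev t'' v - ev t' v).
  by lmod_eq (scal R K); ring.
rewrite (le_trans (csn_add hp _ _))// (csnN hp); lra.
Qed.

Lemma mode_sets_absorb (B : set D) (W : set D) : mode_sets m B -> nbhs 0 W ->
  exists2 c : R, 0 < c & forall v, B v -> W (rinc c *: v).
Proof.
move=> /mode_sets_bounded bB /bB /near0_sabs[e e0 eP].
exists (e / 2); first by lra.
by move=> v; apply: eP; rewrite sabs_rinc gtr0_norm; lra.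
Qed.

Section Derivatives.
Context (X : tvsType (scal R K)) (U : set X) (oU : open U).

Lemma nbhsU x : U x -> nbhs x U.
Proof. by move=> Ux; exact: (open_nbhs_nbhs (conj oU Ux)). Qed.

(** Difference quotients of multilinear maps are multilinear, and so is their pointwise limit. *)
Lemma act_multilinear_dirderiv (h : X -> D -> F) y x (h' : D -> F) : U x ->
  (forall x, U x -> act_multilinear (h x)) ->
  (forall v, is_dirderiv (h^~ v) y x (h' v)) -> act_multilinear h'.
Proof.
move=> Ux mh hd.
apply: (@act_multilinear_cvg _ (0^' : set_system (scal R K)) _
  (fun t v => t^-1 *: (h (x + t *: y) v - h x v))) => //.
have [d d0 dU] := segment_near y 0 (nbhsU Ux).
have := sabs_near0 K d0; rewrite /dnbhs /within /=; apply: filterS => t td _.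
have Ut : U (x + t *: y).
  by have := dU t 0 td; rewrite scaler0 addr0; apply; rewrite sabs0.
move=> i v a u w; rewrite (mh _ Ut) (mh _ Ux) actZ actD actN.
by lmod_eq (scal R K); ring.
Qed.

(** The pointwise derivative is multilinear as a limit and continuous by hypothesis, so it is
    represented by an element of T. The last hypothesis is the uniform continuity that the mean
    value inequality turns into convergence in T. *)
Lemma fs_dirderiv (f : X -> T) y x (h : X -> D -> F) : U x ->
  (forall x v, U x -> is_dirderiv (fun x => ev (f x) v) y x (h x v)) ->
  continuous (h x) ->
  (forall B p e, mode_sets m B -> cont_seminorm p -> 0 < e -> exists2 d, 0 < d &
    forall t : scal R K, sabs t < d -> forall v, B v -> p (h (x + t *: y) v - h x v) <= e) ->
  exists2 t, ev t = h x & is_dirderiv f y x t.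
Proof.
move=> Ux fh ch uh.
have mh : act_multilinear (h x).
  by apply: (act_multilinear_dirderiv Ux (fun x _ => fs_mlin S (f x))) => v; exact: fh.
have [t th] := fs_surj S mh ch; exists t => //.
apply/(@fs_cvgP _ (0^' : set_system (scal R K))) => B p e mB hp e0.
have e20 : 0 < e / 2 by lra.
have [d d0 dP] := uh B p _ mB hp e20.
have [d' d'0 d'U] := segment_near y 0 (nbhsU Ux).
have dd' : 0 < Num.min d d' by rewrite lt_min d0.
have := sabs_near0 K dd'; rewrite /dnbhs /within /=; apply: filterS => c cd c0 v Bv.
have sc0 : 0 < sabs c by rewrite lt_neqAle sabs_ge0 eq_sym sabs_eq0 c0.
rewrite fs_evZ fs_evB th.
have -> : c^-1 *: (ev (f (x + c *: y)) v - ev (f x) v) - h x v =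
    c^-1 *: (ev (f (x + c *: y)) v - ev (f x) v - c *: h x v).
  by rewrite [RHS]scalerBr scalerA mulVf// scale1r.
rewrite (csn_scale hp) sabsV mulrC ltr_pdivrMr//.
have seg s : 0 <= s <= 1 -> sabs (rinc s * c) < Num.min d d'.
  move=> /andP[s0 s1]; rewrite sabsM sabs_rinc ger0_norm//.
  by apply: le_lt_trans cd; rewrite ler_piMl// ltW.
have /le_lt_trans : p (ev (f (x + c *: y)) v - ev (f x) v - c *: h x v) <= e / 2 * sabs c.
  apply: (@mean_value _ _ _ _ (fun x => ev (f x) v) x (c *: y)
    (fun s => c *: h (x + rinc s *: (c *: y)) v)) => // s /seg; rewrite lt_min => /andP[sd sd'].
    apply: is_dirderivZ; apply: fh.
    by have := d'U _ 0 sd'; rewrite scaler0 addr0 scalerA; apply; rewrite sabs0.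
  by rewrite -scalerBr (csn_scale hp) mulrC ler_wpM2r ?sabs_ge0// scalerA; exact: dP.
by apply; nra.
Qed.

(** The parameter space P is kept general: it is X when derivatives are constructed, and X times a
    power of X when they are shown to be continuous. *)
Lemma tube_near (P : topologicalType) (h : P -> D -> F) (x : P) (B : set D) p e :
  (forall v, (fun q : P * D => h q.1 q.2) @ (x, v) --> h x v) ->
  compact B -> cont_seminorm p -> 0 < e ->
  \forall y \near x, forall v, B v -> p (h y v - h x v) < e.
Proof.
move=> ch /compact_near_coveringP cB hp e0.
apply: (cB _ (nbhs x) (fun y v => p (h y v - h x v) < e)) => v Bv.
have e20 : 0 < e / 2 by lra.
have h1 : \forall q \near (x, v), p (h q.1 q.2 - h x v) < e / 2.
  exact (csn_cvg hp (ch v) e20).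
have h2 : \forall v' \near v, p (h x v' - h x v) < e / 2.
  have cx : (fun v' => h x v') @ v --> h x v.
    apply: (@cvg_comp _ _ _ (fun v' => (x, v')) (fun q : P * D => h q.1 q.2) (nbhs v) (nbhs (x, v)) (nbhs (h x v))); last exact: ch.
    by apply: (@cvg_pair _ _ _ (nbhs v) (nbhs x) (nbhs v)); [exact: cvg_cst|exact: cvg_id].
  exact (csn_cvg hp cx e20).
case: h1 => -[A1 A2] /= [A1x A2v] AP.
exists (A2 `&` [set v' | p (h x v' - h x v) < e / 2], A1); first by split=> //=; exact: filterI.
move=> [v' y] /= [[A2v' pv'] A1y].
have -> : h y v' - h x v' = (h y v' - h x v) + - (h x v' - h x v).
  by lmod_eq (scal R K); ring.
rewrite (le_lt_trans (csn_add hp _ _))// (csnN hp).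
have := AP (y, v') (conj A1y A2v') => /=; lra.
Qed.

End Derivatives.
End FunctionSpace.

Lemma map_dfwith j (X : Type) (z : 'I_j -> X) (i : 'I_j) :
  exists s1 s2, forall a, [seq dfwith z i a l | l <- enum 'I_j] = s1 ++ a :: s2.
Proof.
have := enum_uniq 'I_j; case/splitPr: (mem_enum 'I_j i) => s1 s2.
rewrite cat_uniq /= negb_or => /and3P[_ /andP[is1 _] /andP[is2 _]].
have e s a : i \notin s -> [seq dfwith z i a l | l <- s] = map z s.
  move=> nis; apply/eq_in_map => l ls; rewrite dfwithout//.
  by apply: contraNneq nis => ->.
by exists (map z s1), (map z s2) => a; rewrite map_cat /= dfwithin !e.
Qed.

(** A direction appended at the end is the one differentiated last, so the derivative along
    [snoc y h] is the derivative along h of the one along y. *)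
Definition snoc (X : Type) j (y : 'I_j -> X) (h : X) (i : 'I_j.+1) : X :=
  if unlift ord_max i is Some l then y l else h.

Lemma map_snoc (X : Type) j (y : 'I_j -> X) h :
  [seq snoc y h i | i <- enum 'I_j.+1] = rcons [seq y i | i <- enum 'I_j] h.
Proof.
rewrite enum_ordSr map_rcons {2}/snoc unlift_none; congr rcons.
rewrite -map_comp; apply: eq_map => i /=; rewrite /snoc.
have -> : widen_ord (leqnSn j) i = lift ord_max i.
  by apply: val_inj; rewrite /= /bump leqNgt ltn_ord.
by rewrite liftK.
Qed.

(** * Derivatives in x with v as a parameter *)

Section ParameterDerivatives.
Context (R : realType) (K : scalars) (X F : tvsType (scal R K)) (D : topologicalType).
Context (hF : hausdorff_space F) (U : set X) (oU : open U).
Implicit Types (h g : X -> D -> F).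

(** The directions are fixed while x and v vary together; variation of the directions is left to
    [joint_cont]. *)
Definition iter_cont n h := forall ys, (size ys <= n)%N -> forall v,
  iter_dirderivable U (h^~ v) ys /\
  forall x, U x -> (fun q : X * D => iter_dirderiv (h^~ q.2) ys q.1) @ (x, v) -->
    iter_dirderiv (h^~ v) ys x.

Lemma iter_cont_le n n' h : (n' <= n)%N -> iter_cont n h -> iter_cont n' h.
Proof. by move=> nn' hc ys ysn; apply: hc; exact: leq_trans nn'. Qed.

Lemma iter_cont_dirderiv n h y : iter_cont n.+1 h ->
  iter_cont n (fun x v => dirderiv (h^~ v) y x).
Proof. by move=> hc ys ysn v; have [[]] := hc (y :: ys) ysn v. Qed.

Lemma eq_iter_cont n h g : (forall x v, U x -> h x v = g x v) ->
  iter_cont n h -> iter_cont n g.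
Proof.
move=> hg hc ys ysn v; have [hd hc'] := hc ys ysn v.
have e v' : {in U, h^~ v' =1 g^~ v'} by move=> x; rewrite inE => /hg.
split; first exact (eq_iter_dirderivable oU (e v) hd).
move=> x Ux; rewrite -(eq_iter_dirderiv oU ys (e v)) ?inE//.
apply: cvg_near_eq (hc' x Ux).
exists (U, setT) => /=; first by split; [exact: nbhsU|exact: filterT].
by move=> [x' v'] [/= Ux' _]; rewrite -(eq_iter_dirderiv oU ys (e v')) ?inE.
Qed.

Lemma iter_cont_dsmooth n h v : iter_cont n h -> dsmooth U n (h^~ v).
Proof.
move=> hc ys ysn; have [hd hc'] := hc ys ysn v; split=> // x; rewrite inE => Ux.
apply: (@cvg_comp _ _ _ (fun x => (x, v))
  (fun q : X * D => iter_dirderiv (h^~ q.2) ys q.1) (nbhs x) (nbhs (x, v))); last exact: hc'.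
by apply: (@cvg_pair _ _ _ (nbhs x) (nbhs x) (nbhs v)); [exact: cvg_id|exact: cvg_cst].
Qed.

Lemma iter_cont_is_dirderiv n h y x v : iter_cont n.+1 h -> U x ->
  is_dirderiv (h^~ v) y x (dirderiv (h^~ v) y x).
Proof. by move=> hc Ux; have [[hd _] _] := hc [:: y] isT v; exact/dirderivP/hd. Qed.

End ParameterDerivatives.

(* the number of derivatives lost in the passage from f^ to f *)
Definition mode_loss (m : convergence_mode) := if m is on_bounded then 1%N else 0%N.

Section FunctionSpaceDerivatives.
Context (R : realType) (K L : scalars) (I : finType)
  (E : I -> tvsType (scal R L)) (F T : tvsType (scal R K))
  (m : convergence_mode) (ev : T -> prod_topology E -> F)
  (act : scal R L -> F -> F).
Local Notation D := (prod_topology E).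
Context (S : function_space m ev act).
Context (X : tvsType (scal R K)) (U : set X) (oU : open U).

(** For bounded B, h is Lipschitz along the line through x in direction y, uniformly in v in B,
    because its derivative is bounded uniformly on B near x. *)
Lemma mode_segment (h : X -> D -> F) y x B p e : U x ->
  (forall x, U x -> act_multilinear act (h x)) -> iter_cont U (mode_loss m) h ->
  mode_sets m B -> cont_seminorm p -> 0 < e -> exists2 d, 0 < d &
    forall t : scal R K, sabs t < d -> forall v, B v -> p (h (x + t *: y) v - h x v) <= e.
Proof.
move=> Ux mh hc mB hp e0.
case: m mB hc => mB hc.
  have := tube_near (fun v => (hc [::] isT v).2 x Ux) mB hp e0.
  move=> /(segment_near y 0)[d d0 dP]; exists d => // t td v Bv; apply: ltW.
  by have := dP t 0 td; rewrite scaler0 addr0; apply=> //; rewrite sabs0.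
pose g x v := dirderiv (h^~ v) y x.
have hg x' v : U x' -> is_dirderiv (h^~ v) y x' (g x' v).
  by move=> Ux'; exact (iter_cont_is_dirderiv (y:=y) (v:=v) hc Ux').
have mg x' : U x' -> act_multilinear act (g x').
  by move=> Ux'; apply: (act_multilinear_dirderiv S oU Ux' mh) => v; exact: hg.
have cg : (fun q : X * D => g q.1 q.2) @ (x, 0) --> g x 0.
  exact: (hc [:: y] isT 0).2.
have [[A W] /= [xA W0] AW] : \forall q \near (x, 0 : D), p (g q.1 q.2 - g x 0) < 1.
  exact (csn_cvg hp cg ltr01).
have [c c0 cB] := mode_sets_absorb mB W0.
have [d d0 dP] := segment_near y 0 (filterI (nbhsU oU Ux) xA).
have ck0 : 0 < c ^+ #|I| by rewrite exprn_gt0.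
(* Near (x, 0) the derivative has seminorm below 1; as c v is in W, homogeneity gives c^k p (g x' v)
   < 1. *)
have bound x' v : U x' -> A x' -> B v -> p (g x' v) <= (c ^+ #|I|)^-1.
  move=> Ux' Ax' Bv; have := AW (x', rinc c *: v) (conj Ax' (cB v Bv)) => /=.
  rewrite (act_multilinear0 S (mg _ Ux)) subr0 (act_multilinear_homog S _ _ (mg _ Ux')).
  by rewrite csn_rinc// gtr0_norm// -ltr_pdivlMl// mulr1 => /ltW.
(* The second bound makes |t| c^(-k) at most e. *)
exists (Num.min d (e * c ^+ #|I|)); first by rewrite lt_min d0 mulr_gt0.
move=> t; rewrite lt_min => /andP[td te] v Bv.
have seg s : 0 <= s -> s <= 1 -> (U `&` A) (x + rinc s *: (t *: y)).
  move=> s0 s1; have := dP (rinc s * t) 0; rewrite scaler0 addr0 scalerA; apply.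
    by rewrite sabsM sabs_rinc ger0_norm// (le_lt_trans _ td)// ler_piMl// sabs_ge0.
  by rewrite sabs0.
rewrite -[_ - _]subr0.
apply: (@mean_value _ _ _ _ (h^~ v) x (t *: y)
  (fun s => t *: g (x + rinc s *: (t *: y)) v)) => // s /andP[s0 s1].
  by apply/is_dirderivZ/hg; exact: (seg s s0 s1).1.
have [U' A'] := seg s s0 s1.
rewrite subr0 (csn_scale hp) (le_trans (ler_wpM2l (sabs_ge0 _) (bound _ _ U' A' Bv)))//.
by rewrite ler_pdivrMr// ltW.
Qed.

(** The loss [mode_loss m] occurs once and does not accumulate: passing to [dirderiv f y] lowers
    both n and the available order by one. Evaluations of that derivative agree with [h] on U only,
    hence [eq_iter_cont]. *)
Lemma fs_iter n (f : X -> T) : iter_cont U (n + mode_loss m) (fun x v => ev (f x) v) ->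
  forall ys, (size ys <= n)%N -> iter_dirderivable U f ys /\
    forall x v, U x -> ev (iter_dirderiv f ys x) v = iter_dirderiv (fun x => ev (f x) v) ys x.
Proof.
move=> + ys; elim: ys n f => [//|y ys ih] [//|n] f fc /= ysn.
pose h x v := dirderiv (fun x => ev (f x) v) y x.
have hc : iter_cont U (n + mode_loss m) h by exact: iter_cont_dirderiv fc.
have fh x v : U x -> is_dirderiv (fun x => ev (f x) v) y x (h x v).
  by move=> Ux; exact (iter_cont_is_dirderiv (y:=y) (v:=v) fc Ux).
have mh x : U x -> act_multilinear act (h x).
  by move=> Ux; apply: (act_multilinear_dirderiv S oU Ux (fun x _ => fs_mlin S (f x))) => v; exact: fh.
have D x : U x -> exists2 t, ev t = h x & is_dirderiv f y x t.
  move=> Ux; apply: (fs_dirderiv S oU Ux fh).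
    move=> v; apply: (@cvg_comp _ _ _ (fun v => (x, v)) (fun q : X * D => h q.1 q.2)
      (nbhs v) (nbhs (x, v))); last exact: (hc [::] isT v).2.
    by apply: (@cvg_pair _ _ _ (nbhs v) (nbhs x) (nbhs v)); [exact: cvg_cst|exact: cvg_id].
  move=> B p e mB hp e0; apply: mode_segment => //.
  by apply: iter_cont_le hc; rewrite leq_addl.
have hT := fs_T_hausdorff S.
have fE x v : U x -> ev (dirderiv f y x) v = h x v.
  by move=> /D[t th ft]; rewrite (dirderivE hT ft) th.
have [|d1 d2] := ih n (dirderiv f y) _ ysn.
  by apply: eq_iter_cont hc => // x v Ux; rewrite fE.
split; first by split=> // x /D[t _ ft]; exists t.
move=> x v Ux; rewrite d2//.
by apply: (eq_iter_dirderiv oU) => [x'|]; rewrite inE//; exact: fE.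
Qed.

End FunctionSpaceDerivatives.

Lemma prod_cvg_comp (K : numFieldType) (I : finType) (E : I -> tvsType K) J
    (G : set_system J) {FG : Filter G} (f : J -> prod_topology E) (x : prod_topology E) :
  (forall i, (fun q => f q i) @ G --> x i) -> f @ G --> x.
Proof. by move=> h; apply: prod_cvg => i; exact: h. Qed.

(** * Joint continuity of derivatives in the point and the directions *)

Section JointContinuity.
Context (R : realType) (K L : scalars) (I : finType)
  (E : I -> tvsType (scal R L)) (F T : tvsType (scal R K))
  (m : convergence_mode) (ev : T -> prod_topology E -> F)
  (act : scal R L -> F -> F).
Local Notation D := (prod_topology E).
Context (S : function_space m ev act).
Context (X : tvsType (scal R K)) (U : set X) (oU : open U).
Local Notation P j := (prod_topology (fun _ : 'I_j => X)).

Definition joint_cont j (h : X -> D -> F) := forall x (y : P j) v, U x ->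
  (fun q : X * P j * D =>
    iter_dirderiv (h^~ q.2) [seq q.1.2 i | i <- enum 'I_j] q.1.1) @ ((x, y), v) -->
  iter_dirderiv (h^~ v) [seq y i | i <- enum 'I_j] x.

Context (j : nat) (f : X -> T).
Let h x v := ev (f x) v.
Hypothesis fc : iter_cont U (j + mode_loss m) h.
Let H i (x : X) (y : P i) v := iter_dirderiv (h^~ v) [seq y l | l <- enum 'I_i] x.

Lemma size_enum_map (A : Type) i (y : 'I_i -> A) : size [seq y l | l <- enum 'I_i] = i.
Proof. by rewrite size_map size_enum_ord. Qed.

Lemma fs_iterE x y v : U x -> ev (iter_dirderiv f [seq y l | l <- enum 'I_j] x) v = H x y v.
Proof. by apply: (fs_iter S oU fc _).2; rewrite size_enum_map. Qed.

Lemma H_mlin x (y : P j) : U x -> act_multilinear act (H x y).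
Proof.
move=> Ux; rewrite (_ : H x y = ev (iter_dirderiv f [seq y l | l <- enum 'I_j] x)).
  exact: (fs_mlin S).
by apply/funext => v; rewrite fs_iterE.
Qed.

Lemma H_comb i (iS : (i <= j + mode_loss m)%N) x (y : P i) (l : 'I_i) (a : scal R K) z z' v :
  U x -> H x (dfwith y l (a *: z + z')) v =
    a *: H x (dfwith y l z) v + H x (dfwith y l z') v.
Proof.
move=> Ux; have [s1 [s2 e]] := map_dfwith y l; rewrite /H !e.
apply: (iter_dirderiv_comb (fs_hausdorff S) oU) => //.
have := size_enum_map (dfwith y l z); rewrite e => ->.
exact (iter_cont_dsmooth v (iter_cont_le iS fc)).
Qed.

Lemma H_scale i (iS : (i <= j + mode_loss m)%N) x (y : P i) (l : 'I_i) (a : scal R K) z v :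
  U x -> H x (dfwith y l (a *: z)) v = a *: H x (dfwith y l z) v.
Proof.
move=> Ux; have H0 : H x (dfwith y l 0) v = 0.
  have := H_comb iS y l 1 0 0 v Ux; rewrite !scale1r addr0 => /eqP.
  by rewrite -subr_eq0 opprD addNKr oppr_eq0 => /eqP.
by rewrite -[a *: z]addr0 H_comb// H0 addr0.
Qed.

Lemma dfwith_cvg i (y : P i) (l : 'I_i) (z : X) :
  (fun q : P i * X => dfwith q.1 l q.2 : P i) @ (y, z) --> (dfwith y l z : P i).
Proof.
apply: prod_cvg_comp => l'; have [->|ll'] := eqVneq l' l.
  rewrite dfwithin [X in X @ _](_ : _ = snd); first exact: cvg_snd.
  by apply/funext => q /=; rewrite dfwithin.
rewrite dfwithout 1?eq_sym// [X in X @ _](_ : _ = (fun q : P i * X => q.1 l')); last first.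
  by apply/funext => q /=; rewrite dfwithout 1?eq_sym.
by apply: (@cvg_comp _ _ _ fst (fun y : P i => y l') _ (nbhs y));
  [exact: cvg_fst|exact: (@proj_continuous _ _ l')].
Qed.

Lemma snoc_cvg i (y : P i) (z : X) :
  (fun q : P i * X => snoc q.1 q.2 : P i.+1) @ (y, z) --> (snoc y z : P i.+1).
Proof.
apply: prod_cvg_comp => l'; rewrite /snoc; case: (unlift _ _) => [l|].
  by apply: (@cvg_comp _ _ _ fst (fun y : P i => y l) _ (nbhs y));
    [exact: cvg_fst|exact: (@proj_continuous _ _ l)].
exact: cvg_snd.
Qed.

Lemma dfwith_id i (y : P i) (l : 'I_i) : dfwith y l (y l) = y.
Proof. by apply/funext => l'; case: dfwithP. Qed.

Lemma dfwith_snoc i (y : P i) (z z' : X) : snoc y z = dfwith (snoc y z' : P i.+1) ord_max z.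
Proof.
apply/funext => l; have [->|ll'] := eqVneq l ord_max.
  by rewrite dfwithin /snoc unlift_none.
rewrite dfwithout 1?eq_sym// /snoc.
by case: unliftP => // e; rewrite e eqxx in ll'.
Qed.

(** With a = c^(-k), the value at direction a z and vector c v equals the one at z and v. Here c v
    stays in a fixed 0-neighbourhood while a z still tends to 0, so continuity at v = 0, where H
    vanishes, gives a bound uniform on B. *)
Lemma H_slot_small i (iS : (i <= j + mode_loss m)%N) x (y : P i) (l : 'I_i)
    J (G : set_system J) {FG : Filter G}
    (fx : J -> X) (fy : J -> P i) (fz : J -> X) (B : set D) p e :
  joint_cont i h -> (forall x y, U x -> act_multilinear act (H (i := i) x y)) ->
  U x -> mode_sets m B -> cont_seminorm p -> 0 < e ->
  fx @ G --> x -> fy @ G --> y -> fz @ G --> (0 : X) ->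
  \forall q \near G, forall v, B v -> p (H (fx q) (dfwith (fy q) l (fz q)) v) <= e.
Proof.
move=> jc mH Ux mB hp e0 cx cy cz.
have cH := jc x (dfwith y l 0) 0 Ux.
have [[A W] /= [xA W0] AW] : \forall q \near ((x, dfwith y l 0 : P i), 0 : D),
   p (H q.1.1 q.1.2 q.2 - H x (dfwith y l 0 : P i) 0) < e.
  exact (csn_cvg hp cH e0).
have [c c0 cB] := mode_sets_absorb mB W0.
have ck0 : 0 < c ^+ #|I| by rewrite exprn_gt0.
pose a := rinc (c ^+ #|I|)^-1 : scal R K.
have cq : (fun q => (fx q, dfwith (fy q) l (a *: fz q) : P i)) @ G --> (x, dfwith y l 0 : P i).
  apply: (@cvg_pair _ _ _ G (nbhs x) (nbhs (dfwith y l 0 : P i))) => //.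
  apply: (@cvg_comp _ _ _ (fun q => (fy q, a *: fz q))
    (fun q : P i * X => dfwith q.1 l q.2 : P i) G (nbhs (y, 0 : X))); last exact: dfwith_cvg.
  apply: (@cvg_pair _ _ _ G (nbhs y) (nbhs (0 : X))) => //.
  by rewrite -(scaler0 _ a); apply: cvg_scaleT => //; exact: cvg_cst.
have hU : \forall q \near G, U (fx q) by exact: cx (nbhsU oU Ux).
have hA : \forall q \near G, A (fx q, dfwith (fy q) l (a *: fz q) : P i) by exact: cq xA.
apply: filterS2 hU hA => q /= Uq Aq v Bv.
have := AW (_, rinc c *: v) (conj Aq (cB v Bv)) => /=.
rewrite (act_multilinear0 S (mH _ _ Ux)) subr0 (act_multilinear_homog S _ _ (mH _ _ Uq)).
by rewrite H_scale// scalerA -rincM divff ?gt_eqF// rinc1 scale1r => /ltW.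
Qed.

Lemma star_near (x : X) (A : set X) : nbhs x A ->
  \forall x' \near x, forall s, 0 <= s <= 1 -> A (x + rinc s *: (x' - x)).
Proof.
move=> /nbhs_add/csn_exists[p hp pA].
have : \forall x' \near x, p (x' - x) < 1.
  by apply: (csn_cvg hp _ ltr01); exact: cvg_id.
apply: filterS => x' px s /andP[s0 s1]; apply: pA.
by rewrite csn_rinc// ger0_norm// (le_lt_trans _ px)// ler_piMl// csn_ge0.
Qed.

(** For bounded B the increment is split: moving x costs one more derivative, with x' - x as the
    extra direction, and the directions are exchanged one slot at a time. In both parts some slot
    tends to 0, so [H_slot_small] applies. *)
Lemma fs_joint x (y : P j) : joint_cont j h -> (m = on_bounded -> joint_cont j.+1 h) -> U x ->
  (fun q : X * P j => iter_dirderiv f [seq q.2 l | l <- enum 'I_j] q.1) @ (x, y) -->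
  iter_dirderiv f [seq y l | l <- enum 'I_j] x.
Proof.
move=> jc jc1 Ux; apply/(fs_cvgP S) => B p e mB hp e0.
have nU : \forall q \near (x, y), U q.1.
  exists (U, setT) => /=; first by split; [exact: nbhsU|exact: filterT].
  by move=> [? ?] [].
suff : \forall q \near (x, y), forall v, B v -> p (H q.1 q.2 v - H x y v) < e.
  apply: filterS2 nU => q Uq hq v Bv.
  by rewrite !fs_iterE//; exact: hq.
case em : m mB => mB.
  exact (tube_near (P := (X * P j)%type) (h := fun q v => H q.1 q.2 v) (x := (x, y))
    (fun v => jc x y v Ux) mB hp e0).
rewrite -em in mB; have {}jc1 := jc1 em.
have lem : (j.+1 <= j + mode_loss m)%N by rewrite em addn1.
have lej : (j <= j + mode_loss m)%N by rewrite leq_addr.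
have fstc : (fun q : X * P j => q.1) @ (x, y) --> x by exact: cvg_fst.
have sndc : (fun q : X * P j => q.2) @ (x, y) --> y by exact: cvg_snd.
have HD x' (y' : P j) z v : U x' ->
    is_dirderiv (fun x => H x y' v) z x' (H x' (snoc y' z : P j.+1) v).
  move=> Ux'; rewrite /H map_snoc -cats1 iter_dirderiv_cat; apply: dirderivP.
  have [|] := fc (ys := [seq y' l | l <- enum 'I_j] ++ [:: z]) _ v.
    by rewrite size_cat size_enum_map em.
  by rewrite iter_dirderivable_cat /= => -[_ [+ _]] _; apply.
(* [H_mlin] stops at order j, up to which H comes from a derivative of f in T. At order j + 1
   multilinearity is inherited as that of a derivative of the order j map. *)
have mH1 x' (y' : P j.+1) : U x' -> act_multilinear act (H x' y').
  move=> Ux'.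
  have -> : y' = snoc (fun l => y' (lift ord_max l)) (y' ord_max).
    by apply/funext => l; rewrite /snoc; case: unliftP => [l'|] ->.
  apply: (@act_multilinear_dirderiv _ _ _ _ _ _ _ _ _ _ S _ _ oU
    (fun x v => H x (fun l => y' (lift ord_max l) : X) v) (y' ord_max) x') => //.
    by move=> x'' Ux''; exact: H_mlin.
  by move=> v; exact: HD.
have e20 : 0 < e / 2 / 2 by lra.
have part1 : \forall q \near (x, y), forall v, B v -> p (H q.1 q.2 v - H x q.2 v) <= e / 2 / 2.
  have cz : (fun q : X * P j => q.1 - x) @ (x, y) --> (0 : X).
    exact ((cvg_sub0 _ _).1 fstc).
  (* The intermediate point of the segment and the pair (x', y') vary independently, so the estimate
     is taken over a triple and later specialised along the segment. *)
  have sc : (fun q : X * (X * P j) => q.2) @ (x, (x, y)) --> (x, y) by exact: cvg_snd.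
  have c1 : (fun q : X * (X * P j) => snoc q.2.2 0 : P j.+1) @ (x, (x, y)) --> (snoc y 0 : P j.+1).
    apply: (@cvg_comp _ _ _ (fun q : X * (X * P j) => (q.2.2, 0 : X))
      (fun q : P j * X => snoc q.1 q.2 : P j.+1) _ (nbhs (y, 0 : X))); last exact: snoc_cvg.
    apply: (@cvg_pair _ _ _ (nbhs (x, (x, y))) (nbhs y) (nbhs (0 : X))); last exact: cvg_cst.
    exact: (@cvg_comp _ _ _ snd snd _ (nbhs (x, y))).
  have c2 : (fun q : X * (X * P j) => q.2.1 - x) @ (x, (x, y)) --> (0 : X).
    exact: (@cvg_comp _ _ _ snd (fun q : X * P j => q.1 - x) _ (nbhs (x, y))).
  have c0 : (fun q : X * (X * P j) => q.1) @ (x, (x, y)) --> x by exact: cvg_fst.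
  have [[A A'] /= [xA yA'] AA'] : \forall q \near (x, (x, y)), forall v, B v ->
      p (H q.1 (dfwith (snoc q.2.2 0 : P j.+1) ord_max (q.2.1 - x)) v) <= e / 2 / 2.
    exact (H_slot_small lem ord_max jc1 mH1 Ux mB hp e20 c0 c1 c2).
  have hA : \forall q \near (x, y), forall s, 0 <= s <= 1 -> (A `&` U) (x + rinc s *: (q.1 - x)).
    exact: fstc (star_near (filterI xA (nbhsU oU Ux))).
  apply: filterS2 hA yA' => -[x' y'] /= Ax' A'q v Bv.
  have -> : H x' y' v - H x y' v = H (x + (x' - x)) y' v - H x y' v - 0.
    by rewrite subr0 [x + _]addrC subrK.
  apply: (@mean_value _ _ _ _ (fun x => H x y' v) x (x' - x)
    (fun s => H (x + rinc s *: (x' - x)) (snoc y' (x' - x) : P j.+1) v)) => // s s01;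
    have [As Us] := Ax' s s01; first exact: HD.
  rewrite subr0 (dfwith_snoc y' (x' - x) 0).
  by apply: (AA' (x + rinc s *: (x' - x), (x', y'))).
(* The first i directions are already the new ones; consecutive hybrids differ in one slot by
   [y' l - y l]. *)
pose hyb i (y' : P j) : P j := fun l => if (l < i)%N then y' l else y l.
have hybc i : (fun q : X * P j => hyb i q.2) @ (x, y) --> y.
  apply: prod_cvg_comp => l; rewrite /hyb /=; case: (l < i)%N; last exact: cvg_cst.
  by apply: (@cvg_comp _ _ _ snd (fun y : P j => y l) _ (nbhs y)) => //;
    exact: (@proj_continuous _ _ l).
have part2 i : (i <= j)%N -> forall d, 0 < d -> \forall q \near (x, y), forall v, B v ->
    p (H x (hyb i q.2) v - H x y v) <= i%:R * d.
  elim: i => [_ d d0|i ih ij d d0].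
    near=> q => v _; have -> : hyb 0%N q.2 = y by [].
    by rewrite subrr (csn0 hp) mul0r.
  pose l := Ordinal ij.
  have cl : (fun q : X * P j => q.2 l - y l) @ (x, y) --> (0 : X).
    apply: (cvg_sub0 _ _).1; apply: (@cvg_comp _ _ _ snd (fun y : P j => y l) _ (nbhs y)).
      exact: sndc.
    exact: (@proj_continuous _ (fun=> X) l y).
  have h' : \forall q \near (x, y), forall v, B v ->
      p (H x (dfwith (hyb i q.2) l (q.2 l - y l)) v) <= d.
    exact (H_slot_small lej l jc (fun x y Ux => @H_mlin x y Ux) Ux mB hp d0
      (cvg_cst x) (hybc i) cl).
  apply: filterS2 (ih (ltnW ij) d d0) h' => q h1 h2 v Bv.
  have e1 : hyb i.+1 q.2 = dfwith (hyb i q.2) l (1 *: (q.2 l - y l) + y l).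
    apply/funext => l'; rewrite scale1r subrK; case: dfwithP => [|l'' ll''].
      by rewrite /hyb ltnSn.
    rewrite /hyb ltnS leq_eqVlt; case: eqP => // e'.
    by case/eqP: ll''; exact: val_inj.
  have e2 : hyb i q.2 = dfwith (hyb i q.2) l (y l).
    by rewrite -[y l](_ : hyb i q.2 l = _) ?dfwith_id// /hyb ltnn.
  have := h1 v Bv; rewrite {1}e2 e1 H_comb// scale1r -addrA => h1'.
  rewrite (le_trans (csn_add hp _ _))// -natr1 mulrDl mul1r.
  by have := h2 v Bv; lra.
(* The share per slot is taken over j + 1 and not j, so that j = 0 is allowed. *)
have j0 : 0 < e / 2 / j.+1%:R by rewrite !divr_gt0 ?ltr0n.
apply: filterS2 part1 (part2 j (leqnn j) _ j0) => q h1 h2 v Bv.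
have hj : hyb j q.2 = q.2 by apply/funext => l; rewrite /hyb ltn_ord.
have := h1 v Bv; have := h2 v Bv; rewrite hj => {}h2 {}h1.
have -> : H q.1 q.2 v - H x y v = (H q.1 q.2 v - H x q.2 v) + (H x q.2 v - H x y v).
  by rewrite subrKA.
rewrite (le_lt_trans (csn_add hp _ _))//.
have : j%:R * (e / 2 / j.+1%:R) <= e / 2.
  rewrite mulrCA ler_piMr//; first lra.
  by rewrite ler_pdivrMr ?ltr0n// mul1r ler_nat.
by move=> /(le_trans h2) {}h2; lra.
Unshelve. all: by end_near. Qed.

End JointContinuity.

Lemma open_setXT (X Y : topologicalType) (U : set X) : open U -> open (U `*` [set: Y]).
Proof.
move=> oU; rewrite openE => -[x v] [/= Ux _].
by exists (U, setT) => //=; split; [exact: (open_nbhs_nbhs (conj oU Ux))|exact: filterT].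
Qed.

(** * Finite and infinite orders *)

Section Slices.
Context (R : realType) (K : scalars) (X Y F : tvsType (scal R K)).
Implicit Types (g : X * Y -> F) (U : set X).

(** As an equality of predicates it passes to [xget], hence to iterated derivatives, without any
    differentiability. *)
Lemma is_dirderiv_slice g y x v :
  is_dirderiv g (y, 0) (x, v) = is_dirderiv (fun x => g (x, v)) y x.
Proof.
have e (t : scal R K) : (x, v) + t *: (y, 0) = (x + t *: y, v) :> X * Y.
  by apply: injective_projections; rewrite //= scaler0 addr0.
have {}e : (fun t : scal R K => t^-1 *: (g ((x, v) + t *: (y, 0)) - g (x, v))) =
    (fun t => t^-1 *: (g (x + t *: y, v) - g (x, v))) by apply/funext => t; rewrite e.
by apply/funext => l; rewrite /is_dirderiv e.
Qed.

Lemma dirderiv_slice g y x v : dirderiv g (y, 0) (x, v) = dirderiv (fun x => g (x, v)) y x.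
Proof. by rewrite /dirderiv is_dirderiv_slice. Qed.

Lemma iter_dirderiv_slice g ys x v :
  iter_dirderiv g [seq (y, 0) | y <- ys] (x, v) = iter_dirderiv (fun x => g (x, v)) ys x.
Proof.
elim: ys g => //= y ys ih g; rewrite ih; congr iter_dirderiv.
by apply/funext => x'; exact: dirderiv_slice.
Qed.

Lemma iter_dirderivable_slice U g ys v :
  iter_dirderivable (U `*` setT) g [seq (y, 0) | y <- ys] ->
  iter_dirderivable U (fun x => g (x, v)) ys.
Proof.
elim: ys g => //= y ys ih g [gy gys]; split.
  by move=> x Ux; have [l] := gy (x, v) (conj Ux I); rewrite is_dirderiv_slice; exists l.
have := ih _ gys; congr (iter_dirderivable U _ ys).
by apply/funext => x; exact: dirderiv_slice.
Qed.

Lemma seq_enum_map (ys : seq X) : exists y : 'I_(size ys) -> X,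
  [seq y i | i <- enum 'I_(size ys)] = ys.
Proof.
exists (fun i => nth 0 ys i).
by rewrite (map_comp (nth 0 ys) val) val_enum_ord map_nth_iota0// take_size.
Qed.

Lemma keller_slices r U g : open U -> keller_smooth r (U `*` setT) g ->
  forall n, order_le n r -> iter_cont U n (fun x v => g (x, v)) /\
    forall y : prod_topology (fun _ : 'I_n => X), forall x v, U x ->
     (fun q : X * prod_topology (fun _ : 'I_n => X) * Y =>
       iter_dirderiv (fun x => g (x, q.2)) [seq q.1.2 i | i <- enum 'I_n] q.1.1) @ ((x, y), v)
     --> iter_dirderiv (fun x => g (x, v)) [seq y i | i <- enum 'I_n] x.
Proof.
move=> oU [gc gs].
have oUT := open_setXT oU.
have joint n : order_le n r -> (forall y : prod_topology (fun _ : 'I_n => X), forall x v, U x ->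
     (fun q : X * prod_topology (fun _ : 'I_n => X) * Y =>
       iter_dirderiv (fun x => g (x, q.2)) [seq q.1.2 i | i <- enum 'I_n] q.1.1) @ ((x, y), v)
     --> iter_dirderiv (fun x => g (x, v)) [seq y i | i <- enum 'I_n] x).
  move=> nr y x v Ux.
  pose P := prod_topology (fun _ : 'I_n => X).
  pose P' := prod_topology (fun _ : 'I_n => (X * Y)%type).
  have dc : (fun q : (X * Y) * P' => dpow g q.1 q.2) @ ((x, v), (fun i => (y i, 0) : X * Y) : P')
      --> dpow g (x, v) (fun i => (y i, 0)).
    (* Order 0 is continuity of g itself; the clause on derivatives covers positive orders only. *)
    have [n0|n0] := posnP n.
      rewrite {}/P'; move: n0 y => -> y.
      rewrite /dpow; have e : enum 'I_0 = [::] by apply: size0nil; rewrite size_enum_ord.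
      rewrite e /=; apply: (@cvg_comp _ _ _ fst g _ (nbhs (x, v))); first exact: cvg_fst.
      have := gc; rewrite continuous_open_subspace; last exact (oUT Y).
      by move=> /(_ (x, v)); apply; rewrite inE.
    have [_ dc] := gs n n0 nr.
    have := dc; rewrite continuous_open_subspace; last exact (@open_setXT _ P' _ (oUT Y)).
    by move=> /(_ ((x, v), (fun i => (y i, 0)))); apply; rewrite inE.
  have e (x' : X) (y' : P) v' : iter_dirderiv (fun x => g (x, v')) [seq y' i | i <- enum 'I_n] x' =
      dpow g (x', v') (fun i => (y' i, 0)).
    by rewrite /dpow -iter_dirderiv_slice -map_comp.
  rewrite e [X in X @ _](_ : _ = fun q : X * P * Y => dpow g (q.1.1, q.2) (fun i => (q.1.2 i, 0))); last first.
    by apply/funext => -[[x' y'] v']; rewrite /= e.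
  apply: (@cvg_comp _ _ _ (fun q : X * P * Y => ((q.1.1, q.2), (fun i => (q.1.2 i, 0)) : P'))
    (fun q : (X * Y) * P' => dpow g q.1 q.2) (nbhs ((x, y), v))
    (nbhs ((x, v), (fun i => (y i, 0)) : P'))); last exact: dc.
  have c1 : (fun q : X * P * Y => q.1) @ ((x, y), v) --> (x, y) by exact: cvg_fst.
  have c2 : (fun q : X * P * Y => q.1.1) @ ((x, y), v) --> x.
    by apply: (@cvg_comp _ _ _ fst fst _ (nbhs (x, y))) => //; exact: cvg_fst.
  have c3 : (fun q : X * P * Y => q.1.2) @ ((x, y), v) --> y.
    by apply: (@cvg_comp _ _ _ fst snd _ (nbhs (x, y))) => //; exact: cvg_snd.
  have c4 : (fun q : X * P * Y => q.2) @ ((x, y), v) --> v by exact: cvg_snd.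
  apply: (@cvg_pair _ _ _ (nbhs ((x, y), v)) (nbhs (x, v)) (nbhs ((fun i => (y i, 0)) : P'))).
    exact: (@cvg_pair _ _ _ (nbhs ((x, y), v)) (nbhs x) (nbhs v)).
  apply: prod_cvg_comp => i.
  apply: (@cvg_pair _ _ _ (nbhs ((x, y), v)) (nbhs (y i)) (nbhs (0 : Y))); last exact: cvg_cst.
  apply: (@cvg_comp _ _ _ (fun q : X * P * Y => q.1.2) (fun y : P => y i) _ (nbhs y)) => //.
  exact: (@proj_continuous _ (fun=> X) i y).
move=> n nr; split; last exact: joint.
move=> ys ysn v; have ysr : order_le (size ys) r.
  by case: (r) nr => // n' /=; exact: leq_trans.
have [y ye] := seq_enum_map ys.
split.
  apply: iter_dirderivable_slice; case: ys {ysn} ysr y ye => // y0 ys ysr y ye.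
  have [/(_ (fun i => (y i, 0))) + _] := gs (size (y0 :: ys)) isT ysr.
  by rewrite -[in X in _ -> X]ye -map_comp.
move=> x Ux; have := joint _ ysr y x v Ux; rewrite ye => h.
pose P := prod_topology (fun _ : 'I_(size ys) => X).
have c : (fun q : X * Y => ((q.1, y : P), q.2)) @ (x, v) --> ((x, y : P), v).
  apply: (@cvg_pair _ _ _ (nbhs (x, v)) (nbhs (x, y : P)) (nbhs v)); last exact: cvg_snd.
  apply: (@cvg_pair _ _ _ (nbhs (x, v)) (nbhs x) (nbhs (y : P))); last exact: cvg_cst.
  exact: cvg_fst.
rewrite [X in X @ _](_ : _ = fun q : X * Y => iter_dirderiv (fun x => g (x, q.2))
    [seq (y : P) i | i <- enum 'I_(size ys)] q.1); last by apply/funext => q; rewrite ye.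
exact: (@cvg_comp _ _ _ (fun q : X * Y => ((q.1, y : P), q.2))
  (fun q : X * P * Y => iter_dirderiv (fun x => g (x, q.2))
    [seq q.1.2 i | i <- enum 'I_(size ys)] q.1.1) (nbhs (x, v)) (nbhs ((x, y : P), v))).
Qed.

End Slices.

(** * Application to the spaces of continuous multilinear maps *)

Section MultilinearInstance.
Context (R : realType) (K L : scalars) (s : subfield K L) (k : nat)
  (E : 'I_k -> tvsType (scal R L)) (F : tvsType (scal R L)).
Hypotheses (k0 : (0 < k)%N) (hF : hausdorff_space F).

Definition mlin_ev (m : convergence_mode) (t : restrictScal s (multilinSpace m E F))
  (v : prod_topology E) : restrictScal s F := (t : contMultilinear E F) v.

Lemma multilin_function_space (m : convergence_mode) :
  function_space m (@mlin_ev m) (fun a (x : restrictScal s F) => a *: (x : F)).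
Proof.
split.
- exact: hF.
- by rewrite card_ord.
- by [].
- by move=> t A; exact: multilin_nbhsP.
- by move=> t i v a x y; exact: (cmlin_multilinear t).
- by move=> t x A; exact (@cmlin_continuous _ _ _ _ t x A).
- move=> u mu cu.
  have uP : (u : prod_topology E -> F) \in @cmlin_pred _ _ E F.
    by apply/asboolP; split=> [i v a x y|x A]; [exact: mu|exact: cu].
  by exists (ContMultilinear uP).
- move=> t t' tt'; apply: val_inj; exact: tt'.
- move=> c a x y; rewrite !restrictScalE scalerDr !scalerA; congr (_ + _).
  by rewrite mulrC.
- move=> c x A; exact: (@cvg_scaleT _ F _ (nbhs (x : F)) (fun=> c) id c x _ (cvg_cst c) (fun A h => h) A).
- move=> a x; rewrite restrictScalE.
  suff -> : scal_incl s (rinc a) = rinc a by [].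
  by rewrite /rinc; case: s => -[].
Qed.

Definition mode_order (m : convergence_mode) r := if m is on_bounded then order_pred r else r.

Lemma keller_multilin (m : convergence_mode) (X : tvsType (scal R K)) (U : set X)
    (f : X -> contMultilinear E F) r : open U -> order_le (mode_loss m) r ->
  keller_smooth r (U `*` setT) (uncurried s f) ->
  keller_smooth (mode_order m r) U (into s m f) /\
  forall j, order_le j (mode_order m r) ->
    forall x v (y : 'I_j -> X), U x ->
      (dpow (into s m f) x y : contMultilinear E F) v =
      dpow (uncurried s f) (x, v) (fun i => (y i, 0)).
Proof.
move=> oU mr /(keller_slices oU) fs.
have S := multilin_function_space m.
(* [n.-1] is 0 for n = 0; this case would break the inequality in the bounded topology and is
   excluded by [mr]. *)
have ordm j : order_le j (mode_order m r) -> order_le (j + mode_loss m) r.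
  by case: (m) mr => /=; case: (r) => //= n; rewrite ?addn0// addn1; case: n.
have ord1 j : order_le (j + mode_loss m) r -> order_le j r.
  by case: (r) => //= n; apply: leq_trans; rewrite leq_addr.
have jc j : order_le j r -> joint_cont U j (fun x v => mlin_ev (into s m f x) v).
  by move=> /fs[_ h] x y v Ux; exact: h.
have ic j : order_le (j + mode_loss m) r ->
    iter_cont U (j + mode_loss m) (fun x v => mlin_ev (into s m f x) v).
  by move=> /fs[].
have joint j : order_le j (mode_order m r) -> forall x (y : prod_topology (fun _ : 'I_j => X)), U x ->
    (fun q : X * prod_topology (fun _ : 'I_j => X) => dpow (into s m f) q.1 q.2) @ (x, y) -->
    dpow (into s m f) x y.
  move=> /ordm jr x y Ux; rewrite /dpow; apply: (fs_joint S oU (ic _ jr)) => //.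
    exact/jc/ord1.
  by move=> em; apply: jc; move: jr; rewrite em /= addn1.
split; last first.
  move=> j /ordm jr x v y Ux; rewrite {2}/dpow (map_comp (fun y => (y, 0)) y).
  rewrite iter_dirderiv_slice; apply: (fs_iter S oU (ic _ jr) _).2 => //.
  by rewrite size_enum_map.
split.
  rewrite continuous_open_subspace// => x; rewrite inE => Ux.
  have o0 : order_le 0 (mode_order m r) by case: (m) (r) => -[].
  have := joint 0%N o0 x (fun=> 0) Ux; rewrite /dpow.
  have e : enum 'I_0 = [::] by apply: size0nil; rewrite size_enum_ord.
  rewrite e /= => h.
  apply: (@cvg_comp _ _ _ (fun x => (x, (fun=> 0) : prod_topology (fun _ : 'I_0 => X)))
    (fun q => into s m f q.1) (nbhs x) _ _ _ h).
  apply: (@cvg_pair _ _ _ (nbhs x) (nbhs x) (nbhs ((fun=> 0) : prod_topology (fun _ : 'I_0 => X)))).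
    exact: cvg_id.
  exact: cvg_cst.
move=> j _ jr; split.
  move=> y; apply: (fs_iter S oU (ic _ (ordm _ jr)) _).1.
  by rewrite size_enum_map.
rewrite continuous_open_subspace; last exact: open_setXT.
by move=> [x y]; rewrite inE => -[/= Ux _]; exact: joint.
Qed.

End MultilinearInstance.

(** * Homogeneous polynomials *)

Section MultilinearExpansion.
Context (K : numFieldType) (F : lmodType K).

Lemma multilinear_slot n (E : lmodType K) (B : ('I_n -> E) -> F) i (v : 'I_n -> E) (a : K) (x y : E) :
  multilinear (E := fun=> E) B ->
  B (dfwith v i (a *: x + y)) = a *: B (dfwith v i x) + B (dfwith v i y).
Proof. by move=> mB; exact: mB. Qed.

Lemma multilinear_slot0 n (E : lmodType K) (B : ('I_n -> E) -> F) i (v : 'I_n -> E) :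
  multilinear (E := fun=> E) B -> B (dfwith v i 0) = 0.
Proof.
move=> mB; have := multilinear_slot i v 1 0 0 mB; rewrite !scale1r addr0 => /eqP.
by rewrite -subr_eq0 opprD addNKr oppr_eq0 => /eqP.
Qed.

Lemma multilinear_slot_sum n (E : lmodType K) (B : ('I_n -> E) -> F) i (v : 'I_n -> E)
    J (r : seq J) (P : pred J) (a : J -> E) : multilinear (E := fun=> E) B ->
  B (dfwith v i (\sum_(j <- r | P j) a j)) = \sum_(j <- r | P j) B (dfwith v i (a j)).
Proof.
move=> mB; apply: (big_morph (fun x => B (dfwith v i x))) => [x y|].
  by rewrite -[x]scale1r multilinear_slot// !scale1r.
exact: multilinear_slot0.
Qed.

Lemma multilinear_eq0 n (E : lmodType K) (B : ('I_n -> E) -> F) v i :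
  multilinear (E := fun=> E) B -> v i = 0 -> B v = 0.
Proof.
move=> mB vi; rewrite -(multilinear_slot0 i v mB); congr B.
by apply/funext => l; case: dfwithP.
Qed.

Definition ford_cons (E : Type) n (x : E) (y : 'I_n -> E) (i : 'I_n.+1) : E :=
  if unlift ord0 i is Some l then y l else x.

Lemma ford_cons0 (E : Type) n (x : E) (y : 'I_n -> E) : ford_cons x y ord0 = x.
Proof. by rewrite /ford_cons unlift_none. Qed.

Lemma ford_consS (E : Type) n (x : E) (y : 'I_n -> E) l : ford_cons x y (lift ord0 l) = y l.
Proof. by rewrite /ford_cons liftK. Qed.

Lemma dfwith_ford_cons0 (E : Type) n (x z : E) (y : 'I_n -> E) :
  dfwith (ford_cons x y) ord0 z = ford_cons z y.
Proof.
apply/funext => i; case: (unliftP ord0 i) => [l|] ->; last by rewrite dfwithin ford_cons0.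
by rewrite dfwithout ?ford_consS// neq_lift.
Qed.

Lemma dfwith_ford_consS (E : Type) n (x z : E) (y : 'I_n -> E) l :
  dfwith (ford_cons x y) (lift ord0 l) z = ford_cons x (dfwith y l z).
Proof.
apply/funext => i; case: (unliftP ord0 i) => [l'|] ->; last first.
  by rewrite dfwithout ?ford_cons0// eq_sym neq_lift.
rewrite ford_consS; have [->|ll'] := eqVneq l' l; first by rewrite !dfwithin.
by rewrite !dfwithout ?ford_consS// eq_sym// (inj_eq lift_inj).
Qed.

Lemma ford_cons_eta (E : Type) n (y : 'I_n.+1 -> E) :
  y = ford_cons (y ord0) (fun l => y (lift ord0 l)).
Proof.
by apply/funext => i; case: (unliftP ord0 i) => [l|] ->; rewrite ?ford_consS ?ford_cons0.
Qed.

(** Induction on the number of slots: [ford_cons] splits off slot 0, and a choice function on n + 1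
    slots is a choice for slot 0 together with one for the rest. *)
Lemma multilinear_expand n (E : lmodType K) (B : ('I_n -> E) -> F) (J : finType)
    (a : 'I_n -> J -> E) : multilinear (E := fun=> E) B ->
  B (fun i => \sum_j a i j) = \sum_(phi : {ffun 'I_n -> J}) B (fun i => a i (phi i)).
Proof.
elim: n B a => [|n ih] B a mB.
  have e (phi : {ffun 'I_0 -> J}) : B (fun i => a i (phi i)) = B (fun i => \sum_j a i j).
    by congr B; apply/funext => -[].
  by rewrite (eq_bigr _ (fun phi _ => e phi)) sumr_const card_ffun card_ord expn0.
rewrite [in LHS](ford_cons_eta (fun i => \sum_j a i j)) -(dfwith_ford_cons0 0).
rewrite (multilinear_slot_sum _ _ _ _ _ mB).
under eq_bigr => j _.
  rewrite dfwith_ford_cons0 (ih (fun y => B (ford_cons (a ord0 j) y)) (fun i => a (lift ord0 i))); last first.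
    move=> i v c x y; rewrite -!dfwith_ford_consS; exact: multilinear_slot.
  over.
rewrite pair_big /= [RHS](reindex (fun p : J * {ffun 'I_n -> J} => [ffun i => ford_cons p.1 p.2 i])) /=.
  apply: eq_bigr => -[j phi] _ /=; congr B; apply/funext => i.
  by rewrite ffunE; case: (unliftP ord0 i) => [l|] ->; rewrite ?ford_consS ?ford_cons0.
exists (fun phi => (phi ord0, [ffun l => phi (lift ord0 l)])) => [[j phi]|phi] _ /=.
  by rewrite ffunE ford_cons0; congr pair; apply/ffunP => l; rewrite !ffunE ford_consS.
by apply/ffunP => i; rewrite ffunE [in RHS](ford_cons_eta phi); congr (ford_cons _ _ i);
  apply/funext => l; rewrite ffunE.
Qed.

End MultilinearExpansion.

Section HomogeneousPoly.
Context (K : numFieldType) (E F : tvsType K).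

Lemma homogeneous_poly0 n : homogeneous_poly n (fun _ : E => 0 : F).
Proof. by exists (fun=> 0) => // i v a x y; rewrite scaler0 addr0. Qed.

Lemma homogeneous_polyD n (b c : E -> F) : homogeneous_poly n b ->
  homogeneous_poly n c -> homogeneous_poly n (fun y => b y + c y).
Proof.
move=> [B mB bB] [C mC cC]; exists (fun y => B y + C y) => [i v a x y|y].
  by rewrite /= mB mC scalerDr addrACA.
by rewrite bB cC.
Qed.

Lemma homogeneous_poly_sum n J (r : seq J) (P : pred J) (b : J -> E -> F) :
  (forall j, P j -> homogeneous_poly n (b j)) ->
  homogeneous_poly n (fun y => \sum_(j <- r | P j) b j y).
Proof.
move=> h; elim: r => [|j r ih].
  under eq_fun do rewrite big_nil; exact: homogeneous_poly0.
under eq_fun do rewrite big_cons.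
by case: (boolP (P j)) => // Pj; apply: homogeneous_polyD => //; exact: h.
Qed.

Lemma homogeneous_poly_comp n (E' : tvsType K) (b : E -> F) (u : E' -> E) :
  linear u -> homogeneous_poly n b -> homogeneous_poly n (b \o u).
Proof.
move=> lu [B mB bB]; exists (fun y => B (u \o y)) => [i v a x y|y]; last by rewrite /= bB.
have e z : u \o dfwith v i z = dfwith (u \o v) i (u z).
  apply/funext => l /=; have [->|li] := eqVneq l i; first by rewrite !dfwithin.
  by rewrite !dfwithout// eq_sym.
by rewrite !e lu; exact: mB.
Qed.

Lemma homogeneous_poly_scale n (b : E -> F) (a : K) y : homogeneous_poly n b ->
  b (a *: y) = a ^+ n *: b y.
Proof.
move=> [B mB bB]; rewrite !bB.
have := @multilinear_scale K 'I_n (fun=> E) F B a (fun=> y) mB.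
by rewrite card_ord.
Qed.

Lemma homogeneous_poly_cst n (b : E -> F) : homogeneous_poly n b ->
  (n = 0)%N -> forall y, b y = b 0.
Proof. by move=> hb n0 y; rewrite -(scale0r y) (homogeneous_poly_scale _ _ hb) n0 scale1r. Qed.

(** The slots in S, renumbered by [enum_val], are the arguments of the new form; [pk] inverts the
    numbering. *)
Lemma homogeneous_poly_restrict n (B : ('I_n -> E) -> F) (S : {set 'I_n}) w :
  multilinear (E := fun=> E) B ->
  homogeneous_poly #|S| (fun y => B (fun l => if l \in S then y else w)).
Proof.
move=> mB.
pose pk (l : 'I_n) := [pick i : 'I_#|S| | enum_val i == l].
pose ins (Y : 'I_#|S| -> E) l := if pk l is Some i then Y i else w.
exists (fun Y => B (ins Y)) => [i v a x y|y].
  have e z : ins (dfwith v i z) = dfwith (ins v) (enum_val i) z.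
    apply/funext => l; rewrite /ins; have [->|li] := eqVneq l (enum_val i).
      rewrite dfwithin /pk; case: pickP => [i' /eqP/enum_val_inj->|/(_ i)]; last by rewrite eqxx.
      by rewrite dfwithin.
    rewrite [RHS]dfwithout 1?eq_sym// /pk; case: pickP => // i' /eqP i'l.
    by rewrite dfwithout//; apply: contraNneq li => ->; rewrite i'l.
  by rewrite !e; exact: mB.
congr B; apply/funext => l; rewrite /ins /pk; case: pickP => [i /eqP <-|nol].
  by rewrite enum_valP.
case: ifPn => // lS; have := nol (enum_rank_in lS l).
by rewrite enum_rankK_in// eqxx.
Qed.

(** The binomial formula without symmetry: there is one term for each set S of slots receiving y,
    and [c i] collects those with i elements. *)
Lemma homogeneous_poly_expand n (b : E -> F) : homogeneous_poly n b ->
  exists c : nat -> E -> E -> F,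
  [/\ forall i w, homogeneous_poly i (c i ^~ w),
      forall y w, b (y + w) = \sum_(i < n.+1) c i y w
    & forall i (z t : K) y w, (i <= n)%N -> c i (z *: y) (t *: w) = (z ^+ i * t ^+ (n - i)) *: c i y w].
Proof.
move=> [B mB bB].
pose m (S : {set 'I_n}) y w := B (fun l => if l \in S then y else w).
pose c i y w := \sum_(S : {set 'I_n} | #|S| == i) m S y w.
exists c; split.
- by move=> i w; apply: homogeneous_poly_sum => S /eqP<-; exact: homogeneous_poly_restrict.
- move=> y w; rewrite bB.
  have -> : B (fun=> y + w) = \sum_(S : {set 'I_n}) m S y w.
    have -> : (fun=> y + w) = (fun i : 'I_n => \sum_(j : bool) if j then y else w).
      by apply/funext => i; rewrite big_bool.
    rewrite multilinear_expand// [RHS](reindex (fun phi : {ffun 'I_n -> bool} => [set l | phi l]%SET)) /=.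
      apply: eq_bigr => phi _; rewrite /m; congr B; apply/funext => l; by rewrite inE.
    exists (fun S : {set 'I_n} => [ffun l : 'I_n => l \in S]) => [phi|S] _.
      by apply/ffunP => l; rewrite ffunE inE.
    by apply/setP => l; rewrite inE ffunE.
  rewrite (partition_big (fun S : {set 'I_n} => inord #|S| : 'I_n.+1) predT)//=.
  apply: eq_bigr => i _; apply: eq_bigl => S; rewrite -val_eqE /= inordK//.
  by rewrite ltnS -[X in (_ <= X)%N](card_ord n) max_card.
move=> i z t y w _; rewrite /c scaler_sumr; apply: eq_bigr => S /eqP Si; rewrite /m.
have -> : B (fun l => if l \in S then z *: y else t *: w) =
    z ^+ #|S| *: B (fun l => if l \in S then y else t *: w).
  exact (homogeneous_poly_scale z y (homogeneous_poly_restrict S (t *: w) mB)).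
(* Exchanging S with its complement lets the homogeneity in y serve for w as well. *)
have e w' : (fun l => if l \in S then y else w') = (fun l => if l \in ~: S then w' else y).
  by apply/funext => l; rewrite inE; case: (l \in S).
rewrite !e.
have -> : B (fun l => if l \in ~: S then t *: w else y) =
    t ^+ #|~: S| *: B (fun l => if l \in ~: S then w else y).
  exact (homogeneous_poly_scale t w (homogeneous_poly_restrict (~: S) y mB)).
by rewrite scalerA Si; congr ((_ * _ ^+ _) *: _); rewrite cardsCs finset.setCK card_ord Si.
Qed.

End HomogeneousPoly.

(** * Polarization *)

Section Polarization.
Context (K : numFieldType) (E T : tvsType K).

Definition subset_sign n (S : {set 'I_n}) : K := \prod_i (if i \in S then 1 else -1).

(** Inclusion-exclusion: with G equal to 0 on A and -1 elsewhere, the sum is the expansion of the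
    product of the 1 + G i, which vanishes as soon as some index is outside A. *)
Lemma sum_subset_sign n (A : {set 'I_n}) :
  \sum_(S : {set 'I_n} | A \subset S) subset_sign S = (A == [set: 'I_n]%SET)%:R.
Proof.
pose G i : K := if i \in A then 0 else -1.
have e (S : {set 'I_n}) : (if A \subset S then subset_sign S else 0) = \prod_i (if i \in S then 1 else G i).
  case: ifPn => [AS|/subsetPn[i iA iS]].
    apply: eq_bigr => i _; rewrite /G; case: ifPn => // iS; case: ifPn => // iA.
    by rewrite (fintype.subsetP AS _ iA) in iS.
  by rewrite (bigD1 i)//= (negbTE iS) /G iA mul0r.
rewrite big_mkcond; under eq_bigr => S _ do rewrite e.
have -> : \sum_(S : {set 'I_n}) \prod_i (if i \in S then 1 else G i) = \prod_i (1 + G i).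
  by rewrite bigA_distr.
case: eqP => [AT|/eqP]; first by rewrite big1// => i _; rewrite /G AT finset.in_setT addr0.
rewrite -finset.subTset => /subsetPn[i _ iA].
by rewrite (bigD1 i)//= /G (negbTE iA) subrr mul0r.
Qed.

(* sum_S (-1)^(n - |S|) gamma(sum_{i in S} Y i) is n! times the symmetric
   multilinear form of a homogeneous polynomial gamma of degree n. *)
Definition polarization n (gamma : E -> T) (Y : 'I_n -> E) : T :=
  (n`!%:R)^-1 *: \sum_(S : {set 'I_n}) subset_sign S *: gamma (\sum_(i in S) Y i).

(** Expanding b on the sum over S gives the phi with image in S. The signs cancel every phi that is
    not onto, and onto means injective on a finite set. *)
Lemma polarization_homogeneous n (F : tvsType K) (b : E -> F) (B : ('I_n -> E) -> F) Y :
  multilinear (E := fun=> E) B -> (forall y, b y = B (fun=> y)) ->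
  \sum_(S : {set 'I_n}) subset_sign S *: b (\sum_(i in S) Y i) =
  \sum_(phi : {ffun 'I_n -> 'I_n} | injectiveb phi) B (Y \o phi).
Proof.
move=> mB bB.
have e (S : {set 'I_n}) : b (\sum_(i in S) Y i) =
    \sum_(phi : {ffun 'I_n -> 'I_n} | phi @: [set: 'I_n]%SET \subset S) B (Y \o phi).
  rewrite bB big_mkcond multilinear_expand//= [RHS]big_mkcond; apply: eq_bigr => phi _.
  case: ifPn => [/fintype.subsetP pS|/subsetPn[i /imsetP[l _ ->] nS]].
    congr B; apply/funext => l /=; case: ifPn => // /negP[]; apply: pS.
    by rewrite imset_f ?finset.in_setT.
  by rewrite (multilinear_eq0 (i := l))// (negbTE nS).
under eq_bigr => S _ do rewrite e scaler_sumr big_mkcond.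
rewrite exchange_big [RHS]big_mkcond; apply: eq_bigr => phi _.
rewrite -big_mkcond -scaler_suml sum_subset_sign.
have -> : (phi @: [set: 'I_n]%SET == [set: 'I_n]%SET) = injectiveb phi.
  apply/idP/injectiveP => [/eqP h|h].
    have /imset_injP h' : #|phi @: [set: 'I_n]%SET| == #|[set: 'I_n]%SET| by rewrite h.
    by move=> i l; apply: h'; rewrite finset.in_setT.
  by rewrite finset.eqEcard finset.subsetT /= card_imset.
by case: ifP; rewrite ?scale1r ?scale0r.
Qed.

(** Each [lam w \o gamma] has a form of its own, and these need not fit together. Polarization is a
    formula in gamma, so it makes sense in T; its multilinearity may be checked after each [lam w],
    as these separate points. *)
Lemma homogeneous_poly_polarize n (F : tvsType K) W (lam : W -> T -> F) (gamma : E -> T) :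
  (forall w, linear (lam w)) -> (forall t t', (forall w, lam w t = lam w t') -> t = t') ->
  (forall w, homogeneous_poly n (lam w \o gamma)) -> homogeneous_poly n gamma.
Proof.
move=> llam jinj hlam.
have lamZ w a t : lam w (a *: t) = a *: lam w t.
  have l0 : lam w 0 = 0.
    have := llam w 1 0 0; rewrite !scale1r addr0 => /eqP.
    by rewrite -subr_eq0 opprD addNKr oppr_eq0 => /eqP.
  by have := llam w a t 0; rewrite l0 !addr0.
have lamD w t t' : lam w (t + t') = lam w t + lam w t'.
  by have := llam w 1 t t'; rewrite !scale1r.
have lam_sum w J (r : seq J) (P : pred J) (f : J -> T) :
    lam w (\sum_(j <- r | P j) f j) = \sum_(j <- r | P j) lam w (f j).
  apply: (big_morph (lam w)) => //.
  by have := lamZ w 0 0; rewrite !scale0r.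
have lamP w : exists2 B : ('I_n -> E) -> F, multilinear (E := fun=> E) B &
    (forall y, lam w (gamma y) = B (fun=> y)) /\
    forall Y, lam w (polarization gamma Y) =
    (n`!%:R)^-1 *: \sum_(phi : {ffun 'I_n -> 'I_n} | injectiveb phi) B (Y \o phi).
  have [B mB bB] := hlam w; exists B => //; split=> // Y.
  rewrite lamZ lam_sum -(polarization_homogeneous Y mB bB); congr (_ *: _).
  by apply: eq_bigr => S _; rewrite lamZ.
exists (@polarization n gamma) => [i v a x y|y]; apply: jinj => w; have [B mB [bB pB]] := lamP w.
  rewrite llam !pB scalerA mulrC -scalerA -scalerDr; congr (_ *: _).
  rewrite scaler_sumr -big_split /=; apply: eq_bigr => phi /injectiveP iphi.
  (* Slot i of v is read by the permuted tuple at position [psi i]. *)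
  have [psi psiK phiK] := injF_bij iphi.
  have e z : dfwith v i z \o phi = dfwith (v \o phi) (psi i) z.
    apply/funext => l /=; have [->|li] := eqVneq l (psi i).
      by rewrite phiK !dfwithin.
    rewrite dfwithout; last by apply: contraNneq li => ->; rewrite psiK.
    by rewrite dfwithout// eq_sym.
  by rewrite !e; exact: mB.
rewrite pB (eq_bigr (fun=> B (fun=> y)))// sumr_const -bB.
have -> : #|[pred phi : {ffun 'I_n -> 'I_n} | injectiveb phi]| = n`!.
  by rewrite -[LHS]cardsE card_inj_ffuns card_ord ffactnn.
by rewrite -(scaler_nat n`! (lam w (gamma y))) scalerA mulVf ?scale1r// pnatr_eq0 -lt0n fact_gt0.
Qed.

End Polarization.

(** * Power series *)

Section GeometricTail.
Context (R : realType).

(** Multiplication by 1 - q makes the sum telescope, and 1 / (1 - q) <= 2. *)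
Lemma geometric_tail (q : R) a N : 0 <= q <= 1 / 2 ->
  \sum_(l < N) (if (a <= l)%N then q ^+ l else 0) <= 2 * q ^+ a.
Proof.
move=> /andP[q0 q1].
suff : (1 - q) * \sum_(l < N) (if (a <= l)%N then q ^+ l else 0) <=
    q ^+ a - q ^+ maxn a N.
  have := exprn_ge0 (maxn a N) q0; have := exprn_ge0 a q0.
  have : 0 <= \sum_(l < N) (if (a <= l)%N then q ^+ l else 0).
    by apply: sumr_ge0 => l _; case: ifP => // _; exact: exprn_ge0.
  nra.
elim: N => [|N ih]; first by rewrite big_ord0 mulr0 maxn0 subrr.
rewrite big_ord_recr /= mulrDr; case: leqP => aN; last first.
  have e : (maxn a N.+1 = maxn a N) by lia.
  by rewrite mulr0 addr0 e.
have e : (maxn a N = N) by lia. have e' : (maxn a N.+1 = N.+1) by lia.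
by rewrite e in ih; rewrite e' exprS; lra.
Qed.

End GeometricTail.

Section PowerSeries.
Context (R : realType) (K : scalars) (F : tvsType (scal R K)).
Local Notation k := (scal R K).

Definition power_series (c : nat -> F) (z : k) (l : F) :=
  (fun N => \sum_(n < N) z ^+ n *: c n) @ \oo --> l.

Lemma power_series_scale c (z a : k) l : power_series c (a * z) l <->
  power_series (fun n => a ^+ n *: c n) z l.
Proof.
have e : (fun N => \sum_(n < N) (a * z) ^+ n *: c n) =
    (fun N => \sum_(n < N) z ^+ n *: (a ^+ n *: c n)).
  apply/funext => N; apply: eq_bigr => n _.
  by rewrite scalerA exprMn mulrC.
by rewrite /power_series e.
Qed.

Variables (p : F -> R) (hp : cont_seminorm p).

Lemma power_series_bounded c l : power_series c 1 l -> exists2 M, 0 <= M & forall n, p (c n) <= M.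
Proof.
move=> cl.
have : \forall N \near \oo, p (\sum_(n < N) 1 ^+ n *: c n - l) < 1 by exact (csn_cvg hp cl ltr01).
move=> [N0 _ NP].
have s0 : 0 <= \sum_(n < N0) p (c n) by apply: sumr_ge0 => n _; exact: csn_ge0.
exists (2 + \sum_(n < N0) p (c n)); first by lra.
move=> n; have [nN|nN] := ltnP n N0.
  rewrite (bigD1 (Ordinal nN))//=.
  have : 0 <= \sum_(i < N0 | i != Ordinal nN) p (c i).
    by apply: sumr_ge0 => i _; exact: csn_ge0.
  lra.
have := NP n nN; have := NP n.+1 (leq_trans nN (leqnSn n)) => /=.
rewrite big_ord_recr /= expr1n scale1r; set S := \sum_(i < n) _ => h1 h2.
have -> : c n = (S + c n - l) - (S - l) by lmod_eq (scal R K); ring.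
rewrite (le_trans (csn_sub hp _ _))//; lra.
Qed.

Lemma power_series_tail c (z : k) l M a : power_series c z l -> sabs z <= 1 / 2 ->
  (forall n, p (c n) <= M) -> p (l - \sum_(n < a) z ^+ n *: c n) <= M * (2 * sabs z ^+ a).
Proof.
move=> cl z1 cM; apply/ler_addgt0Pr => e e0.
have : \forall N \near \oo, p (\sum_(n < N) z ^+ n *: c n - l) < e by exact (csn_cvg hp cl e0).
move=> [N0 _ NP].
pose N := maxn N0 a.
have := NP N (leq_maxl _ _) => /=; set S := \sum_(n < N) _ => h1.
have M0 : 0 <= M by apply: le_trans (cM 0%N); exact: csn_ge0.
have h2 : p (S - \sum_(n < a) z ^+ n *: c n) <= M * (2 * sabs z ^+ a).
  have -> : S - \sum_(n < a) z ^+ n *: c n =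
      \sum_(n < N) (if (a <= n)%N then z ^+ n *: c n else 0).
    rewrite /S -2!(big_mkord xpredT (fun n => z ^+ n *: c n)).
    rewrite (big_cat_nat (n := a)) ?leq_maxr//= addrC addrK.
    rewrite -(big_mkord xpredT (fun n => if (a <= n)%N then z ^+ n *: c n else 0)).
    rewrite [RHS](big_cat_nat (n := a)) ?leq_maxr//=.
    rewrite [X in _ = X + _]big_nat_cond [X in _ = X + _]big1 ?add0r.
      by apply: eq_big_nat => i /andP[->].
    by move=> i /andP[/andP[_ ia] _]; rewrite leqNgt ia.
  apply: (le_trans (csn_sum hp _ _ _)).
  have /(ler_wpM2l M0) : \sum_(l < N) (if (a <= l)%N then sabs z ^+ l else 0) <= 2 * sabs z ^+ a.
    by apply: geometric_tail; rewrite sabs_ge0.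
  apply: le_trans; rewrite mulr_sumr; apply: ler_sum => n _; case: ifP => _.
    by rewrite (csn_scale hp) sabsX mulrC ler_wpM2r// exprn_ge0// sabs_ge0.
  by rewrite (csn0 hp) mulr0.
have -> : l - \sum_(n < a) z ^+ n *: c n = - (S - l) + (S - \sum_(n < a) z ^+ n *: c n).
  by lmod_eq (scal R K); ring.
rewrite (le_trans (csn_add hp _ _))// (csnN hp); lra.
Qed.

End PowerSeries.

Section Uniqueness.
Context (R : realType) (K : scalars) (F : tvsType (scal R K)) (hF : hausdorff_space F).

(** If all coefficients before n vanish, then evaluation at q d and the tail estimate after n give p
    (d^n c n) <= 2 M q for all small q. Positive real arguments suffice, which is what the rays t w
    provide. *)
Lemma power_series_eq0 (c : nat -> F) (d : R) : 0 < d ->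
  (forall t, 0 < t <= d -> power_series c (rinc t) 0) -> forall n, c n = 0.
Proof.
move=> d0 hc n; elim/ltn_ind: n => n ih.
apply: (csn_eq0 hF) => p hp.
have hd : power_series (fun n => rinc d ^+ n *: c n) 1 0.
  by apply/power_series_scale; rewrite mulr1; apply: hc; rewrite d0 lexx.
have [M M0 cM] := power_series_bounded hp hd.
have h q : 0 < q <= 1 / 2 -> p (rinc d ^+ n *: c n) <= 2 * M * q.
  move=> /andP[q0 q1].
  have hq : power_series (fun n => rinc d ^+ n *: c n) (rinc q) 0.
    by apply/power_series_scale; rewrite -rincM; apply: hc; rewrite mulr_gt0//=; nra.
  have := power_series_tail hp n.+1 hq; rewrite sabs_rinc gtr0_norm// => /(_ M q1 cM).
  rewrite big_ord_recr /= big1 ?add0r ?sub0r ?csnN//; last first.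
    by move=> i _; rewrite ih// !scaler0.
  rewrite (csn_scale hp) -rincX sabs_rinc gtr0_norm ?exprn_gt0// exprS.
  have -> : M * (2 * (q * q ^+ n)) = q ^+ n * (2 * M * q) by ring.
  by rewrite ler_pM2l// exprn_gt0.
have : p (rinc d ^+ n *: c n) <= 0.
  apply/ler_addgt0Pr => e e0; rewrite add0r.
  pose q := Num.min (1 / 2) (e / (2 * M + 1)).
  have q0 : 0 < q by rewrite lt_min !divr_gt0//; lra.
  have q1 : q <= 1 / 2 by rewrite ge_min lexx.
  have q2 : q * (2 * M + 1) <= e by rewrite -ler_pdivlMr ?ge_min ?lexx ?orbT//; lra.
  by have := h q; rewrite q0 q1 => /(_ isT); nra.
rewrite (csn_scale hp) -rincX sabs_rinc gtr0_norm ?exprn_gt0// pmulr_rle0 ?exprn_gt0// => h0.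
by apply/eqP; rewrite eq_le h0 csn_ge0.
Qed.

Lemma power_series_unique (c c' : nat -> F) (d : R) (l : R -> F) : 0 < d ->
  (forall t, 0 < t <= d -> power_series c (rinc t) (l t)) ->
  (forall t, 0 < t <= d -> power_series c' (rinc t) (l t)) -> forall n, c n = c' n.
Proof.
move=> d0 h h' n; apply/eqP; rewrite -subr_eq0; apply/eqP.
apply: (power_series_eq0 (c := fun n => c n - c' n) d0) => t td.
have e : (fun N => \sum_(n < N) rinc t ^+ n *: (c n - c' n)) =
    (fun N => \sum_(n < N) rinc t ^+ n *: c n - \sum_(n < N) rinc t ^+ n *: c' n).
  by apply/funext => N; rewrite -sumrB; apply: eq_bigr => i _; rewrite scalerBr.
have cv : (fun N => \sum_(n < N) rinc t ^+ n *: c n - \sum_(n < N) rinc t ^+ n *: c' n)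
    @ \oo --> l t - l t.
  by apply: cvg_subT; [exact (h t td)|exact (h' t td)].
by rewrite subrr in cv; rewrite /power_series e.
Qed.

Lemma finite_power_series (c : nat -> F) m (z : scal R K) : (forall n, (m <= n)%N -> c n = 0) ->
  power_series c z (\sum_(n < m) z ^+ n *: c n).
Proof.
move=> c0; apply: (@cvg_near_eq _ _ _ (fun=> \sum_(n < m) z ^+ n *: c n)); last exact: cvg_cst.
exists m => // N /= mN.
rewrite -2!(big_mkord xpredT (fun n => z ^+ n *: c n)) (big_cat_nat (n := m) (p := N))//=.
by rewrite [X in _ = _ + X]big_nat_cond [X in _ = _ + X]big1 ?addr0// => i /andP[/andP[mi _] _]; rewrite c0// scaler0.
Qed.

End Uniqueness.

(** * Cauchy estimates from roots of unity *)

Section Cauchy.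
Context (R : realType).
Local Notation C := (scal R Complexes).

(** X^n - 1 splits and is separable, and a set of n distinct n-th roots of unity contains a
    primitive one. *)
Lemma prim_root_exists n : (0 < n)%N -> exists z : C, n.-primitive_root z.
Proof.
move=> n_gt0; suff [z zP] : exists z : R[i], n.-primitive_root z by exists z.
pose p : {poly R[i]} := 'X^n - 1; have [r Dp] := closed_field_poly_normal p.
rewrite (monicP _) ?monicXnsubC // scale1r in Dp.
have rn1: all n.-unity_root r by apply/allP=> z; rewrite -root_prod_XsubC -Dp.
have sz_r: (n < (size r).+1)%N.
  by rewrite -(size_prod_XsubC r id) -Dp size_XnsubC.
have [|z] := hasP (cyclic.has_prim_root n_gt0 rn1 _ sz_r); last by exists z.
by rewrite -separable.separable_prod_XsubC -Dp cyclotomic.separable_Xn_sub_1 // pnatr_eq0 -lt0n.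
Qed.

Lemma unity_root_sum m (w : C) a b : m.-primitive_root w ->
  \sum_(j < m) (w ^+ a)^-1 ^+ j * (w ^+ b) ^+ j = (m%:R * (b == a %[mod m])%:R) :> C.
Proof.
move=> wP; have m0 := prim_order_gt0 wP.
have w0 : w != 0.
  by apply/eqP => w0; have := prim_expr_order wP; rewrite w0 expr0n gtn_eqF// => /eqP; rewrite eq_sym oner_eq0.
pose u := (w ^+ a)^-1 * w ^+ b.
under eq_bigr => j _ do rewrite -exprMn -/u.
rewrite -(eq_prim_root_expr wP).
have u1 : (u == 1) = (w ^+ b == w ^+ a).
  by rewrite /u -(inj_eq (mulfI (expf_neq0 a w0))) mulrA mulfV ?mul1r ?mulr1// expf_neq0.
have [ba|ba] := eqVneq (w ^+ b) (w ^+ a).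
  have -> : u = 1 by apply/eqP; rewrite u1 ba.
  by under eq_bigr => j _ do rewrite expr1n; rewrite sumr_const card_ord mulr1.
rewrite (negbTE ba) in u1; rewrite mulr0; apply: (mulfI (x := u - 1)); first by rewrite subr_eq0 u1.
have um : u ^+ m = 1.
  by rewrite /u exprMn exprVn -!exprM ![(_ * m)%N]mulnC !exprM (prim_expr_order wP) !expr1n invr1 mulr1.
by rewrite mulr0 -subrX1 um subrr.
Qed.

Context (F : tvsType C).
Variables (p : F -> R) (hp : cont_seminorm p).

Lemma sabs_prim_root m (w : C) : m.-primitive_root w -> sabs w = 1.
Proof.
move=> wP; have m0 := prim_order_gt0 wP; apply/eqP.
by rewrite -(pexpr_eq1 m0) ?sabs_ge0// -sabsX (prim_expr_order wP) sabs1.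
Qed.

(** The discrete form of the Cauchy integral: it isolates the coefficients whose index is congruent
    to a modulo m. *)
Lemma unity_average (c : nat -> F) (r w : C) m a N : m.-primitive_root w ->
  \sum_(j < m) (w ^+ a)^-1 ^+ j *: (\sum_(l < N) (r * w ^+ j) ^+ l *: c l) =
  m%:R *: \sum_(l < N | (l == a %[mod m])) r ^+ l *: c l.
Proof.
move=> wP; under eq_bigr => j _ do rewrite scaler_sumr.
rewrite exchange_big scaler_sumr [RHS]big_mkcond /=; apply: eq_bigr => l _.
have -> : \sum_(j < m) (w ^+ a)^-1 ^+ j *: ((r * w ^+ j) ^+ l *: c l) =
    (\sum_(j < m) (w ^+ a)^-1 ^+ j * (w ^+ l) ^+ j) *: (r ^+ l *: c l).
  rewrite scaler_suml; apply: eq_bigr => j _; rewrite !scalerA; congr (_ *: _).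
  by rewrite exprMn -!exprM [(j * l)%N]mulnC -mulrA [r ^+ l * _]mulrC.
by rewrite (unity_root_sum _ _ wP); case: eqP; rewrite ?mulr1// mulr0 scale0r.
Qed.

(** Averaging over m-th roots of unity on the circle of radius 1/2 bounds r^n c n, up to the aliased
    terms with index at least m. By the crude bound M' on the coefficients these are at most 2 M'
    r^m and disappear as m grows, so M' leaves no trace; the factor 2^n is r^(-n). *)
Lemma cauchy_estimate (c : nat -> F) (phi : C -> F) (M : R) :
  (forall z, sabs z <= 1 -> power_series c z (phi z)) ->
  (forall z, sabs z <= 1 -> p (phi z) <= M) -> forall n, p (c n) <= M * 2 ^+ n.
Proof.
move=> cphi phiM n.
have s1 : sabs (1 : C) <= 1 by rewrite sabs1.
have [M' M'0 cM'] := power_series_bounded hp (cphi 1 s1).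
have M0 : 0 <= M by apply: le_trans (phiM 1 s1); exact: csn_ge0.
pose r : R := 1 / 2.
have r0 : 0 < r by rewrite /r; lra.
have rn0 : 0 < r ^+ n by exact: exprn_gt0.
suff h e m : 0 < e -> (n < m)%N -> p (rinc r ^+ n *: c n) <= M + e + M' * (2 * r ^+ m).
  have h1 : p (rinc r ^+ n *: c n) <= M.
    apply/ler_addgt0Pr => e e0.
    have e20 : 0 < e / 2 by lra.
    have h2 : (fun m => M' * (2 * r ^+ m)) @ \oo --> M' * (2 * 0).
      apply: cvgMr; apply: cvgMr; apply: cvg_expr.
      by rewrite gtr0_norm// /r; lra.
    rewrite !mulr0 in h2.
    have : \forall m \near \oo, `|0 - M' * (2 * r ^+ m)| < e / 2.
      by move/cvgrPdist_lt: h2 => /(_ _ e20).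
    move=> [m0 _ /(_ (maxn m0 n.+1) (leq_maxl _ _))] /=; rewrite sub0r normrN => h3.
    have := h _ (maxn m0 n.+1) e20 (leq_maxr _ _).
    have := ler_norm (M' * (2 * r ^+ maxn m0 n.+1)); lra.
  rewrite (csn_scale hp) -rincX sabs_rinc (gtr0_norm rn0) in h1.
  have -> : (2 : R) ^+ n = (r ^+ n)^-1 by rewrite -exprVn /r invf_div divr1.
  by rewrite ler_pdivlMr// mulrC.
move=> e0 nm.
have [w wP] := prim_root_exists (leq_ltn_trans (leq0n n) nm).
have sw := sabs_prim_root wP.
have srw j : sabs (rinc r * w ^+ j) = r.
  by rewrite sabsM sabs_rinc sabsX sw expr1n mulr1 gtr0_norm.
(* One truncation for all m points on the circle. *)
have : \forall N \near \oo, forall j : 'I_m,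
    p (\sum_(l < N) (rinc r * w ^+ j) ^+ l *: c l - phi (rinc r * w ^+ j)) < e.
  apply: filter_forall => j; have := cphi (rinc r * w ^+ j).
  by rewrite srw => /(_ ltac:(rewrite /r; lra)) cj; exact (csn_cvg hp cj e0).
move=> [N0 _ /(_ (maxn N0 n.+1) (leq_maxl _ _))] /=.
set N := maxn N0 n.+1 => hN.
have nN : (n < N)%N by rewrite leq_maxr.
have m0 : (m%:R : R) != 0 by rewrite pnatr_eq0 -lt0n (leq_ltn_trans _ nm).
have := @unity_average c (rinc r) w m n N wP.
set A := \sum_(j < m) _ => hA.
have pA : p A <= m%:R * (M + e).
  rewrite (le_trans (csn_sum hp _ _ _))//.
  have -> : m%:R * (M + e) = \sum_(j < m) (M + e) by rewrite sumr_const card_ord mulr_natl.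
  apply: ler_sum => j _; rewrite (csn_scale hp) sabsX sabsV sabsX sw expr1n invr1 expr1n mul1r.
  have := hN j; have := phiM (rinc r * w ^+ j); rewrite srw => /(_ ltac:(rewrite /r; lra)) h1 h2.
  rewrite (le_trans (csn_le hp _ (phi (rinc r * w ^+ j))))//; lra.
have mR : (m%:R : C) = rinc m%:R.
  by elim: (m) => [|i ih]; rewrite ?rinc0// -!natr1 rincD -ih rinc1.
have pS : p (\sum_(l < N | (l == n %[mod m])) rinc r ^+ l *: c l) <= M + e.
  move: pA; rewrite hA mR csn_rinc// normr_nat ler_pM2l// lt_neqAle eq_sym m0 ler0n//.
move: pS; rewrite (bigD1 (Ordinal nN))//= => pS.
set S := \sum_(l < N | _) _ in pS.
have pS' : p S <= M' * (2 * r ^+ m).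
  have /(ler_wpM2l M'0) : \sum_(l < N) (if (m <= l)%N then r ^+ l else 0) <= 2 * r ^+ m.
    by apply: geometric_tail; rewrite /r; lra.
  apply: le_trans; rewrite (le_trans (csn_sum hp _ _ _))// mulr_sumr big_mkcond.
  apply: ler_sum => l _; case: ifPn => [/andP[lm ln]|_]; last first.
    by case: ifP => _; rewrite ?mulr0// mulr_ge0// exprn_ge0 ?ltW.
  (* An index congruent to n modulo m and different from n < m is at least m. *)
  rewrite ifT; last first.
    rewrite leqNgt; apply: contra ln => lm'; rewrite -val_eqE /=.
    by move: lm; rewrite !modn_small.
  by rewrite (csn_scale hp) sabsX sabs_rinc (gtr0_norm r0) mulrC ler_wpM2r ?exprn_ge0 ?cM' ?(ltW r0).
have -> : rinc r ^+ n *: c n = (rinc r ^+ n *: c n + S) - S by rewrite addrK.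
rewrite (le_trans (csn_sub hp _ _))//; lra.
Qed.

Lemma family_continuity (X : tvsType C) A (B : set A) (phi : A -> X -> F) (x : X) (Y : set X) (M : R) :
  nbhs 0 Y ->
  (forall h a, Y h -> B a -> exists2 c, c 0%N = phi a x & forall z, sabs z <= 1 ->
    power_series c z (phi a (x + z *: h)) /\ p (phi a (x + z *: h)) <= M) ->
  forall e, 0 < e -> \forall h \near (0 : X), forall a, B a -> p (phi a (x + h) - phi a x) <= e.
Proof.
move=> Y0 hphi e e0.
(* [M1] is a positive version of M. The estimate is applied at 2 q, so the tail after the constant
   term is at most 4 [M1] q; q <= 1/4 keeps 2 q within the range of [power_series_tail]. *)
pose M1 := Num.max M 1.
have M10 : 0 < M1 by rewrite lt_max ltr01 orbT.
pose q := Num.min (1 / 4) (e / (4 * M1)).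
have q0 : 0 < q by rewrite lt_min !divr_gt0//; lra.
have q1 : q <= 1 / 4 by rewrite ge_min lexx.
have q2 : q * (4 * M1) <= e by rewrite -ler_pdivlMr ?ge_min ?lexx ?orbT//; lra.
have cq : (fun h : X => rinc q^-1 *: h) @ (0 : X) --> rinc q^-1 *: (0 : X).
  by apply: cvg_scaleT; [exact: cvg_cst|exact: cvg_id].
rewrite scaler0 in cq.
have : \forall h \near (0 : X), Y (rinc q^-1 *: h) by exact: cq Y0.
apply: filterS => h Yh a Ba; have [c c0 cz] := hphi _ a Yh Ba.
have cM n : p (2^-1 ^+ n *: c n) <= M1.
  have := cauchy_estimate (fun z z1 => (cz z z1).1) (fun z z1 => (cz z z1).2) n.
  rewrite (csn_scale hp) sabsX => hn.
  have -> : sabs (2^-1 : C) = 2^-1.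
    by have := sabs_rinc Complexes (2^-1 : R); rewrite rincV rincD rinc1 => ->; rewrite ger0_norm// invr_ge0; lra.
  rewrite exprVn ler_pdivrMl ?exprn_gt0//.
  rewrite mulrC (le_trans hn)// ler_wpM2r ?exprn_ge0//.
  by rewrite le_max lexx.
have qs : sabs (rinc q : C) = q by rewrite sabs_rinc gtr0_norm.
have [|hs _] := cz (rinc q); first by rewrite qs; lra.
rewrite scalerA -rincM divff ?gt_eqF// rinc1 scale1r in hs.
have e2 : 2^-1 * (2 * rinc q) = rinc q :> C by rewrite mulrA mulVf ?mul1r// pnatr_eq0.
have hs' : power_series (fun n => 2^-1 ^+ n *: c n) (2 * rinc q) (phi a (x + h)).
  by rewrite -e2 in hs; exact ((power_series_scale _ _ _ _).1 hs).
have q3 : sabs (2 * rinc q : C) = 2 * q.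
  by have := sabs_rinc Complexes (2 * q); rewrite rincM rincD rinc1 => ->; rewrite gtr0_norm; lra.
have q4 : sabs (2 * rinc q : C) <= 1 / 2 by rewrite q3; lra.
have := power_series_tail hp 1 hs' q4 cM.
rewrite big_ord1 !expr0 !scale1r c0 expr1 q3 => /le_trans; apply; lra.
Qed.

End Cauchy.

Lemma rinc_nat (R : realType) (K : scalars) n : rinc n%:R = n%:R :> scal R K.
Proof. by elim: n => [|n ih]; rewrite ?rinc0// -!natr1 rincD ih rinc1. Qed.

Section Balanced.
Context (R : realType) (K : scalars) (X : tvsType (scal R K)).

Lemma balanced_near (x : X) (A : set X) (r : R) : 0 < r -> nbhs x A ->
  exists2 Y : set X, nbhs 0 Y & forall h, Y h -> forall z, sabs z <= r -> A (x + z *: h).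
Proof.
move=> r0 /nbhs_add/csn_exists[p hp pA].
exists [set h | p h < r^-1]; first by apply: csn_nbhs => //; rewrite invr_gt0.
move=> h /= ph z zr; apply: pA; rewrite (csn_scale hp).
have := csn_ge0 hp h; have := sabs_ge0 z => z0 h0.
apply: le_lt_trans (_ : r * p h < 1); first by rewrite ler_wpM2r.
by rewrite -ltr_pdivlMl// mulr1.
Qed.

Lemma absorbing (A : set X) (x : X) : nbhs 0 A ->
  exists2 d : R, 0 < d & forall t : R, `|t| < d -> A (rinc t *: x).
Proof.
move=> A0; have : (fun t : scal R K => t *: x) @ (0 : scal R K) --> (0 : scal R K) *: x.
  by apply: (@cvg_scaleT _ X _ (nbhs (0 : scal R K)) id (fun=> x)); [exact: cvg_id|exact: cvg_cst].
rewrite scale0r => /(_ _ A0) /near0_sabs[d d0 dA]; exists d => // t td.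
by apply: dA; rewrite sabs_rinc.
Qed.

End Balanced.

Section UnitSquare.
Context (R : realType).
Local Notation C := (scal R Complexes).

Definition imag_unit : C := ('i : R[i])%C.

Lemma sabs_ReIm (z : C) : exists a b : R, [/\ z = rinc a + rinc b * imag_unit,
  `|a| <= sabs z & `|b| <= sabs z].
Proof.
exists (complex.Re (z : R[i])), (complex.Im (z : R[i])); split.
- by rewrite [LHS](complexE (z : R[i])) mulrC.
- by rewrite -(rinc_le Complexes) sabs_norm; exact: (normc_ge_Re (z : R[i])).
- rewrite -(rinc_le Complexes) sabs_norm.
  rewrite (_ : `|z| = `|(z : R[i])|)// normc_def.
  rewrite -sqrtr_sqr; apply: (etrans (lecR _ _)).
  by rewrite ler_wsqrtr// lerDr sqr_ge0.
Qed.

(** A square, as the continuous image of a product of two segments, is a convenient compact set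
    around the unit disc. *)
Lemma square_compact : exists Q : set C, [/\ compact Q, forall z, sabs z <= 1 -> Q z &
  forall z, Q z -> sabs z <= 2].
Proof.
pose g (ab : R * R) : C := rinc ab.1 + rinc ab.2 * imag_unit.
pose S : set (R * R) := `[-1, 1]%classic `*` `[-1, 1]%classic.
have si : sabs imag_unit = 1.
  apply: (@rinc_inj _ Complexes); rewrite sabs_norm rinc1.
  by rewrite (_ : `| _ | = `|('i : R[i])%C|)// normc_def /= expr0n expr1n add0r sqrtr1.
exists (g @` S); split.
- apply: continuous_compact; last by apply: compact_setX; exact: segment_compact.
  apply: continuous_subspaceT => ab.
  have r1 : (fun ab : R * R => rinc ab.1 : C) @ ab --> (rinc ab.1 : C).
    apply: (@cvg_comp _ _ _ fst rinc _ (nbhs ab.1)); first exact: cvg_fst.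
    exact: rinc_continuous.
  have r2 : (fun ab : R * R => rinc ab.2 : C) @ ab --> (rinc ab.2 : C).
    apply: (@cvg_comp _ _ _ snd rinc _ (nbhs ab.2)); first exact: cvg_snd.
    exact: rinc_continuous.
  apply: cvgD; first exact: r1.
  by apply: cvgM; [exact: r2|exact: cvg_cst].
- move=> z z1; have [a [b [zab az bz]]] := sabs_ReIm z; rewrite zab.
  exists (a, b) => //; split; rewrite /= in_itv /= -ler_norml.
    exact: le_trans az z1.
  exact: le_trans bz z1.
- move=> _ [[a b] [/= + +] <-]; rewrite !in_itv /= -!ler_norml => a1 b1.
  apply: (le_trans (sabsD (rinc a) (rinc b * imag_unit))).
  rewrite sabsM !sabs_rinc si mulr1; lra.
Qed.

End UnitSquare.

Lemma power_series_at0 (R : realType) (K : scalars) (F : tvsType (scal R K)) (c : nat -> F) l :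
  hausdorff_space F -> power_series c 0 l -> l = c 0%N.
Proof.
move=> hF cl; apply: (tvs_cvg_unique hF _ cl).
apply: (@cvg_near_eq _ _ _ (fun=> c 0%N)); last exact: cvg_cst.
exists 1%N => // N /= N0; case: N N0 => // N _.
by rewrite big_ord_recl /= expr0 scale1r big1 ?addr0// => i _; rewrite expr0n scale0r.
Qed.

(** * Analytic maps to spaces of multilinear maps *)

Section AnalyticFunctionSpace.
Context (R : realType) (L : scalars) (I : finType).
Local Notation C := (scal R Complexes).
Context (E : I -> tvsType (scal R L)) (F T : tvsType C)
  (m : convergence_mode) (ev : T -> prod_topology E -> F)
  (act : scal R L -> F -> F).
Local Notation D := (prod_topology E).
Context (S : function_space m ev act).
Context (X : tvsType C).

Let hF := fs_hausdorff S.
Let k := #|I|.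

(** Continuity of f^ at (x, 0), where its value is 0. *)
Definition ev_null (f : X -> T) (x : X) :=
  (fun q : X * D => ev (f q.1) q.2) @ (x, 0) --> 0.

(** [ev_null] and the rescaling of v bound the functions z |-> f (x + z h)(v) by c^(-k), uniformly
    in v in B; power series with a common bound are equicontinuous by the Cauchy estimates. *)
Lemma fs_continuous_at (f : X -> T) x (Y : set X) : ev_null f x -> nbhs 0 Y ->
  (forall h w, Y h -> exists2 c, c 0%N = ev (f x) w & forall z, sabs z <= 1 ->
    power_series c z (ev (f (x + z *: h)) w)) -> f @ x --> f x.
Proof.
move=> fx Y0 hY; apply/(fs_cvgP S) => B p e mB hp e0.
have [[A W] /= [xA W0] AW] : \forall q \near (x, 0 : D), p (ev (f q.1) q.2 - 0) < 1.
  exact (csn_cvg hp fx ltr01).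
have [c c0 cB] := mode_sets_absorb mB W0.
have ck0 : 0 < c ^+ k by rewrite exprn_gt0.
have [Y' Y'0 Y'A] := balanced_near ltr01 xA.
have e20 : 0 < e / 2 by lra.
have h : \forall h \near (0 : X), forall v, B v -> p (ev (f (x + h)) v - ev (f x) v) <= e / 2.
  refine (@family_continuity _ _ p hp _ _ B (fun w x => ev (f x) w) x (Y `&` Y') (c ^+ k)^-1
    _ _ _ e20); first exact: filterI.
  move=> h v [Yh Y'h] Bv; have [d d0 dz] := hY h v Yh.
  exists d => // z z1; split; first exact: dz.
  have := AW (_, rinc c *: v) (conj (Y'A h Y'h z z1) (cB v Bv)) => /=.
  rewrite subr0 (act_multilinear_homog S _ _ (fs_mlin S _)) csn_rinc// gtr0_norm//.
  by rewrite -ltr_pdivlMl// mulr1 => /ltW.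
have : \forall x' \near x, forall v, B v -> p (ev (f (x + (x' - x))) v - ev (f x) v) <= e / 2.
  have xx : (fun x' => x' - x) @ x --> (0 : X) by apply: (cvg_sub0 _ _).1; exact: cvg_id.
  by exact: xx h.
apply: filterS => x' hx v Bv; have := hx v Bv; rewrite [x + _]addrC subrK; lra.
Qed.

(** For every t the values at t [w3], t [w1], t [w2] are related by multilinearity of [ev (phi t)],
    with the same a throughout; uniqueness on a common interval transfers the relation to the
    coefficients. *)
Lemma series_multilinear (b : nat -> D -> F) (phi : R -> T) :
  (forall w, exists2 d : R, 0 < d & forall t, 0 < t <= d ->
    power_series (b ^~ w) (rinc t) (ev (phi t) (rinc t *: w))) ->
  forall n, act_multilinear act (b n).
Proof.
move=> bs n i v a u u'.
pose w3 : D := dfwith v i (a *: u + u').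
pose w1 : D := dfwith v i u; pose w2 : D := dfwith v i u'.
change (b n w3 = act a (b n w1) + b n w2).
have [d1 d10 s1] := bs w1; have [d2 d20 s2] := bs w2; have [d3 d30 s3] := bs w3.
pose e := Num.min d1 (Num.min d2 d3).
have e0 : 0 < e by rewrite !lt_min d10 d20 d30.
refine (@power_series_unique _ _ F hF (b ^~ w3) (fun n => act a (b n w1) + b n w2) e
  (fun t => ev (phi t) (rinc t *: w3)) e0 _ _ n).
  by move=> t /andP[t0]; rewrite !le_min => /and3P[td1 td2 td3]; apply: s3; rewrite t0.
move=> t /andP[t0]; rewrite !le_min => /and3P[td1 td2 td3].
have {}s1 := s1 t (introT andP (conj t0 td1)); have {}s2 := s2 t (introT andP (conj t0 td2)).
have scd z : rinc t *: (dfwith v i z : D) = dfwith (rinc t *: v) i (rinc t *: z).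
  apply: functional_extensionality_dep => l; rewrite prod_scaleE.
  have [->|li] := eqVneq l i; first by rewrite !dfwithin.
  by rewrite !dfwithout// eq_sym.
rewrite /w3 scd scalerDr scalerA mulrC -scalerA (fs_mlin S) -!scd.
have c : (fun N => act a (\sum_(n < N) rinc t ^+ n *: b n w1) + \sum_(n < N) rinc t ^+ n *: b n w2)
    @ \oo --> act a (ev (phi t) (rinc t *: w1)) + ev (phi t) (rinc t *: w2).
  apply: cvg_addT; last exact s2.
  apply: (@cvg_comp _ _ _ _ (act a) \oo _ _ s1); exact: (fs_act_cont S).
rewrite /power_series; have -> : (fun N => \sum_(n < N) rinc t ^+ n *: (act a (b n w1) + b n w2)) =
  (fun N => act a (\sum_(n < N) rinc t ^+ n *: b n w1) + \sum_(n < N) rinc t ^+ n *: b n w2).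
  apply/funext => N; rewrite (act_sum S) -big_split; apply: eq_bigr => n' _.
  by rewrite (actZ S) scalerDr.
exact: c.
Qed.

(** The [b n] stand for the homogeneous terms of f^ at (x, 0), of total degree n in (y, w). Joint
    homogeneity is asked for real t only, because D is a space over L, which may be the reals. *)
Definition expandable (V : set X) (f : X -> T) (x : X) :=
  exists (Y : set X) (W : set D) (b : nat -> X -> D -> F), [/\ nbhs 0 Y, nbhs 0 W,
    forall n, [/\ continuous (fun q : X * D => b n q.1 q.2),
      forall w, exists2 c : nat -> X -> F, forall i, homogeneous_poly i (c i)
        & forall y, b n y w = \sum_(i < n.+1) c i y
      & forall (t : R) y w, b n (rinc t *: y) (rinc t *: w) = rinc t ^+ n *: b n y w]
    & forall y w, Y y -> W w -> V (x + y) /\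
      (fun N => \sum_(n < N) b n y w) @ \oo --> ev (f (x + y)) w].

Section Expansion.
Context (V : set X) (f : X -> T) (x : X) (Y : set X) (W : set D) (b : nat -> X -> D -> F).
Hypotheses (Y0 : nbhs 0 Y) (W0 : nbhs 0 W).
Hypothesis bc : forall n, continuous (fun q : X * D => b n q.1 q.2).
Hypothesis bp : forall n w, exists2 c : nat -> X -> F, forall i, homogeneous_poly i (c i)
  & forall y, b n y w = \sum_(i < n.+1) c i y.
Hypothesis bh : forall n (t : R) y w, b n (rinc t *: y) (rinc t *: w) = rinc t ^+ n *: b n y w.
Hypothesis bs : forall y w, Y y -> W w -> V (x + y) /\
  (fun N => \sum_(n < N) b n y w) @ \oo --> ev (f (x + y)) w.

Lemma ray_power_series y w (t : R) : Y (rinc t *: y) -> W (rinc t *: w) ->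
  power_series (fun n => b n y w) (rinc t) (ev (f (x + rinc t *: y)) (rinc t *: w)).
Proof.
move=> Yt Wt; have [_] := bs Yt Wt; rewrite /power_series.
have -> : (fun N => \sum_(n < N) b n (rinc t *: y) (rinc t *: w)) =
    (fun N => \sum_(n < N) rinc t ^+ n *: b n y w).
  by apply/funext => N; apply: eq_bigr => n _; rewrite bh.
by [].
Qed.

Lemma expansion_mlin n y : act_multilinear act (b n y).
Proof.
apply: (series_multilinear (phi := fun t => f (x + rinc t *: y)) (b := fun n => b n y)) => w.
have [d d0 dY] := absorbing y Y0.
have [d' d'0 dW] := @absorbing _ _ (restrictScal (real_subfield L) D) W w W0.
exists (Num.min d d' / 2) => [|t /andP[t0]]; first by rewrite divr_gt0// lt_min d0.
move=> td; have : t < Num.min d d' by rewrite (le_lt_trans td)// gtr_pMr ?lt_min ?d0//; lra.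
rewrite lt_min => /andP[td1 td2]; apply: ray_power_series; [apply: dY|apply: dW]; by rewrite gtr0_norm.
Qed.

(** The total degree is n and the degree in w is k, so the degree in y is n - k. Formally, t^k b n
    (t y) w = t^n b n y w, and coefficients of powers of t are compared. *)
Lemma expansion_degree n w :
  ((n < k)%N -> forall y, b n y w = 0) /\ ((k <= n)%N -> homogeneous_poly (n - k) (b n ^~ w)).
Proof.
have [c ch cb] := bp n w.
have key y (t : R) : rinc t ^+ k *: (\sum_(i < n.+1) rinc t ^+ i *: c i y) = rinc t ^+ n *: b n y w.
  rewrite -bh (act_multilinear_homog S _ _ (expansion_mlin n _)) -rincX cb.
  by congr (_ *: _); apply: eq_bigr => i _; rewrite (homogeneous_poly_scale _ _ (ch i)).
pose c' y i := if (k <= i)%N && (i - k <= n)%N then c (i - k)%N y else 0.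
pose c'' y i := if i == n then b n y w else 0.
have e y i : c' y i = c'' y i.
  refine (@power_series_unique _ _ F hF (c' y) (c'' y) 1 (fun t => rinc t ^+ n *: b n y w) ltr01 _ _ i).
    move=> t _; rewrite -key.
    have -> : rinc t ^+ k *: (\sum_(i < n.+1) rinc t ^+ i *: c i y) =
        \sum_(i < k + n.+1) rinc t ^+ i *: c' y i.
      rewrite big_split_ord /= [X in _ = X + _]big1 ?add0r; last first.
        by move=> i' _; rewrite /c' /= leqNgt ltn_ord scaler0.
      rewrite scaler_sumr; apply: eq_bigr => i' _; rewrite /c' /= leq_addr addKn -ltnS ltn_ord /=.
      by rewrite scalerA -exprD.
    apply: finite_power_series => i' ki; rewrite /c'; case: andP => // -[ki' ni'].
    by move: ki ki' ni'; lia.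
  move=> t _.
  have -> : rinc t ^+ n *: b n y w = \sum_(i < n.+1) rinc t ^+ i *: c'' y i.
    rewrite big_ord_recr /= big1 ?add0r /c'' ?eqxx// => i' _.
    by rewrite ltn_eqF ?ltn_ord// scaler0.
  by apply: finite_power_series => i' ni'; rewrite /c'' gtn_eqF.
split=> [nk y|kn].
  by have := e y n; rewrite /c' /c'' eqxx leqNgt nk.
have -> : b n ^~ w = c (n - k)%N; last exact: ch.
by apply/funext => y; have := e y n; rewrite /c' /c'' eqxx kn leq_subr.
Qed.

Lemma expansion_slice n y : continuous (b n y).
Proof.
move=> w; apply: (@cvg_comp _ _ _ (fun w => (y, w)) (fun q : X * D => b n q.1 q.2)
  (nbhs w) (nbhs (y, w))); last exact (@bc n (y, w)).
by apply: (@cvg_pair _ _ _ (nbhs w) (nbhs y) (nbhs w)); [exact: cvg_cst|exact: cvg_id].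
Qed.

(** Degree n in y occurs in total degree n + k, as w takes up degree k. *)
Definition taylor n y : T := sval (cid (fs_surj S (expansion_mlin (n + k)%N y) (@expansion_slice (n + k)%N y))).

Lemma taylorE n y : ev (taylor n y) = b (n + k)%N y.
Proof. by rewrite /taylor; case: cid. Qed.

Lemma taylor_homogeneous n : homogeneous_poly n (taylor n).
Proof.
apply: (@homogeneous_poly_polarize _ X T n F D (fun w t => ev t w)).
- by move=> w a t t'; exact: (fs_lin S).
- by move=> t t' h; apply: (fs_inj S); apply/funext.
- move=> w; have := (expansion_degree (n + k)%N w).2 (leq_addl _ _); rewrite addnK.
  by rewrite (_ : b (n + k)%N ^~ w = (fun t => ev t w) \o taylor n)//;
    apply/funext => y /=; rewrite taylorE.
Qed.

(** For w in W the first k terms of the joint expansion vanish and the rest is reindexed. Both sides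
    are homogeneous in w, so a multiple of w in W settles arbitrary w. *)
Lemma taylor_series y w : Y y -> power_series (fun n => ev (taylor n y) w) 1 (ev (f (x + y)) w).
Proof.
move=> Yy.
have sW w' : W w' -> power_series (fun n => ev (taylor n y) w') 1 (ev (f (x + y)) w').
  move=> Ww'; have [_ hs] := bs Yy Ww'; rewrite /power_series.
  have hs' : (fun N => \sum_(n < N + k) b n y w') @ \oo --> ev (f (x + y)) w'.
    move=> A /hs[N0 _ NP]; exists N0 => // N /= N0N; apply: NP => /=.
    exact: leq_trans N0N (leq_addr _ _).
  have <- : (fun N => \sum_(n < N + k) b n y w') = (fun N => \sum_(n < N) 1 ^+ n *: ev (taylor n y) w').
    apply/funext => N; rewrite addnC big_split_ord /= big1 ?add0r; last first.
      by move=> i _; rewrite ((expansion_degree i w').1 (ltn_ord i)).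
    by apply: eq_bigr => i _; rewrite expr1n scale1r taylorE addnC.
  exact: hs'.
have [d d0 dW] := @absorbing _ _ (restrictScal (real_subfield L) D) W w W0.
pose t := d / 2; have t0 : 0 < t by rewrite /t; lra.
have Wt : W (rinc t *: w) by have := dW t; rewrite gtr0_norm//; apply; rewrite /t; lra.
have tk0 : (rinc (t ^+ k) : C) != 0 by rewrite rinc_eq0 expf_neq0// gt_eqF.
have h t' v : ev t' (rinc t *: v) = rinc (t ^+ k) *: ev t' v.
  exact: (act_multilinear_homog S _ _ (fs_mlin S t')).
have := sW _ Wt; rewrite h /power_series => hs.
have c : (fun N => (rinc (t ^+ k))^-1 *: (\sum_(n < N) 1 ^+ n *: ev (taylor n y) (rinc t *: w)))
    @ \oo --> (rinc (t ^+ k))^-1 *: (rinc (t ^+ k) *: ev (f (x + y)) w).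
  by apply: cvg_scaleT; [exact: cvg_cst|exact: hs].
rewrite scalerA mulVf// scale1r in c.
have -> : (fun N => \sum_(n < N) 1 ^+ n *: ev (taylor n y) w) =
  (fun N => (rinc (t ^+ k))^-1 *: (\sum_(n < N) 1 ^+ n *: ev (taylor n y) (rinc t *: w))).
  apply/funext => N; rewrite scaler_sumr; apply: eq_bigr => n _.
  by rewrite h !expr1n !scale1r scalerA mulVf// scale1r.
exact: c.
Qed.

Lemma taylor_scale n z y w : ev (taylor n (z *: y)) w = z ^+ n *: ev (taylor n y) w.
Proof. by rewrite (homogeneous_poly_scale _ _ (taylor_homogeneous n)) (fs_evZ S). Qed.

Lemma taylor_series_scale z y w : Y (z *: y) ->
  power_series (fun n => ev (taylor n y) w) z (ev (f (x + z *: y)) w).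
Proof.
move=> Yz; have := taylor_series (w := w) Yz.
have -> : (fun n => ev (taylor n (z *: y)) w) = (fun n => z ^+ n *: ev (taylor n y) w).
  by apply/funext => n; rewrite taylor_scale.
by move=> /power_series_scale; rewrite mulr1.
Qed.

Lemma taylor_null n y : ev_null (taylor n) y.
Proof.
have h : (fun q : X * D => b (n + k)%N q.1 q.2) @ (y, 0) --> b (n + k)%N y 0.
  exact (@bc (n + k)%N (y, 0)).
rewrite (act_multilinear0 S (expansion_mlin _ _)) in h.
rewrite /ev_null; have -> : (fun q : X * D => ev (taylor n q.1) q.2) = (fun q : X * D => b (n + k)%N q.1 q.2).
  by apply/funext => q; rewrite taylorE.
by [].
Qed.

(** Evaluated at w, the map z |-> [taylor n (y + z *: h)] is a polynomial, hence a convergent power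
    series, and [fs_continuous_at] applies. *)
Lemma taylor_continuous n : continuous (taylor n).
Proof.
move=> y; apply: (@fs_continuous_at (taylor n) y setT (taylor_null n y)); first exact: filterT.
move=> h w _.
have hp : homogeneous_poly n (fun y => ev (taylor n y) w).
  have := taylor_homogeneous n => -[B mB bB].
  exists (fun Y => ev (B Y) w) => [i v a u u'|u]; last by rewrite bB.
  by rewrite mB (fs_lin S).
have [c [_ cs cz]] := homogeneous_poly_expand hp.
pose d i := if (i < n.+1)%N then c i h y else 0.
have dz z : ev (taylor n (y + z *: h)) w = \sum_(i < n.+1) z ^+ i *: d i.
  rewrite addrC cs; apply: eq_bigr => i _; rewrite /d ltn_ord.
  by have := cz i z 1 h y (ltn_ord i); rewrite scale1r expr1n mulr1.
have ds z : power_series d z (ev (taylor n (y + z *: h)) w).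
  by rewrite dz; apply: finite_power_series => i; rewrite leqNgt /d => /negbTE ->.
exists d => //; apply/esym.
by have := power_series_at0 hF (ds 0); rewrite scale0r addr0.
Qed.

Lemma expansion_continuous : ev_null f x -> f @ x --> f x.
Proof.
move=> fx; have [Y' Y'0 Y'P] := balanced_near (x := 0) (r := 1) ltr01 Y0.
apply: (@fs_continuous_at f x Y' fx Y'0) => h w Yh.
have ds z : sabs z <= 1 -> power_series (fun n => ev (taylor n h) w) z (ev (f (x + z *: h)) w).
  by move=> z1; apply: taylor_series_scale; have := Y'P h Yh z z1; rewrite add0r.
exists (fun n => ev (taylor n h) w) => //; apply/esym.
have s0 : sabs (0 : C) <= 1 by rewrite sabs0.
by have := power_series_at0 hF (ds 0 s0); rewrite scale0r addr0.
Qed.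

Lemma taylor_cvg : (forall x, V x -> ev_null f x) -> exists2 Y' : set X, nbhs 0 Y' &
  forall y, Y' y -> V (x + y) /\ (fun N => \sum_(n < N) taylor n y) @ \oo --> f (x + y).
Proof.
(* 8 = 2 * 4: points of Q have modulus at most 2, and f is examined along z (4 y). Of the gain 4^n,
   one factor 2^n pays for the Cauchy estimate, and the other makes the series at y converge
   geometrically. *)
move=> Vnull; have r0 : (0 : R) < 8 by lra.
have [Y' Y'0 Y'P] := balanced_near (x := 0) r0 Y0.
have {}Y'P y z : Y' y -> sabs z <= 8 -> Y (z *: y).
  by move=> Yy z8; have := Y'P y Yy z z8; rewrite add0r.
have YV y : Y y -> V (x + y).
  by move=> Yy; have [] := bs Yy (nbhs_singleton W0).
exists Y' => // y Yy.
have Yy1 : Y y by have := Y'P y 1 Yy; rewrite scale1r sabs1; apply; lra.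
split; first exact: YV.
apply/(fs_cvgP S) => B p e mB hp e0.
have [Q [cQ Q1 Q2]] := square_compact R.
have s4 : sabs (4 : C) = 4.
  have -> : (4 : C) = rinc 4 by rewrite rinc_nat.
  by rewrite sabs_rinc ger0_norm.
have QY z : Q z -> Y ((z * 4) *: y).
  by move=> Qz; apply: Y'P => //; rewrite sabsM s4; have := Q2 z Qz; lra.
(* [ev_null] gives a 0-neighbourhood of D near each z; compactness of Q yields a common one. *)
have [W1 W10 W1P] : exists2 W1 : set D, nbhs 0 W1 & forall w, W1 w -> forall z, Q z ->
    p (ev (f (x + (z * 4) *: y)) w) <= 1.
  exists [set w | forall z, Q z -> p (ev (f (x + (z * 4) *: y)) w) <= 1] => //.
  have /compact_near_coveringP cov := cQ.
  apply: (cov _ (nbhs (0 : D)) (fun w z => p (ev (f (x + (z * 4) *: y)) w) <= 1)) => z Qz.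
  have zc : (fun q : C * D => x + (q.1 * 4) *: y) @ (z, 0 : D) --> x + (z * 4) *: y.
    apply: cvg_addT; first exact: cvg_cst.
    apply: cvg_scaleT; last exact: cvg_cst.
    by apply: cvgM; [exact: cvg_fst|exact: cvg_cst].
  have fc : (fun q : C * D => ev (f (x + (q.1 * 4) *: y)) q.2) @ (z, 0 : D) --> 0.
    apply: (@cvg_comp _ _ _ (fun q : C * D => (x + (q.1 * 4) *: y, q.2))
      (fun q : X * D => ev (f q.1) q.2) (nbhs (z, 0 : D)) (nbhs (x + (z * 4) *: y, 0 : D))); last first.
      exact/Vnull/YV/QY.
    by apply: (@cvg_pair _ _ _ (nbhs (z, 0 : D)) (nbhs (x + (z * 4) *: y)) (nbhs (0 : D))) => //; exact: cvg_snd.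
  have [[A1 A2] /= [A1z A20] AP] : \forall q \near (z, 0 : D), p (ev (f (x + (q.1 * 4) *: y)) q.2 - 0) < 1.
    exact (csn_cvg hp fc ltr01).
  exists (A1, A2) => //= -[z' w] /= [A1z' A2w].
  by have := AP (z', w) (conj A1z' A2w); rewrite /= subr0 => /ltW.
have [c c0 cB] := mode_sets_absorb mB W10.
have ck0 : 0 < c ^+ k by rewrite exprn_gt0.
pose M := (c ^+ k)^-1.
have M0 : 0 < M by rewrite invr_gt0.
have bound n w : B w -> p (2 ^+ n *: ev (taylor n y) w) <= M.
  move=> Bw.
  have := @cauchy_estimate _ F p hp (fun n => ev (taylor n (4 *: y)) (rinc c *: w))
    (fun z => ev (f (x + z *: (4 *: y))) (rinc c *: w)) 1 _ _ n.
  rewrite mul1r taylor_scale (act_multilinear_homog S _ _ (fs_mlin S _)) => h.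
  have {h} : p (4 ^+ n *: (rinc (c ^+ k) *: ev (taylor n y) w)) <= 2 ^+ n.
    apply: h => z z1.
      by apply: taylor_series_scale; rewrite scalerA; exact/QY/Q1.
    by rewrite scalerA; apply: W1P; [exact: cB|exact: Q1].
  rewrite !(csn_scale hp) !sabsX s4 sabs_rinc (gtr0_norm ck0).
  have -> : sabs (2 : C) = 2.
    have -> : (2 : C) = rinc 2 by rewrite rinc_nat.
    by rewrite sabs_rinc ger0_norm.
  have -> : (4 : R) ^+ n = 2 ^+ n * 2 ^+ n by rewrite -exprMn; congr (_ ^+ _); lra.
  have n0 : (0 : R) < 2 ^+ n by rewrite exprn_gt0.
  rewrite -mulrA -[X in _ <= X]mulr1 ler_pM2l// mulrCA -ler_pdivlMl// mulr1.
  by [].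
have cg : (fun N => M * (2 * (1 / 2) ^+ N)) @ \oo --> M * (2 * 0).
  by apply: cvgMr; apply: cvgMr; apply: cvg_expr; rewrite gtr0_norm; lra.
rewrite !mulr0 in cg.
have : \forall N \near \oo, `|0 - M * (2 * (1 / 2) ^+ N)| < e by move/cvgrPdist_lt: cg => /(_ _ e0).
apply: filterS => N; rewrite sub0r normrN => hN v Bv.
rewrite (fs_ev_sum S).
have s2 : sabs (2^-1 : C) = 1 / 2.
  have -> : (2^-1 : C) = rinc 2^-1 by rewrite rincV rinc_nat.
  by rewrite sabs_rinc ger0_norm ?invr_ge0// div1r.
have ps : power_series (fun n => 2 ^+ n *: ev (taylor n y) v) 2^-1 (ev (f (x + y)) v).
  by apply/power_series_scale; rewrite mulfV ?pnatr_eq0//; exact: taylor_series.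
have s2' : sabs (2^-1 : C) <= 1 / 2 by rewrite s2.
have := power_series_tail hp N ps s2' (fun n => bound n v Bv); rewrite s2.
have -> : \sum_(n < N) 2^-1 ^+ n *: (2 ^+ n *: ev (taylor n y) v) = \sum_(n < N) ev (taylor n y) v.
  by apply: eq_bigr => n _; rewrite scalerA -exprMn mulVf ?pnatr_eq0// expr1n scale1r.
rewrite (csnB hp) => h; apply: le_lt_trans h _; apply: le_lt_trans hN; exact: ler_norm.
Qed.

End Expansion.

Theorem fs_analytic (V : set X) (f : X -> T) : open V ->
  (forall x, V x -> ev_null f x) -> (forall x, V x -> expandable V f x) ->
  @complex_analytic R X T V f.
Proof.
move=> oV Vnull Vexp; split.
  rewrite continuous_open_subspace// => x; rewrite inE => Vx.
  have [Y [W [b [Y0 W0 hb bs]]]] := Vexp x Vx.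
  have bc n : continuous (fun q : X * D => b n q.1 q.2) by have [] := hb n.
  have bp n : forall w, exists2 c : nat -> X -> F, forall i, homogeneous_poly i (c i)
    & forall y, b n y w = \sum_(i < n.+1) c i y by have [] := hb n.
  have bh n : forall (t : R) y w, b n (rinc t *: y) (rinc t *: w) = rinc t ^+ n *: b n y w.
    by have [] := hb n.
  exact: (expansion_continuous Y0 W0 bc bp bh bs (Vnull x Vx)).
move=> x Vx; have [Y [W [b [Y0 W0 hb bs]]]] := Vexp x Vx.
have bc n : continuous (fun q : X * D => b n q.1 q.2) by have [] := hb n.
have bp n : forall w, exists2 c : nat -> X -> F, forall i, homogeneous_poly i (c i)
  & forall y, b n y w = \sum_(i < n.+1) c i y by have [] := hb n.
have bh n : forall (t : R) y w, b n (rinc t *: y) (rinc t *: w) = rinc t ^+ n *: b n y w.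
  by have [] := hb n.
have [Y' Y'0 Y'P] := taylor_cvg Y0 W0 bc bp bh bs Vnull.
exists Y'; split => //; first by move=> y /Y'P[].
exists (taylor Y0 W0 bc bh bs).
  by move=> n; split; [exact: taylor_homogeneous|exact: taylor_continuous].
by move=> y /Y'P[].
Qed.

End AnalyticFunctionSpace.

(** * Derivatives of analytic maps *)

Section AnalyticDerivative.
Context (R : realType).
Local Notation C := (scal R Complexes).
Context (E F : tvsType C) (hF : hausdorff_space F).

(** The tail after the linear term is at most 2 M |t|^2. *)
Lemma power_series_dirderiv (g : E -> F) (x h : E) (c : nat -> F) :
  (forall z, sabs z <= 1 -> power_series c z (g (x + z *: h))) -> is_dirderiv g h x (c 1%N).
Proof.
move=> hc; apply/is_dirderivP => p hp e e0.
have s1 : sabs (1 : C) <= 1 by rewrite sabs1.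
have s0 : sabs (0 : C) <= 1 by rewrite sabs0.
have [M M0 cM] := power_series_bounded hp (hc 1 s1).
have c0 : g x = c 0%N by have := power_series_at0 hF (hc 0 s0); rewrite scale0r addr0.
exists (Num.min (1 / 2) (e / (2 * M + 1))); first by rewrite lt_min !divr_gt0//; lra.
move=> t; rewrite lt_min => /andP[t1 t2].
have t0 := sabs_ge0 t.
have t1' : sabs t <= 1 by lra.
have := power_series_tail hp 2 (hc t t1') (ltW t1) cM.
rewrite 2!big_ord_recl big_ord0 /= addr0 expr0 scale1r expr1 c0 opprD addrA => /le_trans; apply.
have M10 : 0 < 2 * M + 1 by lra.
rewrite ltr_pdivlMr// in t2.
have := ler_wpM2r t0 (ltW t2); have := mulr_ge0 t0 t0.
by rewrite expr2; lra.
Qed.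

Section Local.
Context (g : E -> F) (U : set E) (oU : open U) (x : E) (Y : set E) (b : nat -> E -> F).
Hypothesis YU : forall y, Y y -> U (x + y).
Hypothesis bhom : forall n, homogeneous_poly n (b n).
Hypothesis bcont : forall n, continuous (b n).
Hypothesis bs : forall y, Y y -> (fun N => \sum_(n < N) b n y) @ \oo --> g (x + y).

Lemma local_power_series h z : Y (z *: h) -> power_series (fun n => b n h) z (g (x + z *: h)).
Proof.
move=> /bs; rewrite /power_series.
have -> : (fun N => \sum_(n < N) b n (z *: h)) = (fun N => \sum_(n < N) z ^+ n *: b n h).
  by apply/funext => N; apply: eq_bigr => n _; rewrite (homogeneous_poly_scale _ _ (bhom n)).
by [].
Qed.

Context (c : nat -> nat -> E -> E -> F).
Hypothesis chom : forall n i w, homogeneous_poly i (c n i ^~ w).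
Hypothesis cexp : forall n y w, b n (y + w) = \sum_(i < n.+1) c n i y w.
Hypothesis cscale : forall n i (z t : C) y w, (i <= n)%N ->
  c n i (z *: y) (t *: w) = (z ^+ i * t ^+ (n - i)) *: c n i y w.

(* the coefficient of z in b (n + 1) (h + z y) *)
Definition partial y n h := c n.+1 n h y.

Lemma partial_expand y n h z :
  b n.+1 (h + z *: y) = \sum_(j < n.+2) z ^+ j *: c n.+1 (n.+1 - j)%N h y.
Proof.
rewrite cexp (reindex_inj rev_ord_inj) /=; apply: eq_bigr => j _; rewrite subSS.
have jn : (n.+1 - j <= n.+1)%N by rewrite leq_subr.
have := cscale 1 z h y jn; rewrite scale1r expr1n mul1r => ->.
by rewrite subKn// -ltnS ltn_ord.
Qed.

Lemma partialZ y n h (a : C) : partial (a *: y) n h = a *: partial y n h.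
Proof.
have := cscale (n := n.+1) (i := n) 1 a h y (leqnSn n).
by rewrite /partial scale1r expr1n mul1r subSnn expr1.
Qed.

Lemma partial_homogeneous y n : homogeneous_poly n (partial y n).
Proof. exact: chom. Qed.

(** The form behind [b n.+1] need not be continuous, so this coefficient is recovered from the
    continuous [b n.+1] by averaging over roots of unity. Their order n + 2 exceeds the degree n + 1
    in z, so nothing is aliased. *)
Lemma partial_continuous y n : continuous (partial y n).
Proof.
have [w wP] := prim_root_exists R (isT : (0 < n.+2)%N).
have e h : partial y n h = (n.+2%:R)^-1 *: \sum_(j < n.+2) (w ^+ 1)^-1 ^+ j *: b n.+1 (h + w ^+ j *: y).
  have := @unity_average _ F (fun j => c n.+1 (n.+1 - j)%N h y) 1 w n.+2 1 n.+2 wP.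
  under eq_bigr => j _ do [under eq_bigr => l _ do rewrite mul1r; rewrite -partial_expand].
  move=> ->; rewrite scalerA mulVf ?scale1r ?pnatr_eq0//.
  rewrite (bigD1 (Ordinal (isT : (1 < n.+2)%N)))//= expr1n scale1r subn1 /= big1 ?addr0// => l /andP[l1 l2].
  by case/eqP: l2; apply: val_inj => /=; move/eqP: l1; rewrite !modn_small.
move=> h; rewrite (_ : partial y n = fun h =>
  (n.+2%:R)^-1 *: \sum_(j < n.+2) (w ^+ 1)^-1 ^+ j *: b n.+1 (h + w ^+ j *: y)); last exact/funext.
apply: (@cvg_scaleT _ F _ (nbhs h) (fun=> n.+2%:R^-1)
  (fun h => \sum_(j < n.+2) (w ^+ 1)^-1 ^+ j *: b n.+1 (h + w ^+ j *: y))); first exact: cvg_cst.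
apply: cvg_sumT => j _; apply: cvg_scaleT; first exact: cvg_cst.
apply: (@cvg_comp _ _ _ (fun h => h + w ^+ j *: y) (b n.+1) (nbhs h) (nbhs (h + w ^+ j *: y))); last exact: bcont.
by apply: cvg_addT; [exact: cvg_id|exact: cvg_cst].
Qed.

Section Bound.
Variables (p : F -> R) (hp : cont_seminorm p) (M : R) (h y : E).
Hypothesis Yab : forall a b : C, sabs a <= 4 -> sabs b <= 4 -> Y (a *: h + b *: y).
Hypothesis gM : forall a b : C, sabs a <= 4 -> sabs b <= 4 -> p (g (x + (a *: h + b *: y))) <= M.

Let s4 : sabs (4 : C) = 4.
Proof. by rewrite -rinc_nat sabs_rinc ger0_norm. Qed.
Let s2 : sabs (2 : C) = 2.
Proof. by rewrite -rinc_nat sabs_rinc ger0_norm. Qed.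

(** The Cauchy estimate in the direction 4 (h + z y): half of 4^n is lost to it, and half remains as
    decay. *)
Lemma term_bound n z : sabs z <= 1 -> p (b n (h + z *: y)) <= M / 2 ^+ n.
Proof.
move=> z1.
have dir w : sabs w <= 1 -> exists a b : C, [/\ sabs a <= 4, sabs b <= 4 &
    w *: (4 *: (h + z *: y)) = a *: h + b *: y].
  move=> w1; exists (w * 4), (w * 4 * z); split; last by lmod_eq (scal R Complexes); ring.
  - by rewrite sabsM s4; lra.
  - by rewrite !sabsM s4; have := sabs_ge0 w; have := sabs_ge0 z; nra.
have := @cauchy_estimate _ F p hp (fun n => b n (4 *: (h + z *: y)))
  (fun w => g (x + w *: (4 *: (h + z *: y)))) M _ _ n.
rewrite (homogeneous_poly_scale _ _ (bhom n)) (csn_scale hp) sabsX s4 => est.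
have {est} : 4 ^+ n * p (b n (h + z *: y)) <= M * 2 ^+ n.
  apply: est => w /dir[a [b' [a4 b4 e]]].
    by apply: local_power_series; rewrite e; exact: Yab.
  by rewrite e; exact: gM.
have -> : (4 : R) ^+ n = 2 ^+ n * 2 ^+ n by rewrite -exprMn; congr (_ ^+ _); lra.
have n0 : (0 : R) < 2 ^+ n by rewrite exprn_gt0.
move: n0; set a := 2 ^+ n => a0 hb; rewrite ler_pdivlMr// -(ler_pM2l a0); lra.
Qed.

Lemma partial_coef_bound n j : (j <= n.+1)%N ->
  p (c n.+1 (n.+1 - j)%N h y) <= M / 2 ^+ n.+1 * 2 ^+ j.
Proof.
move=> jn.
pose d j := if (j < n.+2)%N then c n.+1 (n.+1 - j)%N h y else 0.
have := @cauchy_estimate _ F p hp d (fun z => b n.+1 (h + z *: y)) (M / 2 ^+ n.+1) _ (term_bound n.+1) j.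
rewrite {2}/d ltnS jn; apply => z _; rewrite partial_expand.
have -> : \sum_(j < n.+2) z ^+ j *: c n.+1 (n.+1 - j)%N h y = \sum_(j < n.+2) z ^+ j *: d j.
  by apply: eq_bigr => i _; rewrite /d ltn_ord.
by apply: finite_power_series => i; rewrite leqNgt /d => /negbTE ->.
Qed.

Lemma partial_bound n : p (partial y n h) <= M.
Proof.
have M0 : 0 <= M by apply: le_trans (gM (a := 0) (b := 0) _ _); rewrite ?csn_ge0// sabs0.
have := @partial_coef_bound n 1 isT; rewrite subn1 /= expr1 => /le_trans; apply.
rewrite exprS invfM mulrA mulrAC divfK ?pnatr_eq0//.
by rewrite ler_pdivrMr ?exprn_gt0// ler_peMr// exprn_ege1// ler1n.
Qed.

(** The factor 2^(-n-1) makes the second-order errors summable over n, which permits differentiation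
    term by term. The 8 is 2 * 2^2, from the tail after degree 1 at the argument 2 t. *)
Lemma partial_difference n t : sabs t <= 1 / 4 ->
  p (b n.+1 (h + t *: y) - b n.+1 h - t *: partial y n h) <= M / 2 ^+ n.+1 * (8 * sabs t ^+ 2).
Proof.
move=> t4.
pose d j := if (j < n.+2)%N then c n.+1 (n.+1 - j)%N h y else 0.
have ds : power_series (fun j => 2^-1 ^+ j *: d j) (2 * t) (b n.+1 (h + t *: y)).
  have -> : b n.+1 (h + t *: y) = \sum_(j < n.+2) (2 * t) ^+ j *: (2^-1 ^+ j *: d j).
    rewrite partial_expand; apply: eq_bigr => j _; rewrite /d ltn_ord scalerA -exprMn.
    by rewrite mulrAC divff ?mul1r// pnatr_eq0.
  by apply: finite_power_series => i; rewrite leqNgt /d => /negbTE ->; rewrite scaler0.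
have st : sabs (2 * t) <= 1 / 2 by rewrite sabsM s2; lra.
have M0 : 0 <= M by apply: le_trans (gM (a := 0) (b := 0) _ _); rewrite ?csn_ge0// sabs0.
have dM j : p (2^-1 ^+ j *: d j) <= M / 2 ^+ n.+1.
  rewrite /d; case: ltnP => jn; last by rewrite scaler0 (csn0 hp) divr_ge0// exprn_ge0.
  rewrite (csn_scale hp) sabsX sabsV s2 exprVn ler_pdivrMl ?exprn_gt0// mulrC.
  exact: partial_coef_bound.
have := power_series_tail hp 2 ds st dM; rewrite sabsM s2.
have -> : \sum_(i < 2) (2 * t) ^+ i *: (2^-1 ^+ i *: d i) = b n.+1 h + t *: partial y n h.
  rewrite 2!big_ord_recl big_ord0 /= addr0 !expr0 !scale1r !expr1 scalerA mulrAC divff ?mul1r ?pnatr_eq0//.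
  rewrite /d /= subn0 subn1 /= -[b n.+1 h]/(b n.+1 h); congr (_ + _).
  have := partial_expand y n h 0; rewrite scale0r addr0 => ->.
  rewrite big_ord_recl /= expr0 scale1r subn0 big1 ?addr0// => i _.
  by rewrite expr0n scale0r.
by rewrite opprD addrA => /le_trans; apply; rewrite exprMn; lra.
Qed.

End Bound.

(** Compactness of 4 Q in both variables: 4 Q contains the disc of radius 4 and lies in the disc of
    radius 8. *)
Lemma square_bound (p : F -> R) (h y : E) : cont_seminorm p -> {in U, continuous g} ->
  (forall a b : C, sabs a <= 8 -> sabs b <= 8 -> Y (a *: h + b *: y)) ->
  exists M, forall a b : C, sabs a <= 4 -> sabs b <= 4 -> p (g (x + (a *: h + b *: y))) <= M.
Proof.
move=> hp gc Yab.
have [Q [cQ Q1 Q2]] := square_compact R.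
have s4 : sabs (4 : C) = 4 by rewrite -rinc_nat sabs_rinc ger0_norm.
pose G (q : C * C) := g (x + ((4 * q.1) *: h + (4 * q.2) *: y)).
have /compact_near_coveringP cov := compact_setX cQ cQ.
have : \forall M \near +oo, forall q, (Q `*` Q) q -> p (G q) <= M.
  apply: (cov R +oo (fun M q => p (G q) <= M)) => q [Qq1 Qq2].
  have Gc : G @ q --> G q.
    apply: (@cvg_comp _ _ _ (fun q : C * C => x + ((4 * q.1) *: h + (4 * q.2) *: y)) g
      (nbhs q) (nbhs (x + ((4 * q.1) *: h + (4 * q.2) *: y)))); last first.
      apply: gc; rewrite inE; apply: YU; apply: Yab; rewrite sabsM s4.
        by have := Q2 _ Qq1; lra.
      by have := Q2 _ Qq2; lra.
    apply: cvg_addT; first exact: cvg_cst.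
    have c1 : (fun q : C * C => q.1) @ q --> q.1 by exact: cvg_fst.
    have c2 : (fun q : C * C => q.2) @ q --> q.2 by exact: cvg_snd.
    apply: cvg_addT.
      apply: (@cvg_scaleT _ E _ (nbhs q) (fun q : C * C => 4 * q.1) (fun=> h)); last exact: cvg_cst.
      by apply: cvgM; [exact: cvg_cst|exact: c1].
    apply: (@cvg_scaleT _ E _ (nbhs q) (fun q : C * C => 4 * q.2) (fun=> y)); last exact: cvg_cst.
    by apply: cvgM; [exact: cvg_cst|exact: c2].
  have nG : \forall q' \near q, p (G q' - G q) < 1 by exact (csn_cvg hp Gc ltr01).
  exists ([set q' | p (G q' - G q) < 1], [set M | p (G q) + 1 <= M]).
    split; first exact nG.
    by apply: nbhs_pinfty_ge; rewrite num_real.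
  move=> [q' M] /= [h1 h2]; apply: le_trans h2.
  rewrite (le_trans (csn_le hp _ (G q)))//; lra.
move=> [M0 [_ MP]]; exists (M0 + 1) => a b' a4 b4.
have Qd (z : C) : sabs z <= 4 -> Q (z / 4).
  by move=> z4; apply: Q1; rewrite sabsM sabsV s4; lra.
have := MP (M0 + 1) _ (a / 4, b' / 4); rewrite ltrDl ltr01 => /(_ isT (conj (Qd a a4) (Qd b' b4))).
by rewrite /G /= ![4 * _]mulrC !divfK// pnatr_eq0.
Qed.

(** The derivative is known to exist, and only its value is identified: a single small step t is
    fixed, and N is chosen afterwards, so that the series of differences is close to its sum. *)
Lemma partial_cvg_small h y : {in U, continuous g} ->
  (forall a b : C, sabs a <= 8 -> sabs b <= 8 -> Y (a *: h + b *: y)) ->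
  dirderivable g y (x + h) ->
  (fun N => \sum_(n < N) partial y n h) @ \oo --> dirderiv g y (x + h).
Proof.
move=> gc Yab8 gy; apply/csn_cvgP => p hp e e0.
have Yab (a a' : C) : sabs a <= 4 -> sabs a' <= 4 -> Y (a *: h + a' *: y).
  by move=> a4 b4; apply: Yab8; lra.
have [M gM] := square_bound hp gc Yab8.
have M0 : 0 <= M by apply: le_trans (gM 0 0 _ _); rewrite ?csn_ge0// sabs0.
have e30 : 0 < e / 3 by lra.
have /is_dirderivP/(_ p hp _ e30)[d d0 dP] := dirderivP gy.
(* The three bounds serve [partial_difference], the difference quotient of g, and the summed
   second-order error 8 M r^2 <= r e / 3. *)
pose r := Num.min (1 / 4) (Num.min (d / 2) (e / 3 / (8 * M + 1))).
have r0 : 0 < r by rewrite !lt_min !divr_gt0//; lra.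
have r4 : r <= 1 / 4 by rewrite ge_min lexx.
have rd : r < d by apply: le_lt_trans (_ : d / 2 < d); rewrite ?ge_min ?lexx ?orbT//; lra.
have rM : r * (8 * M + 1) <= e / 3 by rewrite -ler_pdivlMr ?ge_min ?lexx ?orbT//; lra.
pose t : C := rinc r; have st : sabs t = r by rewrite sabs_rinc gtr0_norm.
have t0 : t != 0 by rewrite rinc_eq0 gt_eqF.
have Y1 : Y h.
  by have := Yab 1 0; rewrite sabs1 sabs0 scale1r scale0r addr0; apply; lra.
have Y2 : Y (h + t *: y).
  by have := Yab 1 t; rewrite sabs1 st scale1r; apply; lra.
pose u N := \sum_(n < N) (b n (h + t *: y) - b n h).
have uc : u @ \oo --> g (x + (h + t *: y)) - g (x + h).
  have e1 : u = (fun N => \sum_(n < N) b n (h + t *: y) - \sum_(n < N) b n h).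
    by apply/funext => N; rewrite /u sumrB.
  by rewrite e1; apply: cvg_subT; [exact: bs Y2|exact: bs Y1].
have re0 : 0 < r * (e / 3) by exact: mulr_gt0.
have [N0 _ NP] : \forall N \near \oo, p (u N - (g (x + (h + t *: y)) - g (x + h))) < r * (e / 3).
  exact (csn_cvg hp uc re0).
exists N0 => // N /= N0N.
have uN : u N.+1 = \sum_(n < N) (b n.+1 (h + t *: y) - b n.+1 h).
  rewrite /u big_ord_recl /= (homogeneous_poly_cst (bhom 0) erefl (h + t *: y)).
  by rewrite (homogeneous_poly_cst (bhom 0) erefl h) subrr add0r.
have h1 := NP N.+1 (leq_trans N0N (leqnSn N)).
have h2 : p (u N.+1 - t *: \sum_(n < N) partial y n h) <= M * (8 * r ^+ 2).
  rewrite uN scaler_sumr -sumrB (le_trans (csn_sum hp _ _ _))//.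
  apply: le_trans (_ : \sum_(n < N) M / 2 ^+ n.+1 * (8 * r ^+ 2) <= _).
    apply: ler_sum => n _; rewrite -st; apply: (partial_difference hp Yab gM).
    by rewrite st.
  rewrite -mulr_suml -mulr_sumr -mulrA ler_wpM2l//; apply: ler_piMl.
    by rewrite mulr_ge0// exprn_ge0// ltW.
  have := @geometric_tail R (1 / 2) 1 N.+1 _; rewrite big_ord_recl /= add0r expr1.
  have -> : (2 : R) * (1 / 2) = 1 by lra.
  move=> gt; apply: le_trans (gt _); last by lra.
  by apply: ler_sum => n _; rewrite /bump /= add1n div1r exprVn.
have h3 := dP t; rewrite st in h3; have {}h3 := h3 rd.
have key : p (t *: (\sum_(n < N) partial y n h - dirderiv g y (x + h))) <
    r * (e / 3) + M * (8 * r ^+ 2) + e / 3 * r.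
  have -> : t *: (\sum_(n < N) partial y n h - dirderiv g y (x + h)) =
     (u N.+1 - (g (x + (h + t *: y)) - g (x + h))) - (u N.+1 - t *: \sum_(n < N) partial y n h)
     + (g (x + h + t *: y) - g (x + h) - t *: dirderiv g y (x + h)).
    by rewrite -(addrA x); lmod_eq (scal R Complexes); ring.
  have := csn_add hp (u N.+1 - (g (x + (h + t *: y)) - g (x + h)) - (u N.+1 - t *: \sum_(n < N) partial y n h))
    (g (x + h + t *: y) - g (x + h) - t *: dirderiv g y (x + h)).
  have := csn_sub hp (u N.+1 - (g (x + (h + t *: y)) - g (x + h))) (u N.+1 - t *: \sum_(n < N) partial y n h).
  lra.
rewrite (csn_scale hp) st in key.
have : r * p (\sum_(n < N) partial y n h - dirderiv g y (x + h)) < r * e.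
  by apply: lt_le_trans key _; rewrite expr2; nra.
by rewrite ltr_pM2l.
Qed.

End Local.
End AnalyticDerivative.

Lemma eq_complex_analytic (R : realType) (E F : tvsType R[i]) (U : set E) (f g : E -> F) :
  {in U, f =1 g} -> complex_analytic U f -> complex_analytic U g.
Proof.
move=> fg [fc fa]; split.
  by move: fc; apply: subspace_eq_continuous => x /fg.
move=> x Ux; have [Y [Y0 YU [b bP bs]]] := fa x Ux; exists Y; split=> //.
by exists b => // y Yy; rewrite -fg ?inE; [exact: bs|exact: YU].
Qed.

Section ComplexAnalyticDerivative.
Context (R : realType).
Local Notation C := (scal R Complexes).
Context (E F : tvsType C) (hF : hausdorff_space F) (U : set E) (oU : open U).

(** The direction y is prescribed and may be large, so it is shrunk by d; the factor is removed
    later by homogeneity of the derivative in y. *)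
Lemma two_ray_near (A : set E) (y : E) (r : R) : 0 < r -> nbhs 0 A ->
  exists (Y : set E) (d : R), [/\ nbhs 0 Y, 0 < d & forall h, Y h ->
    forall a a' : C, sabs a <= r -> sabs a' <= r -> A (a *: h + a' *: (rinc d *: y))].
Proof.
move=> r0 /csn_exists[q hq qA].
exists [set h | q h < (2 * r)^-1].
have q0 := csn_ge0 hq y.
pose d := (2 * r)^-1 / (q y + 1).
have r20 : 0 < (2 * r)^-1 by rewrite invr_gt0; lra.
have d0 : 0 < d by rewrite divr_gt0//; lra.
have dq : q (rinc d *: y) < (2 * r)^-1.
  rewrite csn_rinc// gtr0_norm// /d -mulrA gtr_pMr// mulrC ltr_pdivrMr; lra.
exists d; split=> //; first exact: csn_nbhs.
move=> h hr a a' ar a'r; apply: qA; have {}hr : q h < (2 * r)^-1 by exact: hr.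
rewrite (le_lt_trans (csn_add hq _ _))// (csn_scale hq a) (csn_scale hq a').
have rr : r * (2 * r)^-1 = 1 / 2 by field; rewrite gt_eqF.
have := csn_ge0 hq h; have := csn_ge0 hq (rinc d *: y).
have := sabs_ge0 a; have := sabs_ge0 a'.
set u := q h in hr *; set v := q _ in dq * => a'0 a0 v0 u0.
have : sabs a * u <= r * u by rewrite ler_wpM2r.
have : sabs a' * v <= r * v by rewrite ler_wpM2r.
have : r * u < r * (2 * r)^-1 by rewrite ltr_pM2l.
have : r * v < r * (2 * r)^-1 by rewrite ltr_pM2l.
rewrite rr; lra.
Qed.

Lemma dirderivZ (g : E -> F) (a : C) y x : dirderivable g y x ->
  dirderiv g (a *: y) x = a *: dirderiv g y x.
Proof. by move=> /dirderivP gy; apply: dirderivE => //; exact: is_dirderivZ. Qed.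

Lemma complex_analytic_expansion (g : E -> F) : @complex_analytic R E F U g ->
  forall x, U x -> exists Y : set E, [/\ nbhs (0 : E) Y, forall y, Y y -> U (x + y)
      & exists2 b : nat -> E -> F,
          forall n, @homogeneous_poly C E F n (b n) /\ continuous (b n)
        & forall y, Y y -> (fun N => \sum_(n < N) b n y) @ \oo --> g (x + y)].
Proof. by move=> [_]. Qed.

Lemma complex_analytic_dirderivable (g : E -> F) y x : @complex_analytic R E F U g -> U x ->
  dirderivable g y x.
Proof.
move=> /complex_analytic_expansion ga Ux; have [Y [Y0 YU [b bP bs]]] := ga x Ux.
have [Y' [d [Y'0 d0 Y'P]]] := two_ray_near y ltr01 Y0.
have ps (z : C) : sabs z <= 1 -> @power_series R Complexes F (fun n => b n (rinc d *: y)) z (g (x + z *: (rinc d *: y))).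
  move=> z1; apply: (local_power_series (fun n => (bP n).1) bs).
  have := Y'P 0 (nbhs_singleton Y'0) 0 z; rewrite sabs0 scaler0 add0r; apply => //.
have := is_dirderivZ (c := rinc d^-1) (power_series_dirderiv hF ps).
by rewrite scalerA -rincM mulVf ?gt_eqF// rinc1 scale1r; eexists; eassumption.
Qed.

Lemma complex_analytic_dirderiv (g : E -> F) y :
  @complex_analytic R E F U g -> @complex_analytic R E F U (dirderiv g y).
Proof.
move=> ca; have gd y' x : U x -> dirderivable g y' x by exact: complex_analytic_dirderivable.
have [gc _] := ca; have ga := complex_analytic_expansion ca; rewrite continuous_open_subspace// in gc.
(* The term-by-term derivative is given for all directions at once, because estimates are made for
   [rinc d *: y] and carried over to y by linearity. *)
have exp x : U x -> exists Y (b : nat -> E -> F), [/\ nbhs 0 Y, forall h, Y h -> U (x + h),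
    forall n, homogeneous_poly n (b n) /\ continuous (b n)
  & exists2 pd : E -> nat -> E -> F,
      [/\ forall y n (a : C) h, pd (a *: y) n h = a *: pd y n h,
          forall y n, homogeneous_poly n (pd y n) & forall y n, continuous (pd y n)]
    & [/\ forall y h, Y h -> (fun N => \sum_(n < N) pd y n h) @ \oo --> dirderiv g y (x + h)
        & exists2 Y', nbhs 0 Y' & forall p, cont_seminorm p -> forall M h y,
            (forall a a' : C, sabs a <= 4 -> sabs a' <= 4 -> Y' (a *: h + a' *: y)) ->
            (forall a a' : C, sabs a <= 4 -> sabs a' <= 4 -> p (g (x + (a *: h + a' *: y))) <= M) ->
            forall n, p (pd y n h) <= M]].
  move=> Ux; have [Y [Y0 YU [b bP bs]]] := ga x Ux.
  have bh n : homogeneous_poly n (b n) := (bP n).1.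
  have bc n : continuous (b n) := (bP n).2.
  have [c cP] := choice (fun n => homogeneous_poly_expand (bh n)).
  have ch n i w : homogeneous_poly i (c n i ^~ w) by have [] := cP n.
  have ce n y' w : b n (y' + w) = \sum_(i < n.+1) c n i y' w by have [] := cP n.
  have cs n i (z t : C) y' w : (i <= n)%N ->
    c n i (z *: y') (t *: w) = (z ^+ i * t ^+ (n - i)) *: c n i y' w by have [_ _] := cP n; apply.
  have [q hq qY] := csn_exists Y0.
  (* Coefficients up to 8 occur on two vectors, and 8/16 + 8/16 = 1. *)
  pose Y2 : set E := [set h | q h < 1 / 16].
  exists Y2, b; split.
  - by apply: csn_nbhs => //; lra.
  - move=> h qh; apply/YU/qY; have : q h < 1 / 16 by exact: qh.
    by lra.
  - exact: bP.
  exists (partial c); split.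
  - by move=> y' n a h; exact: partialZ.
  - by move=> y' n; exact: partial_homogeneous.
  - by move=> y' n; exact: (partial_continuous bc ce cs).
  - move=> y' h Yh; have qh : q h < 1 / 16 by exact: Yh.
    have q0 := csn_ge0 hq y'.
    pose d := 1 / 16 / (q y' + 1).
    have d0 : 0 < d by rewrite !divr_gt0//; lra.
    have dq : q (rinc d *: y') < 1 / 16.
      by rewrite csn_rinc// gtr0_norm// /d mulrAC ltr_pdivrMr; lra.
    have Yab (a a' : C) : sabs a <= 8 -> sabs a' <= 8 -> Y (a *: h + a' *: (rinc d *: y')).
      move=> a8 a'8; apply: qY; rewrite (le_lt_trans (csn_add hq _ _))// (csn_scale hq a) (csn_scale hq a').
      have := csn_ge0 hq h; have := csn_ge0 hq (rinc d *: y').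
      have := sabs_ge0 a; have := sabs_ge0 a'; move: qh dq.
      set u := q h; set v := q _ => uq vq a'0 a0 v0 u0.
      have : sabs a * u <= 8 * u by rewrite ler_wpM2r.
      have : sabs a' * v <= 8 * v by rewrite ler_wpM2r.
      lra.
    have Uxh : U (x + h) by apply/YU/qY; lra.
    have := partial_cvg_small YU bh bs ce cs gc Yab (gd (rinc d *: y') _ Uxh).
    rewrite (dirderivZ _ (gd _ _ Uxh)) => hs.
    have c1 : (fun N => (rinc d)^-1 *: (\sum_(n < N) partial c (rinc d *: y') n h)) @ \oo -->
        (rinc d)^-1 *: (rinc d *: dirderiv g y' (x + h)).
      by apply: cvg_scaleT; [exact: cvg_cst|exact: hs].
    have rd0 : (rinc d : C) != 0 by rewrite rinc_eq0 gt_eqF.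
    rewrite scalerA mulVf// scale1r in c1.
    have -> : (fun N => \sum_(n < N) partial c y' n h) =
        (fun N => (rinc d)^-1 *: (\sum_(n < N) partial c (rinc d *: y') n h)).
      apply/funext => N; rewrite scaler_sumr; apply: eq_bigr => n _.
      by rewrite (partialZ cs) scalerA mulVf// scale1r.
    exact: c1.
  exists Y => // p hp M h y' Yab gM n; exact: (partial_bound bh bs ce cs hp Yab gM).
(* Pointwise convergence of the series gives no continuity of its sum; this needs the uniform bound
   on the coefficients in [exp]. *)
suff dc x : U x -> dirderiv g y @ x --> dirderiv g y x.
  split; first by rewrite continuous_open_subspace// => x; rewrite inE; exact: dc.
  move=> x Ux; have [Y [b [Y0 YU bP [pd [pdZ pdh pdc] [pds _]]]]] := exp x Ux.
  by exists Y; split=> //; exists (pd y) => [n|h Yh]; [split; [exact: pdh|exact: pdc]|exact: pds].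
move=> Ux; have [Y [b [Y0 YU bP [pd [pdZ pdh pdc] [pds [Y' Y'0 pdb]]]]]] := exp x Ux.
apply/csn_cvgP => p hp e e0.
pose M := p (g x) + 1.
have M0 : 0 < M by have := csn_ge0 hp (g x); rewrite /M; lra.
have gx : g @ x --> g x by apply: gc; rewrite inE.
have gM : nbhs 0 [set u | p (g (x + u)) <= M].
  have : \forall x' \near x, p (g x' - g x) < 1 by exact (csn_cvg hp gx ltr01).
  move=> /nbhs_add; apply: filterS => u /=.
  have := csn_le hp (g (x + u)) (g x); rewrite /M; lra.
have r4 : (0 : R) < 4 by lra.
have [Y3 [d [Y30 d0 Y3P]]] := two_ray_near y r4 (filterI gM Y'0).
have [q hq qY] := csn_exists (filterI Y0 Y30).
(* With x' = x + s h and h of size below 1, the tail after the constant term is at most 2 M s, which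
   is below d e; the factor d comes from the shrunk direction. *)
pose s := Num.min (1 / 2) (d * e / (4 * M)).
have s0 : 0 < s by rewrite !lt_min !divr_gt0//= ?mulr_gt0//; lra.
have s1 : s <= 1 / 2 by rewrite ge_min lexx.
have s2 : s * (4 * M) <= d * e by rewrite -ler_pdivlMr ?mulr_gt0// ge_min lexx orbT.
have small : \forall x' \near x, q (x' - x) < s.
  by apply: (csn_cvg hq _ s0); exact: cvg_id.
apply: filterS small => x' qx.
pose h := rinc s^-1 *: (x' - x).
have qh : q h < 1.
  by rewrite /h csn_rinc// gtr0_norm ?invr_gt0// ltr_pdivrMl// mulr1.
have [Yh Y3h] := qY _ qh.
have xh : x' = x + rinc s *: h.
  by rewrite /h scalerA -rincM divff ?gt_eqF// rinc1 scale1r [x + _]addrC subrK.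
have qsh : q (rinc s *: h) < 1.
  by rewrite csn_rinc// gtr0_norm//; have := csn_ge0 hq h; nra.
have bound n : p (pd (rinc d *: y) n h) <= M.
  by apply: pdb => // a a' a4 a'4; have [] := Y3P h Y3h a a' a4 a'4.
have ps z : Y (z *: h) -> power_series (fun n => pd (rinc d *: y) n h) z (dirderiv g (rinc d *: y) (x + z *: h)).
  move=> /(pds (rinc d *: y)); rewrite /power_series.
  have -> : (fun N => \sum_(n < N) pd (rinc d *: y) n (z *: h)) =
      (fun N => \sum_(n < N) z ^+ n *: pd (rinc d *: y) n h).
    apply/funext => N; apply: eq_bigr => n _.
    by rewrite (homogeneous_poly_scale _ _ (pdh _ _)).
  by [].
have ss : sabs (rinc s : C) <= 1 / 2 by rewrite sabs_rinc gtr0_norm.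
have := power_series_tail hp 1 (ps (rinc s) (qY _ qsh).1) ss bound.
rewrite big_ord1 expr0 scale1r expr1 sabs_rinc (gtr0_norm s0).
have Y00 : Y ((0 : C) *: h) by rewrite scale0r; exact: nbhs_singleton Y0.
rewrite -(power_series_at0 hF (ps 0 Y00)) scale0r addr0 -xh.
have Ux' : U x' by rewrite xh; apply: YU; exact: (qY _ qsh).1.
rewrite !dirderivZ; [|exact: gd|exact: gd].
rewrite -scalerBr csn_rinc// (gtr0_norm d0) => hd.
rewrite -(ltr_pM2l d0); apply: le_lt_trans hd _.
apply: lt_le_trans s2; rewrite mulrCA; have := mulr_gt0 s0 M0; lra.
Qed.

End ComplexAnalyticDerivative.

Lemma prod_hausdorff (S T : topologicalType) :
  hausdorff_space S -> hausdorff_space T -> hausdorff_space (S * T)%type.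
Proof.
move=> hS hT [x1 x2] [y1 y2] xy; congr pair.
  apply: hS => A B xA yB.
  have nA : nbhs (x1, x2) (A `*` setT) by exists (A, setT) => //=; split=> //; exact: filterT.
  have nB : nbhs (y1, y2) (B `*` setT) by exists (B, setT) => //=; split=> //; exact: filterT.
  by have [[z1 z2] [[/= ? _] [/= ? _]]] := xy _ _ nA nB; exists z1.
apply: hT => A B xA yB.
have nA : nbhs (x1, x2) (setT `*` A) by exists (setT, A) => //=; split=> //; exact: filterT.
have nB : nbhs (y1, y2) (setT `*` B) by exists (setT, B) => //=; split=> //; exact: filterT.
by have [[z1 z2] [[_ /= ?] [_ /= ?]]] := xy _ _ nA nB; exists z2.
Qed.

Lemma complexification_hausdorff (R : realType) (F : tvsType R) :
  hausdorff_space F -> hausdorff_space (complexification F).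
Proof. by move=> hF; exact: (prod_hausdorff hF hF). Qed.

Lemma complexification_scale_real (R : realType) (F : tvsType R) (t : R) (z : complexification F) :
  (t%:C)%C *: z = (t *: z.1, t *: z.2).
Proof. by rewrite complexification_scaleE /= !scale0r subr0 addr0. Qed.

(** * Derivatives of real analytic maps *)

Section RealAnalyticDerivative.
Context (R : realType).
Local Notation C := (scal R Complexes).
Context (E F : tvsType (scal R Reals)) (hF : hausdorff_space F) (U : set E) (oU : open U).

Lemma rinc_cvg_dnbhs : (rinc : scal R Reals -> C) @ 0^' --> (0 : C)^'.
Proof.
move=> A hA; have : nbhs (0 : C) [set c | c != 0 -> A c] by exact: hA.
move=> /near0_sabs[e e0 eA].
have := @sabs_near0 R Reals e e0; rewrite /nbhs/=; apply: filterS => t te t0.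
by apply: eA; [rewrite sabs_rinc|rewrite rinc_eq0].
Qed.

(** For real t the difference quotients at a real point have imaginary part 0, and the complex limit
    restricts to the filter of real t. *)
Lemma complex_dirderiv_real (V : set (complexification E)) (g : complexification E -> complexification F)
    (f : E -> F) y x (l : complexification F) : U x ->
  (forall x, U x -> g (x, 0) = (f x, 0)) ->
  @is_dirderiv C (complexification E) (complexification F) g (y, 0) (x, 0) l ->
  is_dirderiv f y x l.1 /\ l.2 = 0.
Proof.
move=> Ux gf gl.
pose q (t : scal R Reals) : complexification F :=
  (rinc t : C)^-1 *: (g ((x, 0) + (rinc t : C) *: ((y, 0) : complexification E)) - g (x, 0)).
have ql : q @ 0^' --> l.
  by move=> A /gl hA; exact (rinc_cvg_dnbhs hA).
have [d d0 dU] := @segment_near R Reals E x y 0 U (nbhsU oU Ux).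
have qE : \forall t \near (0 : scal R Reals)^', q t = (t^-1 *: (f (x + t *: y) - f x), 0).
  have := @sabs_near0 R Reals d d0; rewrite /dnbhs /within /=; apply: filterS => t td t0.
  have Ut : U (x + t *: y).
    by have := dU t 0 td; rewrite scaler0 addr0; apply; rewrite sabs0.
  rewrite /q; have -> : (x, 0) + (rinc t : C) *: ((y, 0) : complexification E) = (x + t *: y, 0).
    rewrite [_ *: _](complexification_scale_real t (y, 0)) /= scaler0.
    by apply: injective_projections; rewrite //= addr0.
  rewrite !gf// -rincV [LHS](complexification_scale_real t^-1 _) /=.
  by apply: injective_projections => //=; rewrite subrr scaler0.
have l1 : (fun t => (q t).1) @ 0^' --> l.1.
  apply: (@cvg_comp _ _ _ q fst _ (nbhs l)); [exact ql|exact: cvg_fst].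
have l2 : (fun t => (q t).2) @ 0^' --> l.2.
  apply: (@cvg_comp _ _ _ q snd _ (nbhs l)); [exact ql|exact: cvg_snd].
have pf : ProperFilter ((0 : scal R Reals)^') by exact: Proper_dnbhs_numFieldType.
split.
  by apply: cvg_near_eq l1; apply: filterS qE => t ->.
apply: (@tvs_cvg_unique _ F _ _ _ _ _ hF pf l2).
apply: (@cvg_near_eq _ _ _ (fun=> 0)); last exact: cvg_cst.
by apply: filterS qE => t ->.
Qed.

Lemma real_analytic_dirderiv (f : E -> F) y : @real_analytic R E F U f ->
  (forall x, U x -> dirderivable f y x) /\ @real_analytic R E F U (dirderiv f y).
Proof.
move=> [V [g [oV UV ga gf]]].
have hFc : hausdorff_space (complexification F) by exact: complexification_hausdorff.
have gd x : U x -> @dirderivable C (complexification E) (complexification F) g (y, 0) (x, 0).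
  by move=> Ux; apply: (complex_analytic_dirderivable hFc _ ga); exact: UV.
have gl x : U x -> is_dirderiv f y x (@dirderiv C (complexification E) (complexification F) g (y, 0) (x, 0)).1 /\
    (@dirderiv C (complexification E) (complexification F) g (y, 0) (x, 0)).2 = 0.
  move=> Ux; refine (@complex_dirderiv_real setT g f y x _ Ux gf _).
  exact: (@dirderivP R Complexes (complexification E) (complexification F) g (y, 0) (x, 0) (gd x Ux)).
split; first by move=> x /gl[fl _]; eexists; exact: fl.
exists V, (@dirderiv C (complexification E) (complexification F) g (y, 0)); split=> //.
  exact: (complex_analytic_dirderiv hFc oV _ ga).
move=> x /gl[fl l2]; rewrite (dirderivE hF fl) -l2.
exact: surjective_pairing.
Qed.

End RealAnalyticDerivative.

Section AnalyticDerivativeGeneric.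
Context (R : realType) (K : scalars) (E F : tvsType (scal R K)) (U : set E) (oU : open U).

Lemma eq_analytic (f g : E -> F) : {in U, f =1 g} -> analytic U f -> analytic U g.
Proof.
case: K E F U oU f g => E' F' U' oU' f g fg /=; last exact: eq_complex_analytic.
move=> [V [h [oV UV ha hf]]]; exists V, h; split=> // x Ux.
by rewrite hf// fg ?inE.
Qed.

Lemma analytic_dirderiv (f : E -> F) y : hausdorff_space F -> analytic U f ->
  (forall x, U x -> dirderivable f y x) /\ analytic U (dirderiv f y).
Proof.
case: K E F U oU f y => E' F' U' oU' f y hF /= fa.
  exact: real_analytic_dirderiv.
split; last exact: complex_analytic_dirderiv.
by move=> x Ux; exact: (complex_analytic_dirderivable hF y fa Ux).
Qed.

End AnalyticDerivativeGeneric.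

Lemma scal_incl_rinc (R : realType) (K L : scalars) (s : subfield K L) (a : R) :
  scal_incl s (rinc a) = rinc a.
Proof. by rewrite /rinc; case: s => -[]. Qed.

(** * Currying of analytic maps *)

Section Pullback.
Context (R : realType) (L : scalars) (I : finType).
Local Notation C := (scal R Complexes).
Context (E : I -> tvsType (scal R L)) (F T : tvsType C)
  (m : convergence_mode) (ev : T -> prod_topology E -> F)
  (act : scal R L -> F -> F).
Local Notation D := (prod_topology E).
Context (S : function_space m ev act) (X Z : tvsType C) (iota : X -> D -> Z).
Hypothesis iotaD : forall x y v w, iota (x + y) (v + w) = iota x v + iota y w.
Hypothesis iotaZ : forall (a : C) x, iota (a *: x) 0 = a *: iota x 0.
Hypothesis iota_real : forall (t : R) w, iota 0 (rinc t *: w) = rinc t *: iota 0 w.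
Hypothesis iota_cont : continuous (fun q : X * D => iota q.1 q.2).

Lemma iota_split x w : iota x w = iota x 0 + iota 0 w.
Proof. by rewrite -iotaD addr0 add0r. Qed.

Lemma iota00 : iota 0 0 = 0.
Proof. by have := iotaZ 0 0; rewrite !scale0r. Qed.

Lemma iota_linear : linear (iota^~ 0).
Proof. by move=> a x y; rewrite -iotaZ -iotaD addr0. Qed.

Lemma iota_scale (t : R) y w : iota (rinc t *: y) (rinc t *: w) = rinc t *: iota y w.
Proof. by rewrite iota_split iotaZ iota_real -scalerDr -iota_split. Qed.

Lemma iota_near (A : set Z) : nbhs 0 A ->
  exists (Y : set X) (W : set D), [/\ nbhs 0 Y, nbhs 0 W & forall y w, Y y -> W w -> A (iota y w)].
Proof.
move=> A0; have : nbhs (0 : X, 0 : D) [set q : X * D | A (iota q.1 q.2)].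
  by apply: (@iota_cont (0, 0)); rewrite /= iota00.
by move=> [[Y W] /= [Y0 W0] YW]; exists Y, W; split=> // y w Yy Ww; exact: (YW (y, w)).
Qed.

Lemma homogeneous_poly_pullback n (b : Z -> F) : homogeneous_poly n b -> continuous b ->
  [/\ continuous (fun q : X * D => b (iota q.1 q.2)),
      forall w, exists2 c : nat -> X -> F, forall i, homogeneous_poly i (c i)
        & forall y, b (iota y w) = \sum_(i < n.+1) c i y
      & forall (t : R) y w, b (iota (rinc t *: y) (rinc t *: w)) = rinc t ^+ n *: b (iota y w)].
Proof.
move=> bh bc; split.
- move=> q; apply: (@cvg_comp _ _ _ (fun q : X * D => iota q.1 q.2) b (nbhs q) (nbhs (iota q.1 q.2))).
    exact: iota_cont.
  exact: bc.
- move=> w; have [c [ch ce _]] := homogeneous_poly_expand bh.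
  exists (fun i => c i ^~ (iota 0 w) \o iota^~ 0) => [i|y].
    by apply: homogeneous_poly_comp => //; exact: iota_linear.
  by rewrite iota_split ce.
- by move=> t y w; rewrite iota_scale (homogeneous_poly_scale _ _ bh).
Qed.

Context (U : set Z) (oU : open U) (g : Z -> F) (ga : @complex_analytic R Z F U g).

Lemma analytic_continuous_at z : U z -> g @ z --> g z.
Proof.
by move=> Uz; have [gc _] := ga; move: gc; rewrite continuous_open_subspace// => /(_ z); apply; rewrite inE.
Qed.

(** Common to both fields: [iota] is the pairing of x with w over C, and [complex_pair] over R. The
    identity with g is required for w near 0 only, since the domain of an extension g need not
    contain all w away from real points. *)
Lemma pullback_analytic (V : set X) (f : X -> T) : open V ->
  (forall x, V x -> exists (Y : set X) (W : set D), [/\ nbhs 0 Y, nbhs 0 W & forall y w, Y y -> W w ->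
    [/\ U (iota (x + y) w), V (x + y) & ev (f (x + y)) w = g (iota (x + y) w)]]) ->
  complex_analytic V f.
Proof.
move=> oV fP; apply: (fs_analytic S oV) => x Vx; have [Y [W [Y0 W0 YW]]] := fP x Vx;
  have [Ux _ fx] := YW 0 0 (nbhs_singleton Y0) (nbhs_singleton W0); rewrite addr0 in Ux fx.
- have gx : (fun q : X * D => g (iota q.1 q.2)) @ (x, 0) --> ev (f x) 0.
    rewrite fx; apply: (@cvg_comp _ _ _ (fun q : X * D => iota q.1 q.2) g (nbhs (x, 0)) (nbhs (iota x 0))).
      exact: (@iota_cont (x, 0)).
    exact: analytic_continuous_at.
  rewrite (act_multilinear0 S (fs_mlin S _)) in gx.
  apply: cvg_near_eq gx; have xY : nbhs x [set y | Y (y - x)].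
    by apply/nbhs_add; apply: filterS Y0 => y Yy; rewrite /= addrAC subrr add0r.
  exists ([set y | Y (y - x)], W) => // -[y w] [/= Yy Ww].
  by have [_ _] := YW _ _ Yy Ww; rewrite [x + _]addrC subrK.
- have [Y' [Y'0 YU [b bP bs]]] := complex_analytic_expansion ga Ux.
  have [Y1 [W1 [Y10 W10 YW1]]] := iota_near Y'0.
  exists (Y `&` Y1), (W `&` W1), (fun n y w => b n (iota y w)); split; [exact: filterI|exact: filterI| |].
    by move=> n; have [bh bc] := bP n; exact: homogeneous_poly_pullback.
  move=> y w [Yy Y1y] [Ww W1w]; have [Uy Vy ->] := YW y w Yy Ww; split=> //.
  have -> : iota (x + y) w = iota x 0 + iota y w by rewrite -iotaD add0r.
  by apply: bs; exact: YW1.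
Qed.

End Pullback.

Section ComplexCase.
Context (R : realType) (L : scalars) (s : subfield Complexes L) (k : nat)
  (E : 'I_k -> tvsType (scal R L)) (F : tvsType (scal R L)).
Hypotheses (k0 : (0 < k)%N) (hF : hausdorff_space F).
Local Notation C := (scal R Complexes).

Lemma complex_analytic_into (m : convergence_mode) (X : tvsType C) (U : set X)
    (f : X -> contMultilinear E F) : open U ->
  @analytic R Complexes _ (restrictScal s F) (U `*` setT) (uncurried s f) ->
  @analytic R Complexes X (restrictScal s (multilinSpace m E F)) U (into s m f).
Proof.
move=> oU fa.
refine (@pullback_analytic _ _ _ _ _ _ _ _ _ (multilin_function_space s E k0 hF m) X
  (X * restrictScal s (prod_topology E))%type (fun x w => (x, w)) _ _ _ _ (U `*` setT) _ _ fa U _ oU _).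
- by [].
- by move=> a x; apply: injective_projections; rewrite //= scaler0.
- move=> t w; apply: injective_projections; rewrite /= ?scaler0//.
  by rewrite -[in LHS](scal_incl_rinc s t).
- move=> [x w]; apply: (@cvg_pair _ _ _ (nbhs (x, w)) (nbhs x) (nbhs w)); [exact: cvg_fst|exact: cvg_snd].
- exact: open_setXT.
move=> x Ux; have /nbhs_add U0 := nbhsU oU Ux.
by exists [set y | U (x + y)], setT; split=> //; exact: filterT.
Qed.

End ComplexCase.

Section SeriesOfMultilinearMaps.
Context (R : realType) (K L : scalars) (I : finType)
  (E : I -> tvsType (scal R L)) (F T : tvsType (scal R K))
  (m : convergence_mode) (ev : T -> prod_topology E -> F)
  (act : scal R L -> F -> F).
Local Notation D := (prod_topology E).
Context (S : function_space m ev act).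

Lemma act_multilinear_sum J (r : seq J) (P : pred J) (u : J -> D -> F) :
  (forall j, P j -> act_multilinear act (u j)) ->
  act_multilinear act (fun w => \sum_(j <- r | P j) u j w).
Proof.
move=> mu i v a x y; rewrite (act_sum S) -big_split /=.
by apply: eq_bigr => j /mu; apply.
Qed.

Lemma multilinear_series (b : nat -> D -> F) (W : set D) (h : D -> F) :
  open W -> W 0 -> (forall n, act_multilinear act (b n)) ->
  (forall w, W w -> h @ w --> h w) ->
  (forall w, W w -> (fun N => \sum_(n < N) b n w) @ \oo --> h w) ->
  exists t, forall w, W w -> ev t w = h w.
Proof.
move=> oW W0 mb hc hs.
have W0n : nbhs (0 : D) W := open_nbhs_nbhs (conj oW W0).
have /choice[t tP] w : exists t : R, 0 < t /\ W (rinc t *: w).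
  have [d d0 dW] := @absorbing _ _ (restrictScal (real_subfield L) D) W w W0n.
  exists (d / 2); split; first by lra.
  have d20 : 0 < d / 2 by lra.
  by have := dW (d / 2); rewrite gtr0_norm//; apply; lra.
pose v (c : R) w := (rinc (c ^+ #|I|))^-1 *: h (rinc c *: w).
have vs (c : R) w : 0 < c -> W (rinc c *: w) -> (fun N => \sum_(n < N) b n w) @ \oo --> v c w.
  move=> c0 Wc.
  have -> : (fun N => \sum_(n < N) b n w) =
      (fun N => (rinc (c ^+ #|I|))^-1 *: \sum_(n < N) b n (rinc c *: w)).
    apply/funext => N; rewrite scaler_sumr; apply: eq_bigr => n _.
    rewrite (act_multilinear_homog S _ _ (mb n)) scalerA mulVf ?scale1r//.
    by rewrite rinc_eq0 expf_neq0// gt_eqF.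
  by apply: cvg_scaleT; [exact: cvg_cst|exact: hs].
have uE (c : R) w : 0 < c -> W (rinc c *: w) -> v (t w) w = v c w.
  move=> c0 Wc; have [t0 Wt] := tP w.
  exact: (tvs_cvg_unique (fs_hausdorff S) _ (vs _ _ t0 Wt) (vs _ _ c0 Wc)).
have [|w0|tau tauE] := @fs_surj _ _ _ _ _ _ _ _ _ _ S (fun w => v (t w) w).
- apply: (@act_multilinear_cvg _ _ _ _ _ _ _ _ _ _ S _ \oo _ (fun N w => \sum_(n < N) b n w)).
    by apply: filterE => N; exact: act_multilinear_sum.
  by move=> w; have [t0 Wt] := tP w; exact: vs.
(* The factor t w need not depend continuously on w; near w0 it is replaced by the constant t w0. *)
- have [t0 Wt] := tP w0; set c := t w0 in t0 Wt *.
  have cw : (fun w : D => rinc c *: w) @ w0 --> rinc c *: w0.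
    exact (@cvg_scaleT _ D _ (nbhs w0) (fun=> rinc c) id (rinc c) w0 _ (cvg_cst _) (fun A h => h)).
  have cv : v c @ w0 --> v c w0.
    refine (@cvg_scaleT _ F _ (nbhs w0) (fun=> (rinc (c ^+ #|I|))^-1) _ _ _ _ (cvg_cst _) _).
    apply: (@cvg_comp _ _ _ (fun w : D => rinc c *: w) h (nbhs w0) (nbhs (rinc c *: w0))) => //.
    exact: hc.
  apply: cvg_near_eq cv.
  have : nbhs w0 [set w | W (rinc c *: w)].
    exact: (cw W (open_nbhs_nbhs (conj oW Wt))).
  by apply: filterS => w Wc; rewrite (uE c).
exists tau => w Ww; rewrite tauE (uE 1)// /v rinc1 ?scale1r// expr1n rinc1 invr1 !scale1r.
by [].
Qed.

Lemma fs_agree (t t' : T) (W : set D) : nbhs 0 W -> (forall w, W w -> ev t w = ev t' w) -> t = t'.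
Proof.
move=> W0 tt'; apply: (fs_inj S); apply/funext => w.
have [d d0 dW] := @absorbing _ _ (restrictScal (real_subfield L) D) W w W0.
have c0 : 0 < d / 2 by lra.
have Ww : W (rinc (d / 2) *: w) by have := dW (d / 2); rewrite gtr0_norm//; apply; lra.
have := tt' _ Ww; rewrite !(act_multilinear_homog S _ _ (fs_mlin S _)).
by apply: scalerI; rewrite rinc_eq0 expf_neq0// gt_eqF.
Qed.

End SeriesOfMultilinearMaps.

(** * Complexification of a function space *)

Section ComplexifiedFunctionSpace.
Context (R : realType) (L : scalars) (I : finType)
  (E : I -> tvsType (scal R L)) (F T : tvsType (scal R Reals))
  (m : convergence_mode) (ev : T -> prod_topology E -> F)
  (act : scal R L -> F -> F).
Local Notation D := (prod_topology E).
Context (S : function_space m ev act).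

Definition complex_ev (t : complexification T) (w : D) : complexification F :=
  (ev t.1 w, ev t.2 w).
Definition complex_act (c : scal R L) (z : complexification F) : complexification F :=
  (act c z.1, act c z.2).

Lemma nbhs_complexificationP (G : tvsType R) (x : complexification G) (A : set (complexification G)) :
  nbhs x A <-> exists2 B : set G * set G, nbhs x.1 B.1 /\ nbhs x.2 B.2 & B.1 `*` B.2 `<=` A.
Proof. by case: x => x1 x2; split=> -[B]; exists B. Qed.

Lemma complex_function_space :
  @function_space R Complexes L I E (complexification F) (complexification T) m complex_ev complex_act.
Proof.
split.
- exact: complexification_hausdorff (fs_hausdorff S).
- exact: fs_index S.
- move=> a t t' v; apply: injective_projections; rewrite /complex_ev /=.
    by rewrite (fs_evD S) (fs_evB S) !(fs_evZ S).
  by rewrite (fs_evD S) (fs_evD S) !(fs_evZ S).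
- move=> t A; split.
    move=> /nbhs_complexificationP[[A1 A2] /= [/(fs_nbhs S)[B1 [W1 [mB1 W10 BW1]]]
      /(fs_nbhs S)[B2 [W2 [mB2 W20 BW2]]]] AA].
    exists (B1 `|` B2), (W1 `*` W2); split; first exact: mode_setsU.
      by apply/nbhs_complexificationP; exists (W1, W2).
    move=> t' tt'; rewrite [t']surjective_pairing; apply: AA; split.
      by apply: BW1 => v Bv; have [] := tt' v (or_introl Bv).
    by apply: BW2 => v Bv; have [] := tt' v (or_intror Bv).
  move=> [B [W [mB /nbhs_complexificationP[[W1 W2] /= [W10 W20] WW] BA]]].
  apply/nbhs_complexificationP.
  exists ([set t' | forall v, B v -> W1 (ev t' v - ev t.1 v)],
          [set t' | forall v, B v -> W2 (ev t' v - ev t.2 v)]).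
    by split; apply/(fs_nbhs S); [exists B, W1|exists B, W2].
  by move=> t' [/= h1 h2]; apply: BA => v Bv; apply: WW; split; [exact: h1|exact: h2].
- by move=> t i v a x y; apply: injective_projections; exact: (fs_mlin S).
- move=> t w; apply: (@cvg_pair _ _ _ (nbhs w) (nbhs (ev t.1 w)) (nbhs (ev t.2 w)));
    exact: (fs_cont S).
- move=> u mu cu.
  have [|w|t1 t1E] := fs_surj S (u := fst \o u).
  + by move=> i v a x y /=; rewrite mu.
  + apply: (@cvg_comp _ _ _ u fst (nbhs w) (nbhs (u w))); [exact: cu|exact: cvg_fst].
  have [|w|t2 t2E] := fs_surj S (u := snd \o u).
  + by move=> i v a x y /=; rewrite mu.
  + apply: (@cvg_comp _ _ _ u snd (nbhs w) (nbhs (u w))); [exact: cu|exact: cvg_snd].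
  exists (t1, t2); apply/funext => w; rewrite /complex_ev /= t1E t2E.
  by rewrite [RHS]surjective_pairing.
- move=> t t' tt'; apply: injective_projections; apply: (fs_inj S); apply/funext => w.
    by have := congr1 (fun u => (u w).1) tt'.
  by have := congr1 (fun u => (u w).2) tt'.
- move=> c a x y; apply: injective_projections => /=.
    by rewrite (actD S) !(actD S) (actN S) !(actZ S).
  by rewrite (actD S) !(actD S) !(actZ S).
- move=> c z; apply: (@cvg_pair _ _ _ (nbhs z) (nbhs (act c z.1)) (nbhs (act c z.2))).
    apply: (@cvg_comp _ _ _ fst (act c) (nbhs z) (nbhs z.1)); [exact: cvg_fst|exact: (fs_act_cont S)].
  apply: (@cvg_comp _ _ _ snd (act c) (nbhs z) (nbhs z.2)); [exact: cvg_snd|exact: (fs_act_cont S)].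
- move=> a z; rewrite [RHS](complexification_scale_real a z).
  by apply: injective_projections; exact: (fs_act_real S).
Qed.

End ComplexifiedFunctionSpace.

Section PolynomialOfMultilinearMaps.
Context (R : realType) (K L : scalars) (I : finType)
  (E : I -> tvsType (scal R L)) (F T : tvsType (scal R K))
  (m : convergence_mode) (ev : T -> prod_topology E -> F)
  (act : scal R L -> F -> F).
Local Notation D := (prod_topology E).
Context (S : function_space m ev act).

(** By uniqueness of coefficients, multilinearity at all real t forces each [c i] to be multilinear,
    and then every z is admissible. *)
Lemma multilinear_coef n (c : nat -> D -> F) :
  (forall t : R, act_multilinear act (fun w => \sum_(i < n.+1) rinc t ^+ i *: c i w)) ->
  forall z, act_multilinear act (fun w => \sum_(i < n.+1) z ^+ i *: c i w).
Proof.
move=> mc z; apply: (act_multilinear_sum S) => -[i /= ni] _ j v a u u'.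
pose w3 : D := dfwith v j (a *: u + u').
pose w1 : D := dfwith v j u; pose w2 : D := dfwith v j u'.
suff e : c i w3 = act a (c i w1) + c i w2.
  change (z ^+ i *: c i w3 = act a (z ^+ i *: c i w1) + z ^+ i *: c i w2).
  by rewrite (actZ S) -scalerDr e.
pose d l := if (l < n.+1)%N then c l w3 - (act a (c l w1) + c l w2) else 0.
suff : d i = 0 by rewrite /d ni => /eqP; rewrite subr_eq0 => /eqP.
apply: (@power_series_eq0 _ _ F (fs_hausdorff S) d 1 ltr01) => t _.
have ds : \sum_(l < n.+1) rinc t ^+ l *: d l = 0.
  have := mc t j v a u u'; rewrite (act_sum S) -big_split /=.
  move=> /eqP; rewrite -subr_eq0 -sumrB => /eqP h; rewrite -[RHS]h.
  apply: eq_bigr => l _; rewrite /d ltn_ord (actZ S) -scalerDr -scalerBr.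
  by [].
rewrite -[X in power_series _ _ X]ds; apply: finite_power_series => l nl.
by rewrite /d ltnNge nl.
Qed.

End PolynomialOfMultilinearMaps.

(** * Complex analytic extension of the curried map *)

Section RealAnalyticCurry.
Context (R : realType) (L : scalars) (s : subfield Reals L) (I : finType)
  (E : I -> tvsType (scal R L)) (F T : tvsType (scal R Reals))
  (m : convergence_mode) (ev : T -> prod_topology E -> F)
  (act : scal R L -> F -> F).
Local Notation D := (prod_topology E).
Local Notation C := (scal R Complexes).
Context (S : function_space m ev act).
Context (X : tvsType (scal R Reals)) (U : set X) (oU : open U) (f : X -> T).
Local Notation Xc := (complexification X : tvsType C).
Local Notation Z := ((X * restrictScal s D)%type : tvsType (scal R Reals)).
Local Notation Zc := (@complexification R Z : tvsType C).
Local Notation Fc := (complexification F : tvsType C).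
Let Sc := complex_function_space S.

(** Only X is complexified: w keeps imaginary part 0, because the extension of f must still take
    values in multilinear maps on D. *)
Definition complex_pair (xi : Xc) (w : D) : Zc := ((xi.1, w), (xi.2, 0)).

Lemma complex_pairD x y v w : complex_pair (x + y) (v + w) = complex_pair x v + complex_pair y w.
Proof.
by apply: injective_projections; apply: injective_projections; rewrite //= addr0.
Qed.

Lemma complex_pairZ (a : C) x : complex_pair (a *: x) 0 = a *: complex_pair x 0.
Proof.
rewrite [a *: x]complexification_scaleE [RHS]complexification_scaleE.
apply: injective_projections; apply: injective_projections => //=.
  by rewrite !scaler0 subrr.
by rewrite !scaler0 addr0.
Qed.

Lemma complex_pair_real (t : R) w : complex_pair 0 (rinc t *: w) = rinc t *: complex_pair 0 w.
Proof.
rewrite [RHS](complexification_scale_real t (complex_pair 0 w)).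
apply: injective_projections; apply: injective_projections; rewrite //= ?scaler0//.
by rewrite -[in LHS](scal_incl_rinc s t).
Qed.

Lemma complex_pair_cont : continuous (fun q : Xc * D => complex_pair q.1 q.2).
Proof.
move=> [[x y] w].
have h1 : (fun q : Xc * D => q.1) @ ((x, y), w) --> ((x, y) : Xc) by exact: cvg_fst.
have h2 : (fun q : Xc * D => q.2) @ ((x, y), w) --> w by exact: cvg_snd.
have h11 : (fun q : Xc * D => q.1.1) @ ((x, y), w) --> x.
  apply: (@cvg_comp _ _ _ _ fst _ (nbhs (x, y)) (nbhs x) h1); exact: cvg_fst.
have h12 : (fun q : Xc * D => q.1.2) @ ((x, y), w) --> y.
  apply: (@cvg_comp _ _ _ _ snd _ (nbhs (x, y)) (nbhs y) h1); exact: cvg_snd.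
apply: (@cvg_pair _ _ _ _ (nbhs ((x, w) : X * restrictScal s D)) (nbhs ((y, 0) : X * restrictScal s D))).
  exact: (@cvg_pair _ _ _ _ (nbhs x) (nbhs w)).
apply: (@cvg_pair _ _ _ _ (nbhs y) (nbhs (0 : D))) => //; exact: cvg_cst.
Qed.

Section Extension.
Context (V : set (@complexification R Z))
  (g : @complexification R Z -> complexification F).
Hypotheses (oV : open V) (UV : forall q : X * restrictScal s D, U q.1 -> V (q, 0))
  (ga : @complex_analytic R (@complexification R Z) (complexification F) V g)
  (gf : forall q : X * restrictScal s D, U q.1 -> g (q, 0) = (ev (f q.1) q.2, 0)).

Lemma real_pair x w : complex_pair (x, 0) w = ((x, w), 0).
Proof. by []. Qed.

Section LocalExtension.
Variables (x : X) (Ux : U x) (Y : set Zc) (b : nat -> Zc -> Fc).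
Hypothesis Y0 : nbhs 0 Y.
Hypothesis bh : forall n, homogeneous_poly n (b n).
Hypothesis bs : forall y, Y y -> (fun N => \sum_(n < N) b n y) @ \oo --> g (complex_pair (x, 0) 0 + y).

Lemma real_direction_mlin n (y : X) :
  @act_multilinear R Complexes L I E Fc (complex_act act) (fun w => b n (complex_pair (y, 0) w)).
Proof.
move: n; apply: (series_multilinear Sc (phi := fun t : R => (f (x + t *: y), 0))
  (b := fun n w => b n (complex_pair (y, 0) w))) => w.
have [d d0 dY] := absorbing (complex_pair (y, 0) w) Y0.
have [d' d'0 dU] := segment_near y 0 (nbhsU oU Ux).
exists (Num.min d d' / 2) => [|t /andP[t0 td]]; first by rewrite divr_gt0// lt_min d0.
have : t < Num.min d d' by rewrite (le_lt_trans td)// gtr_pMr ?lt_min ?d0//; lra.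
rewrite lt_min => /andP[td1 td2].
have Uxt : U (x + t *: y).
  by have := dU t 0; rewrite scaler0 addr0 sabs0; apply => //; rewrite -[t]/(@rinc R Reals t) sabs_rinc gtr0_norm.
have Yt : Y (rinc t *: complex_pair (y, 0) w) by apply: dY; rewrite gtr0_norm.
have := local_power_series bh bs Yt.
have -> : complex_pair (x, 0) 0 + rinc t *: complex_pair (y, 0) w = ((x + t *: y, rinc t *: w), 0).
  rewrite -(iota_scale complex_pairD complex_pairZ complex_pair_real) -complex_pairD.
  rewrite (complexification_scale_real t (y, 0)) add0r.
  by apply: injective_projections; apply: injective_projections; rewrite //= scaler0 addr0.
rewrite gf// /complex_ev /= (fs_ev0 S); exact.
Qed.

Lemma complex_direction_mlin n (y : Xc) :
  @act_multilinear R Complexes L I E Fc (complex_act act) (fun w => b n (complex_pair y w)).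
Proof.
have [c [_ ce cs]] := homogeneous_poly_expand (bh n).
(* y is the value at z = i, while real z give real directions. *)
pose yz z : Xc := (y.1, 0) + z *: ((y.2, 0) : Xc).
have e z w : b n (complex_pair (yz z) w) =
    \sum_(i < n.+1) z ^+ i *: c i (complex_pair (y.2, 0) 0) (complex_pair (y.1, 0) w).
  have -> : complex_pair (yz z) w = z *: complex_pair (y.2, 0) 0 + complex_pair (y.1, 0) w.
    by rewrite -complex_pairZ -complex_pairD add0r addrC.
  rewrite ce; apply: eq_bigr => i _.
  by have := cs i z 1 (complex_pair (y.2, 0) 0) (complex_pair (y.1, 0) w) (ltn_ord i);
    rewrite scale1r expr1n mulr1.
have yzi : yz (imag_unit R) = y.
  rewrite /yz [_ *: _]complexification_scaleE /= !scale0r scaler0 subrr scale1r.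
  by apply: injective_projections; rewrite /= ?addr0 ?add0r.
have -> : (fun w => b n (complex_pair y w)) = (fun w => \sum_(i < n.+1) imag_unit R ^+ i *:
    c i (complex_pair (y.2, 0) 0) (complex_pair (y.1, 0) w)).
  by apply/funext => w; rewrite -e yzi.
refine (@multilinear_coef _ _ _ _ _ _ _ _ _ _ Sc n
  (fun i w => c i (complex_pair (y.2, 0) 0) (complex_pair (y.1, 0) w)) _ (imag_unit R)) => t.
have -> : (fun w => \sum_(i < n.+1) rinc t ^+ i *: c i (complex_pair (y.2, 0) 0) (complex_pair (y.1, 0) w)) =
    (fun w => b n (complex_pair (y.1 + t *: y.2, 0) w)).
  apply/funext => w; rewrite -e; congr (b n (complex_pair _ w)).
  rewrite /yz (complexification_scale_real t (y.2, 0)).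
  by apply: injective_projections; rewrite //= scaler0 addr0.
exact: real_direction_mlin.
Qed.

End LocalExtension.

(** Asking for all xi' near xi, with one W, makes the set open at once and supplies the uniform W
    that [pullback_analytic] uses. *)
Definition extendable (xi : Xc) := exists (Y : set Xc) (W : set D), [/\ nbhs xi Y, nbhs 0 W &
  forall xi', Y xi' -> exists t, forall w, W w ->
    V (complex_pair xi' w) /\ complex_ev ev t w = g (complex_pair xi' w)].

Lemma extendable_open : open extendable.
Proof.
rewrite openE => xi [Y [W [xiY W0 YW]]].
by apply: filterS (nbhs_interior xiY) => xi' xi'Y; exists Y, W.
Qed.

Lemma extendable_real x : U x -> extendable (x, 0).
Proof.
move=> Ux; have Vx : V (complex_pair (x, 0) 0) by exact: UV.
have [Y [Y0 YV [b bP bs]]] := complex_analytic_expansion ga Vx.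
have [Y1 [W [Y10 W0 YW]]] := iota_near complex_pairZ complex_pair_cont Y0.
exists [set xi | Y1 (xi - (x, 0))], W^°; split.
- by apply/nbhs_add; apply: filterS Y10 => y Yy; rewrite /= addrAC subrr add0r.
- exact: nbhs_interior.
move=> xi Yxi; set y := xi - (x, 0).
have pE w : complex_pair xi w = complex_pair (x, 0) 0 + complex_pair y w.
  by rewrite -complex_pairD add0r /y addrC subrK.
have Vxi w : W w -> V (complex_pair xi w) by move=> Ww; rewrite pE; apply/YV/YW.
have hc w : W^° w -> (fun w => g (complex_pair xi w)) @ w --> g (complex_pair xi w).
  move=> /interior_subset Ww.
  apply: (@cvg_comp _ _ _ (complex_pair xi) g (nbhs w) (nbhs (complex_pair xi w))); last first.
    exact: (analytic_continuous_at oV ga (Vxi w Ww)).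
  apply: (@cvg_comp _ _ _ (fun w => (xi, w)) (fun q : Xc * D => complex_pair q.1 q.2) (nbhs w)
    (nbhs (xi, w)) (nbhs (complex_pair xi w))); last exact: (@complex_pair_cont (xi, w)).
  by apply: (@cvg_pair _ _ _ (nbhs w) (nbhs xi) (nbhs w)); [exact: cvg_cst|exact: cvg_id].
have hs w : W^° w -> (fun N => \sum_(n < N) b n (complex_pair y w)) @ \oo --> g (complex_pair xi w).
  by move=> /interior_subset Ww; rewrite pE; apply/bs/YW.
have [t tE] := @multilinear_series _ _ _ _ _ _ _ _ _ _ Sc (fun n w => b n (complex_pair y w)) W^°
  (fun w => g (complex_pair xi w)) (open_interior W) (nbhs_singleton (nbhs_interior W0))
  (fun n => complex_direction_mlin Ux Y0 (fun n => (bP n).1) bs n y) hc hs.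
by exists t => w Ww; split; [apply: Vxi; exact: interior_subset|exact: tE].
Qed.

(** The choice is unique, since a multilinear map is determined by its values near 0; the default 0
    occurs outside the set of extendable points only. *)
Definition extension (xi : Xc) : complexification T :=
  xget 0 [set t | exists2 W : set D, nbhs 0 W &
    forall w, W w -> complex_ev ev t w = g (complex_pair xi w)].

Lemma extensionE xi t (W : set D) : nbhs 0 W ->
  (forall w, W w -> complex_ev ev t w = g (complex_pair xi w)) -> extension xi = t.
Proof.
move=> W0 Wt; rewrite /extension; case: xgetP => [t' _ [W' W'0 W't']|/(_ t)[]]; last by exists W.
apply: (@fs_agree _ _ _ _ _ _ _ _ _ _ Sc _ _ (W `&` W')); first exact: filterI.
by move=> w [Ww W'w]; rewrite W't'// Wt.
Qed.

Lemma extension_analytic : @complex_analytic R (complexification X) (complexification T) extendable extension.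
Proof.
refine (@pullback_analytic _ _ _ _ _ _ _ _ _ Sc Xc Zc complex_pair complex_pairD complex_pairZ
  complex_pair_real complex_pair_cont V oV g ga extendable extension extendable_open _).
move=> xi [Y [W [xiY W0 YW]]].
exists [set y | Y^° (xi + y)], W; split=> //.
  exact: ((nbhs_add xi Y^°).1 (nbhs_interior xiY)).
move=> y w /= Yy Ww; have [t tW] := YW _ (interior_subset Yy).
split; [by have [] := tW w Ww|by exists Y, W|].
rewrite (extensionE W0 (t := t)) => [|w' Ww']; [by have [] := tW w Ww|by have [] := tW w' Ww'].
Qed.

Lemma extension_real x : U x -> extension (x, 0) = (f x, 0).
Proof.
move=> Ux; apply: (extensionE filterT) => w _.
by rewrite real_pair gf// /complex_ev /= (fs_ev0 S).
Qed.

End Extension.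

Lemma real_analytic_curry :
  @analytic R Reals Z F (U `*` setT) (fun q => ev (f q.1) q.2) -> @analytic R Reals X T U f.
Proof.
move=> [V [g [oV UV ga gf]]].
have UV' (q : Z) : U q.1 -> V (q, 0) by move=> Uq; apply: UV.
have gf' (q : Z) : U q.1 -> g (q, 0) = (ev (f q.1) q.2, 0) by move=> Uq; apply: gf.
exists (extendable V g), (extension g); split.
- exact: extendable_open.
- by move=> x Ux; exact: (extendable_real oV UV' ga gf' Ux).
- exact: extension_analytic.
- by move=> x Ux; exact: extension_real.
Qed.

End RealAnalyticCurry.

Section RealCase.
Context (R : realType) (L : scalars) (s : subfield Reals L) (k : nat)
  (E : 'I_k -> tvsType (scal R L)) (F : tvsType (scal R L)).
Hypotheses (k0 : (0 < k)%N) (hF : hausdorff_space F).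

Lemma real_analytic_into (m : convergence_mode) (X : tvsType (scal R Reals)) (U : set X)
    (f : X -> contMultilinear E F) : open U ->
  @analytic R Reals _ (restrictScal s F) (U `*` setT) (uncurried s f) ->
  @analytic R Reals X (restrictScal s (multilinSpace m E F)) U (into s m f).
Proof.
move=> oU fa.
exact: (real_analytic_curry (multilin_function_space s E k0 hF m) oU (f := into s m f) fa).
Qed.

End RealCase.

(** * Derivatives in the analytic case and conclusion *)

Section AnalyticCurry.
Context (R : realType) (K L : scalars) (s : subfield K L) (k : nat)
  (E : 'I_k -> tvsType (scal R L)) (F : tvsType (scal R L)).
Hypotheses (k0 : (0 < k)%N) (hF : hausdorff_space F).

Lemma fs_is_dirderiv (I : finType) (E' : I -> tvsType (scal R L)) (F' T X : tvsType (scal R K))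
    m (ev : T -> prod_topology E' -> F') act (f : X -> T) y x l v :
  function_space m ev act -> is_dirderiv f y x l -> is_dirderiv (fun x => ev (f x) v) y x (ev l v).
Proof.
move=> S /(fs_ev_cvg S (v := v)); rewrite /is_dirderiv.
have -> : (fun t : scal R K => ev (t^-1 *: (f (x + t *: y) - f x)) v) =
    (fun t => t^-1 *: (ev (f (x + t *: y)) v - ev (f x) v)).
  by apply/funext => t; rewrite (fs_evZ S) (fs_evB S).
by [].
Qed.

Context (m : convergence_mode) (X : tvsType (scal R K)) (U : set X) (oU : open U).
Let S := multilin_function_space s E k0 hF m.

Lemma analytic_into (f : X -> contMultilinear E F) :
  analytic (U `*` setT) (uncurried s f) -> analytic U (into s m f).
Proof.
case: K s X U oU f => s' X' U' oU' f; first exact: real_analytic_into.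
exact: complex_analytic_into.
Qed.

(** The induction returns to maps of the same kind: [dirderiv (into s m f) y] is again
    multilinear-valued, and its uncurried map is the derivative of f^ along (y, 0), hence
    analytic. *)
Lemma analytic_iter_dirderiv (f : X -> contMultilinear E F) ys x v :
  analytic (U `*` setT) (uncurried s f) -> U x ->
  mlin_ev (iter_dirderiv (into s m f) ys x) v = iter_dirderiv (fun x => uncurried s f (x, v)) ys x.
Proof.
move=> + Ux; elim: ys f => // y ys ih f fa.
have [fd _] := analytic_dirderiv oU y (fs_T_hausdorff S) (analytic_into fa).
have fdE x' v' : U x' -> dirderiv (fun x => uncurried s f (x, v')) y x' =
    mlin_ev (dirderiv (into s m f) y x') v'.
  by move=> Ux'; apply/dirderivE => //;
    exact (fs_is_dirderiv (v := v') S (dirderivP (fd x' Ux'))).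
have f1a : analytic (U `*` setT) (uncurried s (dirderiv (into s m f) y : X -> contMultilinear E F)).
  have [_] := analytic_dirderiv (open_setXT oU) (y, 0) (hF : hausdorff_space (restrictScal s F)) fa.
  apply: eq_analytic; first exact: open_setXT.
  by move=> [x' v']; rewrite inE => -[/= Ux' _]; rewrite dirderiv_slice fdE.
rewrite /= (ih _ f1a); apply: (eq_iter_dirderiv oU); last by rewrite inE.
by move=> x'; rewrite inE => Ux'; rewrite fdE.
Qed.

Lemma analytic_multilin (f : X -> contMultilinear E F) :
  analytic (U `*` setT) (uncurried s f) ->
  analytic U (into s m f) /\
  forall j x v (y : 'I_j -> X), U x ->
    (dpow (into s m f) x y : contMultilinear E F) v =
    dpow (uncurried s f) (x, v) (fun i => (y i, 0)).
Proof.
move=> fa; split=> [|j x v y Ux]; first exact: analytic_into.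
rewrite {2}/dpow (map_comp (fun y => (y, 0)) y) iter_dirderiv_slice.
exact: analytic_iter_dirderiv.
Qed.

Lemma smooth_multilin (f : X -> contMultilinear E F) r : order_le (mode_loss m) r ->
  smooth r (U `*` setT) (uncurried s f) ->
  smooth (mode_order m r) U (into s m f) /\
  forall j, order_le j (mode_order m r) ->
    forall x v (y : 'I_j -> X), U x ->
      (dpow (into s m f) x y : contMultilinear E F) v =
      dpow (uncurried s f) (x, v) (fun i => (y i, 0)).
Proof.
case: r => [n|mr|_ fa] /=.
- by move=> mr /(keller_multilin (r := finite_order n) k0 hF oU mr); case: (m).
- by move=> /(keller_multilin (m := m) (r := infinite_order) k0 hF oU mr); case: (m).
have [h1 h2] := analytic_multilin fa.
by split=> [|j _ x v y]; [case: (m) h1|exact: h2].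
Qed.

End AnalyticCurry.

Theorem proposition2p1 (R : realType) (K L : scalars) (s : subfield K L)
    (k : nat) (hk : (0 < k)%N) (r : smoothness)
    (E : 'I_k -> tvsType (scal R L)) (F : tvsType (scal R L))
    (X : tvsType (scal R K))
    (hE : forall i, hausdorff_space (E i)) (hF : hausdorff_space F)
    (hX : hausdorff_space X)
    (U : set X) (hU : open U) (f : X -> contMultilinear E F)
    (hf : smooth r (U `*` setT) (uncurried s f)) :
  (smooth r U (into s on_compact f) /\
   forall j, (0 < j)%N -> order_le j r ->
     forall (x : X) (v : prod_topology E) (y : 'I_j -> X), U x ->
       (dpow (into s on_compact f) x y : contMultilinear E F) v =
       dpow (uncurried s f) (x, v) (fun i => (y i, 0))) /\
  (order_le 1 r ->
   smooth (order_pred r) U (into s on_bounded f) /\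
   forall j, (0 < j)%N -> order_le j (order_pred r) ->
     forall (x : X) (v : prod_topology E) (y : 'I_j -> X), U x ->
       (dpow (into s on_bounded f) x y : contMultilinear E F) v =
       dpow (uncurried s f) (x, v) (fun i => (y i, 0))).
Proof.
split.
  have r0 : order_le (mode_loss on_compact) r by case: (r).
  have [fs fd] := smooth_multilin hk hF hU r0 hf.
  by split=> // j _; exact: fd.
move=> r1; have [fs fd] := smooth_multilin (m := on_bounded) hk hF hU r1 hf.
by split=> // j _; exact: fd.
Qed.
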